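(* There exist universal constants $C>0$ and $\delta_0>0$ and a randomized algorithm that, given a $d\times d$ positive semidefinite matrix $A$ together with its eigenvalues $\gamma_1\ge\cdots\ge\gamma_d>0$, an integer $1\le k\le d$, an $\varepsilon>0$ and a $\delta\in(0,\delta_0)$, outputs a $d\times d$ Hermitian projection $P$ of rank $k$ such that the following hold. (1) (Utility) $\displaystyle \mathbb{E}_P\big[\langle A,P\rangle\big]\ge(1-\delta)\sum_{i=1}^k\gamma_i$ as long as $\displaystyle \sum_{i=1}^k\gamma_i\ge C\cdot\frac{dk}{\varepsilon\delta}\cdot\log\frac1\delta$. (2) (Privacy) The algorithm is $\varepsilon$-differentially private. (3) (Complexity) The number of arithmetic operations required by the algorithm is polynomial in $\gamma_1-\gamma_d$, $\frac1\varepsilon$, and the number of bits required to represent $\gamma=(\gamma_1,\dots,\gamma_d)$.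
   Context: $\langle A,P\rangle=\operatorname{Tr}(A^*P)$. Differential privacy is with respect to the following data model. There is a universe $\mathcal{U}$ of users, and each $u\in\mathcal{U}$ has a vector $v_u\in\mathbb{R}^d$ with $\|v_u\|_2\le1$. A dataset $D\subseteq\mathcal{U}$ gives the matrix $A=\sum_{u\in D}v_uv_u^*$. A randomized mechanism $\mathcal{M}:\mathbb{R}^{d\times d}\to R$ (here $R$ is the space of rank-$k$ $d\times d$ Hermitian matrices) is $\varepsilon$-differentially private, also called $(\varepsilon,0)$-differentially private, if for all (measurable) $S\subseteq R$ and all $D,D'\subseteq\mathcal{U}$ whose symmetric difference $D\Delta D'$ has cardinality $2$ (neighbouring matrices are treated as being of the form $A'=A-v_1v_1^*+v_2v_2^*$ with $\|v_1\|_2,\|v_2\|_2\le1$), one has $\Pr[\mathcal{M}(A)\in S]\le e^{\varepsilon}\Pr[\mathcal{M}(A')\in S]$, where $A=\sum_{u\in D}v_uv_u^*$ and $A'=\sum_{u\in D'}v_uv_u^*$. Computational conventions: the numbers $\gamma_i$ are rational and given in binary (so the number of bits is at least $d$). Cost is measured in the number of arithmetic operations on real/complex numbers. It is assumed that a Hermitian matrix can be exactly unitarily diagonalized, that square roots and the exponential density can be evaluated exactly, and that exact uniform samples from unit spheres in $\mathbb{C}^m$ (equivalently, Haar-random unitary matrices) can be drawn in $\mathrm{poly}(m)$ operations. *)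

(* Defs.v *)
From HB Require Import structures.
From mathcomp Require Import all_boot all_order all_algebra.
From mathcomp Require Import complex.
From mathcomp Require Import all_classical all_reals all_analysis.
Set Implicit Arguments.
Unset Strict Implicit.
Unset Printing Implicit Defensive.
Import Order.TTheory GRing.Theory Num.Theory.
Import numFieldNormedType.Exports.
Local Open Scope classical_set_scope.
Local Open Scope ring_scope.
Local Open Scope complex_scope.
Local Open Scope sesquilinear_scope.

Definition psdmx (R : realType) (d : nat) (A : 'M[R[i]]_d) : Prop :=
  A \is hermsymmx /\ forall v : 'rV[R[i]]_d, 0 <= (v *m A *m v^t*) 0 0.

(* gamma lists the eigenvalues of A with multiplicity, in decreasing order. *)
Definition eigenvalues_of (R : realType) (d : nat) (A : 'M[R[i]]_d)
    (gamma : d.-tuple R) : Prop :=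
  char_poly A = \prod_(x <- gamma) ('X - (x%:C)%:P)
  /\ sorted (fun x y => y <= x) gamma.

Definition rank_proj (R : realType) (d k : nat) (P : 'M[R[i]]_d) : Prop :=
  [/\ P \is hermsymmx, P *m P = P & \rank P = k].

(* <A, P> = Tr (A^* P); the trace is real when A and P are Hermitian. *)
Definition mxinner (R : realType) (d : nat) (A P : 'M[R[i]]_d) : R :=
  complex.Re (\tr (A^t* *m P)).

(* Borel sets of complex matrices: the sigma-algebra generated by the real and
   imaginary parts of the entries. *)
Definition mx_measurable (R : realType) (m n : nat) :
    set (set 'M[R[i]]_(m, n)) :=
  <<s [set S | exists (i : 'I_m) (j : 'I_n) (B : set R), measurable B /\
        (S = [set M : 'M[R[i]]_(m, n) | B (complex.Re (M i j))] \/
         S = [set M : 'M[R[i]]_(m, n) | B (complex.Im (M i j))])] >>.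

(* Programs for a real RAM with natural-number registers (indices, counters)
   and a memory of exact complex numbers.  Every operand is a
   natural-number register; in the operations on complex numbers the register
   contains the address of a memory cell.  All program constants are natural
   numbers: arbitrary real constants could encode advice. *)
Inductive instr :=
| NConst of nat & nat
| NAdd of nat & nat & nat
| NSub of nat & nat & nat
| NMul of nat & nat & nat
| CNat of nat & nat
| CImag of nat
| CAdd of nat & nat & nat
| CSub of nat & nat & nat
| CMul of nat & nat & nat
| CDiv of nat & nat & nat
| CConj of nat & nat
| CSqrt of nat & nat
| CExp of nat & nat
| Sphere of nat & nat
| Diag of nat & nat & nat & nat.

Inductive test := NLe of nat & nat | CLe of nat & nat.

Inductive prog :=
| Skip
| Do of instr
| Seq of prog & prog
| If of test & prog & prog
| While of test & prog.

(* draws counts the entries of the random tape already consumed. *)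
Record state (R : realType) :=
  State { reg : nat -> nat; mem : nat -> R[i]; draws : nat }.

Definition upd (T : Type) (f : nat -> T) (a : nat) (v : T) : nat -> T :=
  fun b => if b == a then v else f b.

(* Matrices are stored row by row, starting at address a. *)
Definition load_mx (R : realType) (m n a : nat) (f : nat -> R[i]) :
    'M[R[i]]_(m, n) :=
  \matrix_(i < m, j < n) f (a + i * n + j)%N.

Definition store_mx (R : realType) (m n a : nat) (M : 'M[R[i]]_(m, n))
    (f : nat -> R[i]) : nat -> R[i] :=
  fun b => if [pick ij : 'I_m * 'I_n | b == (a + ij.1 * n + ij.2)%N] is Some ij
           then M ij.1 ij.2 else f b.

(* Normalizing a standard Gaussian vector of C^m, read from the tape xi from
   position p on, gives a uniform vector of the unit sphere of C^m. *)
Definition sphere_vec (R : realType) (xi : nat -> R) (p m : nat) :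
    'rV[R[i]]_m :=
  let s := Num.sqrt (\sum_(j < m.*2) xi (p + j)%N ^+ 2) in
  \row_(j < m) ((xi (p + j.*2)%N / s) +i* (xi (p + j.*2.+1)%N / s)).

(* Unitary diagonalization: on H the routine returns (U, l). *)
Definition diag_routine (R : realType) : Type :=
  forall m : nat, 'M[R[i]]_m -> 'M[R[i]]_m * 'rV[R[i]]_m.

(* Which eigenbasis is returned, and in which order, is left open; it has to
   depend measurably on the matrix, so that outputs are random variables. *)
Definition exact_diag (R : realType) (dg : diag_routine R) : Prop :=
  [/\ forall m (H : 'M[R[i]]_m), H \is hermsymmx ->
        (dg m H).1 \is unitarymx /\
        H = (dg m H).1 *m diag_mx (dg m H).2 *m (dg m H).1^t*,
      forall m S, mx_measurable S ->
        mx_measurable [set H : 'M[R[i]]_m | S (dg m H).1]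
    & forall m S, mx_measurable S ->
        mx_measurable [set H : 'M[R[i]]_m | S (dg m H).2]].

(* CSqrt and CExp act on the real part of their argument. *)
Definition instr_step (R : realType) (dg : diag_routine R) (xi : nat -> R)
    (o : instr) (s : state R) : state R :=
  let N := reg s in
  let M := mem s in
  let val x := M (N x) in
  let setN x v := State (upd N x v) M (draws s) in
  let setM x v := State N (upd M (N x) v) (draws s) in
  match o with
  | NConst x n => setN x n
  | NAdd x y z => setN x (N y + N z)%N
  | NSub x y z => setN x (N y - N z)%N
  | NMul x y z => setN x (N y * N z)%N
  | CNat x y => setM x (N y)%:R
  | CImag x => setM x 'i
  | CAdd x y z => setM x (val y + val z)
  | CSub x y z => setM x (val y - val z)
  | CMul x y z => setM x (val y * val z)
  | CDiv x y z => setM x (val y / val z)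
  | CConj x y => setM x (conjc (val y))
  | CSqrt x y => setM x (Num.sqrt (complex.Re (val y)))%:C
  | CExp x y => setM x (expR (complex.Re (val y)))%:C
  | Sphere x y =>
      State N (store_mx (N x) (sphere_vec xi (draws s) (N y)) M)
        (draws s + (N y).*2)%N
  | Diag u l h n =>
      let e := dg (N n) (load_mx (N n) (N n) (N h) M) in
      State N (store_mx (N l) e.2 (store_mx (N u) e.1 M)) (draws s)
  end.

Definition instr_cost (R : realType) (o : instr) (s : state R) : nat :=
  match o with
  | Sphere _ y => (reg s y).+1
  | Diag _ _ _ n => (reg s n ^ 3)%N.+1
  | _ => 1
  end.

Definition test_val (R : realType) (b : test) (s : state R) : bool :=
  match b with
  | NLe x y => (reg s x <= reg s y)%N
  | CLe x y => complex.Re (mem s (reg s x)) <= complex.Re (mem s (reg s y))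
  end.

(* exec dg xi c s s' t: started in s, the program c halts in s' at cost t. *)
Inductive exec (R : realType) (dg : diag_routine R) (xi : nat -> R) :
    prog -> state R -> state R -> nat -> Prop :=
| exec_skip s : exec dg xi Skip s s 0
| exec_do o s : exec dg xi (Do o) s (instr_step dg xi o s) (instr_cost o s)
| exec_seq c1 c2 s1 s2 s3 t1 t2 :
    exec dg xi c1 s1 s2 t1 -> exec dg xi c2 s2 s3 t2 ->
    exec dg xi (Seq c1 c2) s1 s3 (t1 + t2)%N
| exec_if b c1 c2 s s' t :
    exec dg xi (if test_val b s then c1 else c2) s s' t ->
    exec dg xi (If b c1 c2) s s' t.+1
| exec_while b c s s' t :
    exec dg xi (If b (Seq c (While b c)) Skip) s s' t ->
    exec dg xi (While b c) s s' t.

(* Registers 0 and 1 hold d and k; the memory holds epsilon, delta,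
   gamma_1, ..., gamma_d, and then the entries of A. *)
Definition init_state (R : realType) (d k : nat) (A : 'M[R[i]]_d)
    (gamma : d.-tuple R) (eps delta : R) : state R :=
  State (upd (upd (fun=> 0%N) 1 k) 0 d)
    (store_mx (2 + d) A
      (store_mx 2 (\row_(j < d) (gamma`_j)%:C)
        (upd (upd (fun=> 0) 1 delta%:C) 0 eps%:C)))
    0.

(* The output matrix is read at address 0; a run that does not halt yields the
   matrix 0, which has rank 0 < k. *)
Definition output (R : realType) (dg : diag_routine R) (p : prog)
    (d k : nat) (A : 'M[R[i]]_d) (gamma : d.-tuple R) (eps delta : R)
    (xi : nat -> R) : 'M[R[i]]_d :=
  xget 0 [set P | exists s t,
    exec dg xi p (init_state k A gamma eps delta) s t /\
    P = load_mx d d 0 (mem s)].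

Definition halts_within (R : realType) (dg : diag_routine R) (p : prog)
    (d k : nat) (A : 'M[R[i]]_d) (gamma : d.-tuple R) (eps delta : R)
    (xi : nat -> R) (T : R) : Prop :=
  exists s t,
    exec dg xi p (init_state k A gamma eps delta) s t /\ t%:R <= T.

(* xi is a sequence of independent standard normal random variables. *)
Definition iid_normal (R : realType) (disp : measure_display)
    (W : measurableType disp) (Pr : probability W R)
    (xi : nat -> {RV Pr >-> R}) : Prop :=
  forall (n : nat) (B : nat -> set R), (forall j, measurable (B j)) ->
    Pr (\bigcap_(j in `I_n) (xi j @^-1` B j)) =
    (\prod_(j < n) normal_prob (0 : R) 1 (B j))%E.

(* The matrix of the dataset D, as a complex matrix. *)
Definition dataset_mx (R : realType) (d : nat) (U : finType)
    (v : U -> 'cV[R]_d) (D : {set U}) : 'M[R[i]]_d :=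
  map_mx (real_complex R) (\sum_(u in D) v u *m (v u)^T).

Definition unit_bounded (R : realType) (d : nat) (U : finType)
    (v : U -> 'cV[R]_d) : Prop :=
  forall u, Num.sqrt (\sum_(i < d) v u i 0 ^+ 2) <= 1.

Definition neighbours (U : finType) (D D' : {set U}) : Prop :=
  #|(D :\: D') :|: (D' :\: D)| = 2%N.

(* Bits of the numerator and denominator in lowest terms, and a sign bit. *)
Definition rat_bits (q : rat) : nat :=
  ((trunc_log 2 `|numq q|).+1 + (trunc_log 2 `|denq q|).+1 + 1)%N.

Definition bits (d : nat) (q : d.-tuple rat) : nat :=
  (\sum_(x <- q) rat_bits x)%N.

(* Main.v *)
(* Let n = 2 d and m = 4 d^2, let G be a d x n matrix and g a vector of R^m with independent
   standard normal entries, and let X = L G G^T / |g|^2 with L = (d n + m) / eps.  The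
   algorithm outputs the projection onto the top k eigenvectors of A + X_1 - X_2, where X_1 and
   X_2 are independent copies of X; G and g are read off the real parts of a vector of a
   sphere, whose normalization cancels in the quotient.

   Privacy: with respect to the image of the Lebesgue measure under G |-> G G^T, the law of X
   has a density proportional to (1 + tr / L)^(- (d n + m) / 2).  That image measure only
   decreases under a shift by v v^T, and the density changes by a factor at most
   exp (|v|^2 (d n + m) / (2 L)).  So the law of X + v v^T is at most exp (eps / 2) times that of
   X if |v| <= 1; X_1 takes care of an inserted and X_2 of a removed rank-one term.

   Utility: by optimality of the output P for the noisy matrix, <A, P> loses at most
   <X_1, P> + <X_2, Q> for the optimal projection Q for A.  Each term is at most
   k L |G|_op^2 / |g|^2, where E |G|_op^2 = O(d) by rounding extremal vectors to a lattice and
   the Gaussian moment generating function, and E |g|^-2 = 1 / (m - 2). *)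
Require Import Defs.
From HB Require Import structures.
From mathcomp Require Import all_boot all_order all_algebra.
From mathcomp Require Import fingroup perm complex.
From mathcomp Require Import all_classical all_reals all_analysis.
From mathcomp Require Import measurable_realfun zify ring lra.
Set Implicit Arguments.
Unset Strict Implicit.
Unset Printing Implicit Defensive.
Import Order.TTheory GRing.Theory Num.Theory.
Import numFieldNormedType.Exports.
Local Open Scope classical_set_scope.
Local Open Scope ring_scope.
Local Open Scope complex_scope.

(** * Lebesgue measure on the line *)

Section leb1.
Variable R : realType.
Local Open Scope ereal_scope.
Notation leb := (@lebesgue_measure R).

(** Randomness comes only from the sphere instruction, which yields directions but no Gaussian
    radii; hence a noise that is a quotient homogeneous of degree 0. The law of X + v v^T is
    dominated by that of X but not conversely, since X + v v^T never leaves the matrices above v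
    v^T; hence two noises with opposite signs. With 2 d columns, each row of G can move in a plane
    orthogonal to the other rows. In a plane the squared length s has constant density on s >= 0, so
    a shift only removes mass; along a single direction the density would be proportional to
    s^(-1/2), which a shift increases. The length m of g is of the order of d n, so that L / (m - 2)
    stays of order 1 / eps although L grows with d n + m. The image measure on Gram matrices is
    never constructed: statements about it are inequalities between iterated Lebesgue integrals over
    single tape cells, for arbitrary nonnegative measurable test functions. Translations and
    dilations of single coordinates then suffice as changes of variables. *)

Lemma lebesgue_shift (c : R) (A : set R) : measurable A ->
  pushforward leb (fun x : measurableTypeR R => (x + c)%R : measurableTypeR R) A = leb A.
Proof.
move=> mA; have mf : measurable_fun setT (fun x : measurableTypeR R => (x + c)%R : measurableTypeR R).
  by apply: measurable_funD.
apply/esym; apply: (@lebesgue_measure_unique R (pushforward leb (fun x : measurableTypeR R => (x + c)%R : measurableTypeR R))) => //= _ [[a b]] _ <-.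
rewrite /pushforward.
have -> : (fun x : R => (x + c)%R) @^-1` `]a, b] = `](a - c)%R, (b - c)%R]%classic.
  by apply/seteqP; split => x /=; rewrite !in_itv/= ltrBlDr lerBrDr.
rewrite !lebesgue_measure_itv/= !lte_fin ltrD2r; case: ifP => // _.
by rewrite -!EFinD; congr EFin; ring.
Qed.

Lemma integral_shift (c : R) (f : R -> \bar R) : measurable_fun setT f ->
  (forall x, 0 <= f x) ->
  \int[leb]_x f (x + c)%R = \int[leb]_x f x.
Proof.
move=> mf f0.
have mg : measurable_fun setT (fun x : measurableTypeR R => (x + c)%R : measurableTypeR R).
  by apply: measurable_funD.
transitivity (\int[pushforward leb (fun x : measurableTypeR R => (x + c)%R : measurableTypeR R)]_y f y).
  by rewrite (ge0_integral_pushforward mg).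
by apply: eq_measure_integral => A mA _; exact: lebesgue_shift.
Qed.

Lemma lebesgue_scale (c : R) (A : set R) : (0 < c)%R -> measurable A ->
  c%:E * pushforward leb (fun x : measurableTypeR R => (c * x)%R : measurableTypeR R) A = leb A.
Proof.
move=> c0 mA; have mf : measurable_fun setT (fun x : measurableTypeR R => (c * x)%R : measurableTypeR R).
  by apply: measurable_funM.
apply/esym; apply: (@lebesgue_measure_unique R (mscale (NngNum (ltW c0)) (pushforward leb (fun x : measurableTypeR R => (c * x)%R : measurableTypeR R)))) => //= _ [[a b]] _ <-.
rewrite /mscale/= /pushforward.
have -> : (fun x : R => (c * x)%R) @^-1` `]a, b] = `](c^-1 * a)%R, (c^-1 * b)%R]%classic.
  by apply/seteqP; split => x /=; rewrite !in_itv/= ltr_pdivrMl// ler_pdivlMl.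
rewrite !lebesgue_measure_itv/= !lte_fin ltr_pM2l ?invr_gt0//; case: ifP => _; last by rewrite mule0.
by rewrite -!EFinD -EFinM; congr EFin; field; rewrite gt_eqF.
Qed.

Lemma integral_scale (c : R) (f : R -> \bar R) : (0 < c)%R -> measurable_fun setT f ->
  (forall x, 0 <= f x) ->
  c%:E * \int[leb]_x f (c * x)%R = \int[leb]_x f x.
Proof.
move=> c0 mf f0.
have mg : measurable_fun setT (fun x : measurableTypeR R => (c * x)%R : measurableTypeR R).
  by apply: measurable_funM.
transitivity (c%:E * \int[pushforward leb (fun x : measurableTypeR R => (c * x)%R : measurableTypeR R)]_y f y).
  by rewrite (ge0_integral_pushforward mg).
rewrite -(@ge0_integral_mscale _ _ R (pushforward leb _) setT (measurableT) (NngNum (ltW c0)))//.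
by apply: eq_measure_integral => A mA _; exact: lebesgue_scale.
Qed.

Lemma lebesgue_integralZl_ereal (k : \bar R) (f : R -> \bar R) : 0 <= k ->
  measurable_fun setT f -> (forall x, 0 <= f x) ->
  \int[leb]_x (k * f x) = k * \int[leb]_x f x.
Proof. by move=> k0 mf f0; rewrite ge0_integralZl. Qed.

Lemma lebesgue_integralZl (k : R) (f : R -> \bar R) : (0 <= k)%R ->
  measurable_fun setT f -> (forall x, 0 <= f x) ->
  \int[leb]_x (k%:E * f x) = k%:E * \int[leb]_x f x.
Proof. by move=> k0; exact: lebesgue_integralZl_ereal. Qed.
End leb1.

(** * Squared norms of points of the plane *)

Section disc.
Variable R : realType.
Local Open Scope ereal_scope.
Notation leb := (@lebesgue_measure R).
Notation MR := (measurableTypeR R).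

Let sq (p : MR * MR) : MR := (p.1 ^+ 2 + p.2 ^+ 2)%R.

Lemma measurable_sq : measurable_fun setT sq.
Proof.
apply: measurable_funD; apply: (@measurableT_comp _ _ _ _ _ _ (fun x : R => x ^+ 2)%R) => //.
Qed.

Let m : {measure set MR -> \bar R}.
Proof. by refine (pushforward (leb \x leb) sq); exact: measurable_sq. Defined.

Lemma integral_m (f : R -> \bar R) : measurable_fun setT f -> (forall x, 0 <= f x) ->
  \int[m]_x f x = \int[leb]_x \int[leb]_y f (x ^+ 2 + y ^+ 2)%R.
Proof.
move=> mf f0; rewrite /m (ge0_integral_pushforward measurable_sq)//= preimage_setT.
have hm := measurable_sq.
rewrite fubini_tonelli1//=.
exact: measurableT_comp.
Qed.

Let D (t : R) : set MR := `]-oo, t]%classic.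
Lemma measurable_D t : measurable (D t). Proof. exact: measurable_itv. Qed.

(** Homogeneity replaces the computation of an area: dilating both variables by sqrt t maps the unit
    disc onto the disc of squared radius t. *)
Lemma m_D_scale t : (0 < t)%R -> m (D t) = t%:E * m (D 1%R).
Proof.
move=> t0.
have mind s : measurable_fun setT (fun u : MR => (\1_(D s) u : R)%:E).
  by apply/measurable_EFinP; apply: measurable_indic; exact: measurable_D.
have mDi s : m (D s) = \int[leb]_x \int[leb]_y (\1_(D s) (x ^+ 2 + y ^+ 2)%R : R)%:E.
  rewrite -(@integral_m (fun u => (\1_(D s) u : R)%:E)) ?integral_indic ?setIT//.
  - exact: measurable_D.
  - by apply/measurable_EFinP; apply: measurable_indic; exact: measurable_D.
rewrite !mDi.
have st : (0 < Num.sqrt t)%R by rewrite sqrtr_gt0.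
have sqt : (Num.sqrt t * Num.sqrt t = t)%R by rewrite -expr2 sqr_sqrtr// ltW.
have mf s x : measurable_fun setT (fun y : R => (\1_(D s) (x ^+ 2 + y ^+ 2)%R : R)%:E).
  have mg : measurable_fun setT (fun y : R => (x ^+ 2 + y ^+ 2)%R : MR).
    by apply: measurable_funD => //; exact: measurable_funX.
  exact: (measurableT_comp (mind s) mg).
under eq_integral.
  move=> x _; rewrite -(integral_scale st (mf t x)); last by move=> y; rewrite lee_fin.
  over.
have mf2 s : measurable_fun setT (fun p : MR * MR => (\1_(D s) (sq p) : R)%:E).
  exact: (measurableT_comp (mind s) measurable_sq).
have mI s : measurable_fun setT (fun x : MR => \int[leb]_y (\1_(D s) (x ^+ 2 + y ^+ 2)%R : R)%:E).
  apply: (measurable_fun_fubini_tonelli_F (fun p : MR * MR => (\1_(D s) (sq p) : R)%:E)) => //.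
have mf3 : measurable_fun setT (fun x : MR => \int[leb]_y (\1_(D t) (x ^+ 2 + (Num.sqrt t * y) ^+ 2)%R : R)%:E).
  apply: (measurable_fun_fubini_tonelli_F (fun p : MR * MR => (\1_(D t) ((p.1 ^+ 2 + (Num.sqrt t * p.2) ^+2)%R) : R)%:E)) => //.
    have mg : measurable_fun setT (fun p : MR * MR => (p.1 ^+ 2 + (Num.sqrt t * p.2) ^+ 2)%R : MR).
      apply: measurable_funD; apply: measurable_funX => //.
      by apply: measurable_funM => //; exact: measurable_snd.
    exact: (measurableT_comp (mind t) mg).
have f30 x : 0 <= \int[leb]_y (\1_(D t) (x ^+ 2 + (Num.sqrt t * y) ^+ 2)%R : R)%:E.
  exact: integral_ge0.
rewrite (lebesgue_integralZl (sqrtr_ge0 t) mf3 f30).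
rewrite -(integral_scale st mf3); last first.
  exact: f30.
rewrite muleA (_ : (Num.sqrt t)%:E * (Num.sqrt t)%:E = t%:E); last by rewrite -EFinM sqt.
apply: (congr1 (fun z => t%:E * z)).
apply: eq_integral => x _; apply: eq_integral => y _; congr EFin.
rewrite /D !indicE; congr (nat_of_bool _)%:R.
apply/idP/idP; rewrite !inE/= !in_itv/= !exprMn -mulrDr sqr_sqrtr ?(ltW t0)//.
  by rewrite ger_pMr.
by rewrite ger_pMr.
Qed.

Lemma m_D1_fin : m (D 1%R) < +oo.
Proof.
apply: (@le_lt_trans _ _ ((leb \x leb) (`[(-1)%R, 1%R]%classic `*` `[(-1)%R, 1%R]%classic))).
  change (m (D 1%R)) with ((leb \x leb) (sq @^-1` D 1%R)).
  apply: le_measure; rewrite ?inE.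
  - by rewrite -[X in measurable X]setTI; apply: measurable_sq => //; exact: measurable_D.
  - by apply: measurableX.
  move=> [x y] /=; rewrite /D /sq /= !in_itv/= => h.
  have hx : (x ^+ 2 <= 1)%R by rewrite (le_trans _ h)// lerDl sqr_ge0.
  have hy : (y ^+ 2 <= 1)%R by rewrite (le_trans _ h)// lerDr sqr_ge0.
  by rewrite -!ler_norml -!(@ler_sqr _ _ 1%R) ?nnegrE ?real_normK ?num_real ?expr1n.
have -> : (leb \x leb) (`[(-1)%R, 1%R]%classic `*` `[(-1)%R, 1%R]%classic) = leb `[(-1)%R, 1%R]%classic * leb `[(-1)%R, 1%R]%classic.
  by apply: product_measure1E; exact: measurable_itv.
by rewrite !lebesgue_measure_itv/= !lte_fin; case: ifP => _; rewrite ?mule0 ?ltry// -EFinB -EFinM ltry.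
Qed.

Lemma m_D1_gt0 : 0 < m (D 1%R).
Proof.
apply: (@lt_le_trans _ _ ((leb \x leb) (`[0%R, (2^-1)%R]%classic `*` `[0%R, (2^-1)%R]%classic))).
  have -> : (leb \x leb) (`[0%R, (2^-1)%R]%classic `*` `[0%R, (2^-1)%R]%classic) = leb `[0%R, (2^-1)%R]%classic * leb `[0%R, (2^-1)%R]%classic.
    by apply: product_measure1E; exact: measurable_itv.
  rewrite !lebesgue_measure_itv/= !lte_fin invr_gt0 ltr0n.
  by rewrite -EFinB -EFinM lte_fin subr0 mulr_gt0// invr_gt0.
change (m (D 1%R)) with ((leb \x leb) (sq @^-1` D 1%R)).
apply: le_measure; rewrite ?inE.
  - by apply: measurableX.
  - by rewrite -[X in measurable X]setTI; apply: measurable_sq => //; exact: measurable_D.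
move=> [x y] /=; rewrite /D /sq /= !in_itv/= => -[/andP[x0 x1] /andP[y0 y1]].
nra.
Qed.

(** The area of the unit disc, that is pi; only its being positive and finite matters. *)
Let c := fine (m (D 1%R)).
Lemma c_gt0 : (0 < c)%R.
Proof. by rewrite fine_gt0// m_D1_gt0 m_D1_fin. Qed.
Lemma m_D1 : m (D 1%R) = c%:E.
Proof. by rewrite fineK// ge0_fin_numE// m_D1_fin. Qed.

Lemma m_D t : m (D t) = (c * Num.max t 0)%:E.
Proof.
have [t0|t0] := ltP 0%R t.
  by rewrite m_D_scale// m_D1 -EFinM mulrC.
(* For t <= 0 the preimage lies in discs of arbitrarily small area e. *)
rewrite mulr0; apply/eqP; rewrite eq_le measure_ge0 andbT.
apply/lee_addgt0Pr => e e0; rewrite add0r.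
apply: (@le_trans _ _ (m (D (e / c)%R))).
  apply: le_measure; rewrite ?inE//; try exact: measurable_itv.
  by move=> x; rewrite /D /= !in_itv/= => /le_trans; apply; rewrite (le_trans t0)// divr_ge0// ltW// c_gt0.
rewrite m_D_scale ?divr_gt0 ?c_gt0// m_D1 -EFinM lee_fin divfK//.
by rewrite gt_eqF ?c_gt0.
Qed.

Lemma cV_ge0 : (0 <= c^-1)%R. Proof. by rewrite invr_ge0 ltW// c_gt0. Qed.
(** The measure [m] lives on the nonnegative half-line. Lebesgue measure on the negative half-line
    is added because uniqueness of Lebesgue measure concerns the whole line. *)
Let m1 : {measure set MR -> \bar R} :=
  measure_add (mscale (NngNum cV_ge0) m) (mrestr leb (measurable_itv `]-oo, 0%R[)).

Lemma lebesgue_eq_m1 A : measurable A -> leb A = m1 A.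
Proof.
apply: lebesgue_measure_unique => _ [[a b]] _ <- /=.
have [ab|ba] := ltP a b; last by rewrite set_itv_ge ?measure0// bnd_simp -leNgt.
have -> : m1 `]a, b]%classic = c^-1%:E * m `]a, b]%classic + leb (`]a, b] `&` `]-oo, 0%R[).
  exact: measure_addE.
have -> : m `]a, b]%classic = (c * (Num.max b 0 - Num.max a 0))%:E.
  have -> : `]a, b]%classic = D b `\` D a.
    apply/seteqP; split => x; rewrite /D /= !in_itv/=.
      by move=> /andP[ax ->]; split => //; apply/negP; rewrite -ltNge.
    by move=> [-> /negP]; rewrite -ltNge andbT.
  have -> : m (D b `\` D a) = m (D b) - m (D b `&` D a).
    apply: measureD; try exact: measurable_itv.
    by apply: (eq_ind_r (fun x => x < +oo) _ (m_D b)); exact: ltry.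
  have -> : D b `&` D a = D a.
    apply/setIidPr => x; rewrite /D/= !in_itv/= => /le_trans; apply; exact: ltW.
  by rewrite !m_D -EFinB mulrBr.
rewrite -EFinM mulKf ?gt_eqF ?c_gt0//.
have [b0|b0] := ltP b 0%R.
  have -> : `]a, b] `&` `]-oo, 0%R[ = `]a, b]%classic.
    by apply/setIidPl => x /=; rewrite !in_itv/= => /andP[_ /le_lt_trans]; apply.
  by rewrite (max_idPr _) ?(ltW (lt_trans ab b0))// subrr add0e.
have [a0|a0] := ltP a 0%R.
  have -> : `]a, b] `&` `]-oo, 0%R[ = `]a, 0%R[%classic.
    apply/seteqP; split => x /=; rewrite !in_itv/=.
      by move=> [/andP[-> _]].
    by move=> /andP[-> x0]; rewrite (ltW (lt_le_trans x0 b0)).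
  rewrite !lebesgue_measure_itv/= !lte_fin ab a0 -!EFinB -EFinD.
  by rewrite subr0 sub0r.
have -> : `]a, b] `&` `]-oo, 0%R[ = set0.
  apply/seteqP; split => x //=; rewrite !in_itv/= => -[/andP[ax _]].
  by rewrite ltNge (ltW (le_lt_trans a0 ax)).
by rewrite measure0 adde0 lebesgue_measure_itv/= lte_fin ab -EFinB.
Qed.

Lemma measurable_patch0 (f : R -> \bar R) : measurable_fun setT f ->
  measurable_fun setT (f \_ `[0%R, +oo[).
Proof.
move=> mf; have mi : measurable (`[0%R, +oo[%classic : set R) by exact: measurable_itv.
have h : measurable_fun (`[0%R, +oo[%classic : set R) f by exact: measurable_funTS.
exact: ((measurable_restrictT f mi).1 h).
Qed.

Lemma integral_polar (f : R -> \bar R) : measurable_fun setT f -> (forall x, 0 <= f x) ->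
  \int[leb]_x \int[leb]_y f (x ^+ 2 + y ^+ 2)%R =
  c%:E * \int[leb]_(s in `[0%R, +oo[) f s.
Proof.
move=> mf f0.
rewrite [in RHS]integral_mkcond [in RHS](eq_measure_integral m1); last by move=> A mA _; exact: lebesgue_eq_m1.
have mg : measurable_fun setT (f \_ `[0%R, +oo[).
  exact: measurable_patch0.
have g0 x : 0 <= (f \_ `[0%R, +oo[) x by rewrite patchE; case: ifP.
rewrite ge0_integral_measure_add// ge0_integral_mscale//= integral_m//.
have -> : \int[mrestr leb (measurable_itv `]-oo, 0%R[)]_x (f \_ `[0%R, +oo[) x = 0.
  rewrite -integral_mkcond; apply: null_set_integral.
  - exact: measurable_itv.
  - exact: measurable_funTS.
  rewrite /= /mrestr (_ : _ `&` _ = set0) ?measure0//.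
  apply/seteqP; split => x //=; rewrite !in_itv/= andbT => -[x0].
  by rewrite ltNge x0.
rewrite adde0 muleA -EFinM divff ?gt_eqF ?c_gt0// mul1e.
apply: eq_integral => x _; apply: eq_integral => y _.
by rewrite patchE mem_set//= in_itv/= andbT addr_ge0 ?sqr_ge0.
Qed.

(* In polar coordinates the area element is proportional to [d(r^2)], so
   shifting the squared radius only removes mass. *)
Lemma integral_sqr_shift (f : R -> \bar R) (a : R) : measurable_fun setT f ->
  (forall x, 0 <= f x) -> (0 <= a)%R ->
  \int[leb]_x \int[leb]_y f (x ^+ 2 + y ^+ 2 + a)%R <=
  \int[leb]_x \int[leb]_y f (x ^+ 2 + y ^+ 2)%R.
Proof.
move=> mf f0 a0.
have mg : measurable_fun setT (fun s : R => f (s + a)%R).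
  by apply: measurableT_comp => //; apply: measurable_funD.
rewrite integral_polar// (integral_polar mg)//; apply: lee_wpmul2l; first by rewrite lee_fin ltW// c_gt0.
rewrite integral_mkcond [leRHS]integral_mkcond.
have mi : measurable_fun setT (f \_ `[0%R, +oo[).
  exact: measurable_patch0.
have i0 x : 0 <= (f \_ `[0%R, +oo[) x by rewrite patchE; case: ifP.
rewrite -[leRHS](integral_shift a)//.
apply: ge0_le_integral => //.
- by move=> x _; rewrite patchE; case: ifP.
- exact: measurable_patch0.
- by apply: measurableT_comp => //; apply: measurable_funD.
move=> x _; rewrite !patchE; case: ifPn => [|_]; last by case: ifP.
rewrite inE/= in_itv/= andbT => x0; rewrite mem_set//= in_itv/= andbT.
exact: addr_ge0.
Qed.
End disc.

(** * Integration over finitely many coordinates *)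

Section tape.
Variable R : realType.
Local Open Scope ereal_scope.
Notation leb := (@lebesgue_measure R).
Notation MR := (measurableTypeR R).

Definition cylinders : set (set (nat -> R)) :=
  [set A | exists n (B : set R), measurable B /\ A = [set x | B (x n)]].

(** Integrands are functions of the whole tape, so any finite set of coordinates can be integrated
    in any order without forming finite product spaces. *)
Definition tape := g_sigma_algebraType cylinders.

Lemma measurable_coord n : measurable_fun setT (fun x : tape => x n : R).
Proof.
move=> _ B mB; rewrite setTI; apply: sub_sigma_algebra.
by exists n, B.
Qed.

Lemma measurable_tape d (T : measurableType d) (f : T -> tape) :
  (forall n, measurable_fun setT (fun t => f t n : R)) -> measurable_fun setT f.
Proof.
move=> mf; apply: (@measurability _ _ _ tape setT f cylinders) => // _ [_ [n [B [mB ->]]] <-].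
exact: (mf n).
Qed.

Lemma updC (x : nat -> R) i j a b : i != j ->
  upd (upd x i a) j b = upd (upd x j b) i a.
Proof.
move=> ij; apply/funext => k; rewrite /upd.
by have [->|//] := eqVneq k j; rewrite eq_sym (negbTE ij).
Qed.

Lemma updE (x : nat -> R) i a : upd x i a i = a.
Proof. by rewrite /upd eqxx. Qed.

Lemma measurable_upd d (T : measurableType d) (f : T -> tape) (g : T -> R) i :
  measurable_fun setT f -> measurable_fun setT g ->
  measurable_fun setT (fun t => upd (f t) i (g t) : tape).
Proof.
move=> mf mg; apply: measurable_tape => n; rewrite /upd; case: eqP => _ //.
exact: (measurableT_comp (measurable_coord n) mf).
Qed.

Definition mnn (F : tape -> \bar R) :=
  measurable_fun setT F /\ forall x, 0 <= F x.

(** The result is again a function of the whole tape, constant in coordinate [i]; iterated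
    integration is therefore plain composition. *)
Definition coord_int i (F : tape -> \bar R) : tape -> \bar R :=
  fun x => \int[leb]_y F (upd x i y).

Definition coords_int (l : seq nat) (F : tape -> \bar R) : tape -> \bar R :=
  foldr coord_int F l.

Lemma mnn_comp F (f : tape -> tape) : mnn F -> measurable_fun setT f -> mnn (F \o f).
Proof. by move=> [mF F0] mf; split => //=; exact: measurableT_comp. Qed.

Lemma mnn_upd F x i : mnn F -> measurable_fun setT (fun y : R => F (upd x i y)).
Proof.
move=> [mF F0].
have mu : measurable_fun setT (fun y : R => upd x i y : tape).
  by apply: measurable_upd => //; exact: measurable_cst.
exact: (measurableT_comp mF mu).
Qed.

Lemma mnn_coord_int i F : mnn F -> mnn (coord_int i F).
Proof.
move=> [mF F0]; split; last by move=> x; exact: integral_ge0.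
apply: (measurable_fun_fubini_tonelli_F (m2 := leb) (fun p : tape * MR => F (upd p.1 i p.2))) => //.
have mu : measurable_fun setT (fun p : tape * MR => upd p.1 i p.2 : tape).
  by apply: measurable_upd; [exact: measurable_fst|exact: measurable_snd].
exact: (measurableT_comp mF mu).
Qed.

Lemma mnn_coords_int l F : mnn F -> mnn (coords_int l F).
Proof. by move=> mF; elim: l => //= i l; exact: mnn_coord_int. Qed.

Lemma coord_intC i j F : mnn F -> coord_int i (coord_int j F) = coord_int j (coord_int i F).
Proof.
move=> [mF F0]; have [->//|ij] := eqVneq i j.
apply/funext => x; rewrite /coord_int.
have mu : measurable_fun setT (fun p : MR * MR => upd (upd x i p.1) j p.2 : tape).
  apply: measurable_upd; last exact: measurable_snd.
  by apply: measurable_upd; [exact: measurable_cst|exact: measurable_fst].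
have mp := measurableT_comp mF mu.
etransitivity.
  exact: (fubini_tonelli (fun p : MR * MR => F (upd (upd x i p.1) j p.2)) mp (fun p => F0 _)).
by apply: eq_integral => y _; apply: eq_integral => z _; rewrite /= updC.
Qed.

Lemma coords_int_cat l l' F : coords_int (l ++ l') F = coords_int l (coords_int l' F).
Proof. by rewrite /coords_int foldr_cat. Qed.

Lemma coords_int_perm l l' F : perm_eq l l' -> mnn F -> coords_int l F = coords_int l' F.
Proof.
move=> + mF; elim: l l' => [|i l IH] l' ll'.
  by move: ll'; rewrite perm_sym => /perm_nilP ->.
have il' : i \in l' by rewrite -(perm_mem ll') mem_head.
have [p1 [p2 E]] : exists p1 p2, l' = p1 ++ i :: p2.
  by case/splitPr: il' => p1 p2; exists p1, p2.
have pl : perm_eq l (p1 ++ p2).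
  by rewrite -(perm_cons i) (perm_trans ll')// E -(cat1s i p2) perm_catCA.
rewrite /= (IH _ pl) E; elim: p1 {E pl} => //= j p1 <-.
by rewrite coord_intC//; exact: mnn_coords_int.
Qed.

Lemma coords_intC l l' F : mnn F ->
  coords_int l (coords_int l' F) = coords_int l' (coords_int l F).
Proof.
by move=> mF; rewrite -!coords_int_cat; apply: coords_int_perm => //; rewrite perm_catC.
Qed.

(** Such [z] are the points at which an integral over [l] based at [x] evaluates its integrand. *)
Definition agree_off (l : seq nat) (x z : nat -> R) := forall j, j \notin l -> z j = x j.

Lemma agree_off_upd i l x y z : agree_off l (upd x i y) z -> agree_off (i :: l) x z.
Proof. by move=> h j; rewrite inE negb_or => /andP[ji jl]; rewrite h// /upd (negbTE ji). Qed.

Lemma coords_int_eq l F G x : (forall z, agree_off l x z -> F z = G z) ->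
  coords_int l F x = coords_int l G x.
Proof.
elim: l x => [|i l IH] x h /=; first exact: h.
by apply: eq_integral => y _; apply: IH => z /agree_off_upd; exact: h.
Qed.

Lemma coords_int_le l F G x : mnn F -> mnn G ->
  (forall z, agree_off l x z -> F z <= G z) ->
  coords_int l F x <= coords_int l G x.
Proof.
move=> mF mG; elim: l x => [|i l IH] x h /=; first exact: h.
apply: ge0_le_integral => //.
- by move=> y _; case: (mnn_coords_int l mF).
- by apply: mnn_upd; exact: mnn_coords_int.
- by apply: mnn_upd; exact: mnn_coords_int.
by move=> y _; apply: IH => z /agree_off_upd; exact: h.
Qed.

Lemma coords_intZl l (k : tape -> \bar R) F x : mnn F ->
  0 <= k x -> (forall z, agree_off l x z -> k z = k x) ->
  coords_int l (fun z => k z * F z) x = k x * coords_int l F x.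
Proof.
move=> mF k0 kl; transitivity (coords_int l (fun z => k x * F z) x).
  by apply: coords_int_eq => z /kl ->.
move: (k x) k0 => c c0 {kl}; elim: l x => [//|i l IH] x /=.
transitivity (\int[leb]_y (c * coords_int l F (upd x i y))).
  by apply: eq_integral => y _; exact: IH.
have [_ h0] := mnn_coords_int l mF.
rewrite (lebesgue_integralZl_ereal c0)//.
exact: (mnn_upd _ _ (mnn_coords_int l mF)).
Qed.

Lemma coords_intZl_cst l (k : R) F x : mnn F -> (0 <= k)%R ->
  coords_int l (fun z => k%:E * F z) x = k%:E * coords_int l F x.
Proof. by move=> mF k0; rewrite (@coords_intZl l (fun=> k%:E)). Qed.

Lemma coords_int_updl l i (a : R) F x : i \notin l ->
  coords_int l (fun z => F (upd z i a)) x = coords_int l F (upd x i a).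
Proof.
elim: l x => [//|j l IH] x /=; rewrite inE negb_or => /andP[ij il].
by apply: eq_integral => y _; rewrite IH// updC// eq_sym.
Qed.

Definition mapon (l : seq nat) (f : nat -> R -> R) (z : nat -> R) : nat -> R :=
  fun j => if j \in l then f j (z j) else z j.

Lemma measurable_mapon l (f : nat -> R -> R) : (forall j, measurable_fun setT (f j)) ->
  measurable_fun setT (mapon l f : tape -> tape).
Proof.
move=> mf; apply: measurable_tape => n; case nl : (n \in l); rewrite /mapon nl.
  exact: (measurableT_comp (mf n) (measurable_coord n)).
exact: measurable_coord.
Qed.

(** Coordinatewise change of variables, with [k j] as the Jacobian of [f j]; translations and
    dilations are the two instances used. *)
Lemma coords_int_map l (f : nat -> R -> R) (k : nat -> R) F x :
  uniq l -> mnn F -> (forall j, measurable_fun setT (f j)) -> (forall j, 0 <= k j)%R ->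
  (forall j (g : R -> \bar R), measurable_fun setT g -> (forall y, 0 <= g y) ->
    (k j)%:E * \int[leb]_y g (f j y) = \int[leb]_y g y) ->
  (\prod_(j <- l) k j)%:E * coords_int l (F \o mapon l f) x = coords_int l F x.
Proof.
move=> + + mf k0 hf; elim: l F x => [|i l IH] F x /=.
  by rewrite big_nil mul1e => _ _; congr F; apply/funext => j; rewrite /mapon in_nil.
move=> /andP[il ul] mF.
rewrite -[RHS](hf i (fun y => coords_int l F (upd x i y))); [|exact: (mnn_upd _ _ (mnn_coords_int l mF))|]; last first.
  by move=> y; case: (mnn_coords_int l mF).
rewrite big_cons EFinM -muleA; congr (_ * _).
have P0 : (0 <= \prod_(j <- l) k j)%R by apply: prodr_ge0.
have mFm : mnn (F \o mapon (i :: l) f) by apply: mnn_comp => //; exact: measurable_mapon.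
rewrite -lebesgue_integralZl//; last 2 first.
- exact: (mnn_upd _ _ (mnn_coords_int l mFm)).
- by move=> y; case: (mnn_coords_int l mFm).
apply: eq_integral => y _.
rewrite -[RHS]coords_int_updl// -[RHS]IH//; last first.
  by apply: mnn_comp => //; apply: measurable_upd; [exact: measurable_id|exact: measurable_cst].
congr (_ * _).
transitivity (coords_int l (fun z => F (mapon (i :: l) f (upd z i y))) x).
  by rewrite -[LHS](coords_int_updl _ _ _ il).
apply: coords_int_eq => z _ /=; congr F; apply/funext => j; rewrite /mapon /upd inE.
by case: eqP => // ->.
Qed.

Lemma coords_int_shift l (c : nat -> R) F x : uniq l -> mnn F ->
  coords_int l (F \o mapon l (fun j y => y + c j)%R) x = coords_int l F x.
Proof.
move=> ul mF; rewrite -(@coords_int_map l (fun j y => y + c j)%R (fun=> 1%R) F x)//.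
- by rewrite big1_eq mul1e.
- by move=> j; apply: measurable_funD.
- by move=> j g mg g0; rewrite mul1e integral_shift.
Qed.

Lemma coords_int_scale l (c : R) F x : uniq l -> mnn F -> (0 < c)%R ->
  (c ^+ size l)%:E * coords_int l (F \o mapon l (fun _ y => c * y)%R) x = coords_int l F x.
Proof.
move=> ul mF c0; rewrite -(@coords_int_map l (fun _ y => c * y)%R (fun=> c) F x)//.
- by rewrite big_const_seq count_predT iter_mulr_1.
- by move=> j; apply: measurable_funM.
- by move=> j; exact: ltW.
- by move=> j g mg g0; rewrite integral_scale.
Qed.
End tape.

(** * Gram matrices under the Lebesgue measure *)

Section mxmeas.
Variable R : realType.
Local Open Scope ereal_scope.

Definition mx_meas d0 (T : measurableType d0) m n (f : T -> 'M[R]_(m, n)) :=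
  forall i j, measurable_fun setT (fun t => f t i j).

(** Measurability is tested along all entrywise measurable families of matrices, so real matrices
    need no sigma-algebra of their own. *)
Definition mx_mnn m n (Phi : 'M[R]_(m, n) -> \bar R) :=
  (forall d0 (T : measurableType d0) (f : T -> 'M[R]_(m, n)),
     mx_meas f -> measurable_fun setT (Phi \o f)) /\ forall M, 0 <= Phi M.

Lemma mx_meas_mul d0 (T : measurableType d0) m n p (f : T -> 'M[R]_(m, n)) (g : T -> 'M[R]_(n, p)) :
  mx_meas f -> mx_meas g -> mx_meas (fun t => f t *m g t).
Proof.
move=> mf mg i j; under eq_fun do rewrite mxE.
by apply: measurable_sum => k; apply: measurable_funM.
Qed.

Lemma mx_meas_tr d0 (T : measurableType d0) m n (f : T -> 'M[R]_(m, n)) :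
  mx_meas f -> mx_meas (fun t => (f t)^T).
Proof. by move=> mf i j; under eq_fun do rewrite mxE; exact: mf. Qed.

Lemma mx_meas_add d0 (T : measurableType d0) m n (f g : T -> 'M[R]_(m, n)) :
  mx_meas f -> mx_meas g -> mx_meas (fun t => f t + g t)%R.
Proof. by move=> mf mg i j; under eq_fun do rewrite mxE; apply: measurable_funD. Qed.

Lemma mx_meas_scale d0 (T : measurableType d0) m n (f : T -> R) (g : T -> 'M[R]_(m, n)) :
  measurable_fun setT f -> mx_meas g -> mx_meas (fun t => f t *: g t)%R.
Proof. by move=> mf mg i j; under eq_fun do rewrite mxE; apply: measurable_funM. Qed.

Lemma mx_meas_cst d0 (T : measurableType d0) m n (M : 'M[R]_(m, n)) :
  mx_meas (fun t : T => M).
Proof. by move=> i j; exact: measurable_cst. Qed.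

End mxmeas.

(** * Orthonormal vectors orthogonal to all rows but one *)

Section orth.
Variable R : realType.

(** Replacing the vector of index [p] by 0 makes the matrix singular; a normalized kernel vector is
    orthogonal to all the others. *)
Lemma unit_orth d (p : 'I_d) (A : 'M[R]_d) : exists c : 'I_d -> R,
  \sum_a c a ^+ 2 = 1 /\ forall i, i != p -> \sum_a c a * A i a = 0.
Proof.
pose A' := \matrix_(i, j) (if j == p then 0 else A j i).
have : \det A' == 0.
  apply/eqP; rewrite (expand_det_col _ p) big1// => i _.
  by rewrite mxE eqxx mul0r.
case/det0P => v v0 vA.
have s0 : 0 < \sum_a v 0 a ^+ 2.
  rewrite lt_def sumr_ge0 ?andbT; last by move=> i _; exact: sqr_ge0.
  apply: contraNneq v0 => s0; apply/eqP/rowP => a; rewrite mxE.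
  apply/eqP; rewrite -sqrf_eq0; apply/eqP.
  by move: s0 => /psumr_eq0P -> // k _; exact: sqr_ge0.
set s := \sum_a _ in s0.
exists (fun a => v 0 a / Num.sqrt s); split.
  under eq_bigr do rewrite exprMn exprVn.
  by rewrite -mulr_suml sqr_sqrtr ?ltW// divff// gt_eqF.
move=> i ip; have := congr1 (fun M : 'rV_d => M 0 i) vA; rewrite !mxE.
under eq_bigr do rewrite mxE (negbTE ip) mulrC.
move=> h; under eq_bigr do rewrite mulrAC mulrC.
under eq_bigr do rewrite (mulrC (v 0 _)).
by rewrite -mulr_sumr h mulr0.
Qed.

(** Each half of the columns contributes one vector, and disjoint supports make the two orthogonal.
    This is what the 2 d columns are for. *)
Lemma orthonormal_pair d (p : 'I_d) (G : 'M[R]_(d, d + d)) :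
  exists u w : 'I_(d + d) -> R,
  [/\ \sum_a u a ^+ 2 = 1, \sum_a w a ^+ 2 = 1, \sum_a u a * w a = 0,
      forall i, i != p -> \sum_a u a * G i a = 0 &
      forall i, i != p -> \sum_a w a * G i a = 0].
Proof.
have [c [c1 ch]] := unit_orth p (lsubmx G).
have [e [e1 eh]] := unit_orth p (rsubmx G).
pose u a := row_mx (\row_j c j) (0 : 'rV[R]_d) 0 a.
pose w a := row_mx (0 : 'rV[R]_d) (\row_j e j) 0 a.
have uL a : u (lshift d a) = c a by rewrite /u row_mxEl mxE.
have uR a : u (rshift d a) = 0 by rewrite /u row_mxEr mxE.
have wL a : w (lshift d a) = 0 by rewrite /w row_mxEl mxE.
have wR a : w (rshift d a) = e a by rewrite /w row_mxEr mxE.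
exists u, w; split; rewrite ?big_split_ord/=.
- rewrite [X in _ + X]big1 ?addr0; last by move=> a _; rewrite uR expr0n.
  by under eq_bigr do rewrite uL.
- rewrite [X in X + _]big1 ?add0r; last by move=> a _; rewrite wL expr0n.
  by under eq_bigr do rewrite wR.
- rewrite [X in _ + X]big1 ?addr0; last by move=> a _; rewrite uR mul0r.
  by rewrite big1// => a _; rewrite wL mulr0.
- move=> i ip; rewrite big_split_ord/= [X in _ + X]big1 ?addr0; last by move=> a _; rewrite uR mul0r.
  by rewrite -[RHS](ch i ip); apply: eq_bigr => a _; rewrite uL mxE.
- move=> i ip; rewrite big_split_ord/= [X in X + _]big1 ?add0r; last by move=> a _; rewrite wL mul0r.
  by rewrite -[RHS](eh i ip); apply: eq_bigr => a _; rewrite wR mxE.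
Qed.
End orth.

Section gram.
Variables (R : realType) (d : nat).
Local Open Scope ereal_scope.
Notation leb := (@lebesgue_measure R).
Notation MR := (measurableTypeR R).
Notation tape := (tape R).
Let n := (d + d)%N.
Variable e : 'I_d -> 'I_n -> nat.
Hypothesis e_inj : forall i a i' a', e i a = e i' a' -> i = i' /\ a = a'.

Definition gmx (x : tape) : 'M[R]_(d, n) := \matrix_(i, a) x (e i a).
Definition gram_coords : seq nat := [seq e q.1 q.2 | q <- enum {: 'I_d * 'I_n}].
Definition row_coords p : seq nat := [seq e p a | a <- enum 'I_n].
Definition other_coords p : seq nat := [seq e q.1 q.2 | q <- enum {: 'I_d * 'I_n} & q.1 != p].

Let e2_inj : injective (fun q : 'I_d * 'I_n => e q.1 q.2).
Proof. by move=> [i a] [j b] /= /e_inj[-> ->]. Qed.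

Lemma gram_coords_uniq : uniq gram_coords.
Proof. by rewrite map_inj_uniq ?enum_uniq. Qed.
Lemma other_coords_uniq p : uniq (other_coords p).
Proof. by rewrite map_inj_uniq//; exact/filter_uniq/enum_uniq. Qed.
Lemma row_coords_uniq p : uniq (row_coords p).
Proof. by rewrite map_inj_uniq ?enum_uniq// => a b /e_inj[]. Qed.

Lemma mem_gram_coords i a : e i a \in gram_coords.
Proof. by apply/mapP; exists (i, a); rewrite ?mem_enum. Qed.
Lemma mem_row_coords p i a : (e i a \in row_coords p) = (i == p).
Proof.
apply/mapP/eqP; first by move=> [b _ /e_inj[]].
by move=> ->; exists a; rewrite ?mem_enum.
Qed.
Lemma mem_other_coords p i a : (e i a \in other_coords p) = (i != p).
Proof.
apply/mapP/idP => [[[j b]]|ip].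
  by rewrite mem_filter /= => /andP[jp _] /e_inj[-> _].
by exists (i, a) => //; rewrite mem_filter /= ip mem_enum.
Qed.

Lemma gram_coords_perm p : perm_eq gram_coords (other_coords p ++ row_coords p).
Proof.
apply: uniq_perm; first exact: gram_coords_uniq.
  rewrite cat_uniq other_coords_uniq row_coords_uniq andbT /=.
  by apply/hasPn => _ /mapP[a _ ->]; rewrite /= mem_other_coords eqxx.
move=> j; rewrite mem_cat; apply/idP/orP.
  move=> /mapP[[i a] _ ->] /=; rewrite mem_other_coords mem_row_coords.
  by case: eqP => _; [right|left].
by case=> /mapP => -[q _ ->]; exact: mem_gram_coords.
Qed.

Lemma mx_meas_gmx : mx_meas gmx.
Proof.
move=> i a; rewrite (_ : (fun t => gmx t i a) = (fun t => t (e i a))).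
  exact: measurable_coord.
by apply/funext => t; rewrite mxE.
Qed.

Definition gram x := gmx x *m (gmx x)^T.

Lemma mx_meas_gram : mx_meas gram.
Proof. by apply: mx_meas_mul; [|apply: mx_meas_tr]; exact: mx_meas_gmx. Qed.

Lemma gramE x i j : gram x i j = (\sum_a x (e i a) * x (e j a))%R.
Proof. by rewrite mxE; apply: eq_bigr => a _; rewrite !mxE. Qed.

Section row.
(* [A0] and [B0] index the integration variables of the plane spanned by [u]
   and [w]. *)
Variables A0 B0 : nat.
Hypotheses (neA : forall i a, (e i a == A0) = false)
  (neB : forall i a, (e i a == B0) = false) (neAB : (A0 == B0) = false).
Variables (p : 'I_d) (u w : 'I_n -> R).
Hypotheses (u1 : (\sum_a u a ^+ 2 = 1)%R) (w1 : (\sum_a w a ^+ 2 = 1)%R)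
  (uw : (\sum_a u a * w a = 0)%R).

Let Dt (c : 'I_n -> R) (z : tape) : R := (\sum_a c a * z (e p a))%R.
(** A weight whose integral is 1 after any translation. *)
Let box (t : R) : R := \1_(`[0%R, 1%R[%classic : set R) t.
Let s (z : tape) (j : nat) : R :=
  if [pick a | e p a == j] is Some a then (- (z A0 * u a + z B0 * w a))%R else 0%R.
Let sig (z : tape) : tape := mapon (row_coords p) (fun j y => y + s z j)%R z.

Let sE z a : s z (e p a) = (- (z A0 * u a + z B0 * w a))%R.
Proof.
by rewrite /s; case: pickP => [b /eqP/e_inj[_ ->]//|/(_ a)]; rewrite eqxx.
Qed.

Let growA : A0 \notin row_coords p.
Proof. by apply/negP => /mapP[a _ /eqP]; rewrite eq_sym neA. Qed.
Let growB : B0 \notin row_coords p.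
Proof. by apply/negP => /mapP[a _ /eqP]; rewrite eq_sym neB. Qed.

Let sigA z : sig z A0 = z A0. Proof. by rewrite /sig /mapon (negbTE growA). Qed.
Let sigB z : sig z B0 = z B0. Proof. by rewrite /sig /mapon (negbTE growB). Qed.

Let sigE z i a : sig z (e i a) =
  (z (e i a) - (if i == p then z A0 * u a + z B0 * w a else 0))%R.
Proof.
rewrite /sig /mapon mem_row_coords; case: eqP => [->|_]; first by rewrite sE.
by rewrite subr0.
Qed.

Let Dsig_u z : Dt u (sig z) = (Dt u z - z A0)%R.
Proof.
rewrite /Dt; under eq_bigr do rewrite sigE eqxx mulrBr mulrDr.
rewrite sumrB big_split/=; congr (_ - _)%R.
under eq_bigr do rewrite mulrCA -expr2.
rewrite -mulr_sumr u1 mulr1 -[RHS]addr0; congr (_ + _)%R.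
by under eq_bigr do rewrite mulrCA; rewrite -mulr_sumr uw mulr0.
Qed.

Let Dsig_w z : Dt w (sig z) = (Dt w z - z B0)%R.
Proof.
rewrite /Dt; under eq_bigr do rewrite sigE eqxx mulrBr mulrDr.
rewrite sumrB big_split/=; congr (_ - _)%R.
under eq_bigr do rewrite mulrCA (mulrC (w _)).
rewrite -mulr_sumr uw mulr0 add0r.
by under eq_bigr do rewrite mulrCA -expr2; rewrite -mulr_sumr w1 mulr1.
Qed.

Let mDt c : measurable_fun setT (Dt c).
Proof.
by apply: measurable_sum => a; apply: measurable_funM => //; exact: measurable_coord.
Qed.

Let msig : measurable_fun setT sig.
Proof.
apply: measurable_tape => j; rewrite /sig /mapon.
case nj : (j \in row_coords p); last exact: measurable_coord.
apply: measurable_funD; first exact: measurable_coord.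
rewrite /s; case: pickP => [a _|_]; last exact: measurable_cst.
apply: measurableT_comp => //; apply: measurable_funD; apply: measurable_funM => //;
  exact: measurable_coord.
Qed.

Let mbox : measurable_fun setT box.
Proof. by apply: measurable_indic; exact: measurable_itv. Qed.

Let box_int c : \int[leb]_y (box (c + y))%:E = 1.
Proof.
transitivity (\int[leb]_y (box y)%:E).
  rewrite -[RHS](integral_shift c).
  - by apply: eq_integral => y _; rewrite addrC.
  - by apply/measurable_EFinP; exact: mbox.
  - by move=> y; rewrite lee_fin.
rewrite integral_indic ?setIT; last exact: measurable_itv.
  rewrite -[LHS]/(leb `[0%R, 1%R[%classic).
  by rewrite lebesgue_measure_itv/= lte_fin ltr01 oppr0 adde0.
exact: measurableT.
Qed.

Let Dt_upd c z j y : (forall i a, (e i a == j) = false) -> Dt c (upd z j y) = Dt c z.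
Proof. by move=> h; apply: eq_bigr => a _; rewrite /upd h. Qed.

Lemma plane_mnn (F : tape -> \bar R) : mnn F ->
  mnn (fun z => (box (Dt u z) * box (Dt w z))%:E * F (sig z)).
Proof.
move=> mF.
split; last by move=> z; apply: mule_ge0; [rewrite lee_fin mulr_ge0|case: mF].
apply: emeasurable_funM; last by case: mF => mF _; exact: (measurableT_comp mF msig).
apply/measurable_EFinP; apply: measurable_funM.
  by apply: (measurableT_comp mbox); exact: mDt.
by apply: (measurableT_comp mbox); exact: mDt.
Qed.

(** Averaging over a plane without rotating coordinates. A factor with integral 1 in the new
    variables at [A0] and [B0] is inserted, the integrals are exchanged, and row [p] is translated
    by [sig]. The translation frees the box factors from the new variables, which then run through
    the whole plane. *)
Lemma plane_average (F : tape -> \bar R) (x : tape) : mnn F ->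
  (forall z y, F (upd z A0 y) = F z) -> (forall z y, F (upd z B0 y) = F z) ->
  coords_int (row_coords p) F x =
  coords_int (row_coords p) (coords_int [:: A0; B0]
    (fun z => (box (Dt u z) * box (Dt w z))%:E * F (sig z))) x.
Proof.
move=> mF FA FB.
pose W z := (box (Dt u z + z A0) * box (Dt w z + z B0))%:E * F z.
have mW : mnn W.
  split; last by move=> z; apply: mule_ge0; [rewrite lee_fin mulr_ge0|case: mF].
  apply: emeasurable_funM; last by case: mF.
  apply/measurable_EFinP; apply: measurable_funM.
    apply: (measurableT_comp mbox); apply: measurable_funD; [exact: mDt|exact: measurable_coord].
  apply: (measurableT_comp mbox); apply: measurable_funD; [exact: mDt|exact: measurable_coord].
have mV := plane_mnn mF.
transitivity (coords_int (row_coords p) (coords_int [:: A0; B0] W) x).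
  apply: coords_int_eq => z _ /=; rewrite /coord_int /W.
  transitivity (\int[leb]_y ((box (Dt u z + y))%:E * F z)).
    rewrite -[LHS]mule1 -(box_int (Dt u z)) -lebesgue_integralZl_ereal.
    - by apply: eq_integral => y _; rewrite muleC.
    - by case: mF.
    - apply/measurable_EFinP; apply: (measurableT_comp mbox); exact: measurable_funD.
    - by move=> y; rewrite lee_fin.
  apply: eq_integral => y _.
  transitivity (\int[leb]_y0 ((box (Dt u z + y))%:E * F z * (box (Dt w z + y0))%:E)).
    rewrite lebesgue_integralZl_ereal ?box_int ?mule1//.
    - by apply: mule_ge0; [rewrite lee_fin|case: mF].
    - apply/measurable_EFinP; apply: (measurableT_comp mbox); exact: measurable_funD.
    - by move=> y'; rewrite lee_fin.
  apply: eq_integral => y' _; rewrite FB FA !Dt_upd// updE {1}/upd neAB updE.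
  by rewrite EFinM muleAC.
have sw V : mnn V -> coords_int (row_coords p) (coords_int [:: A0; B0] V) x =
    coords_int [:: A0; B0] (coords_int (row_coords p) V) x.
  by move=> mV'; rewrite coords_intC.
rewrite [LHS](sw _ mW) [RHS](sw _ mV).
apply: coords_int_eq => z _.
(* The shift depends only on the cells [A0] and [B0], which are constant during the integration over
   row [p]. *)
rewrite -(coords_int_shift (s z) z (row_coords_uniq p) mW).
apply: coords_int_eq => z' zz' /=.
have -> : mapon (row_coords p) (fun j y => (y + s z j)%R) z' = sig z'.
  rewrite /sig; congr mapon; apply/funext => j; apply/funext => y.
  by rewrite /s (zz' _ growA) (zz' _ growB).
by rewrite /W Dsig_u Dsig_w sigA sigB !subrK.
Qed.

(** The other rows are orthogonal to the plane, so moving row [p] within it affects only the entry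
    (p, p) of the Gram matrix, which is a constant plus a squared distance in the plane. This is the
    situation of [integral_sqr_shift]. *)
Lemma plane_compare (Phi : 'M[R]_d -> \bar R) (a : R) (z : tape) :
  mx_mnn Phi -> (0 <= a)%R ->
  (forall i, i != p -> (\sum_b u b * z (e i b) = 0)%R) ->
  (forall i, i != p -> (\sum_b w b * z (e i b) = 0)%R) ->
  coords_int [:: A0; B0]
    (fun z => (box (Dt u z) * box (Dt w z))%:E * Phi (gram (sig z) + a *: delta_mx p p)%R) z <=
  coords_int [:: A0; B0]
    (fun z => (box (Dt u z) * box (Dt w z))%:E * Phi (gram (sig z))) z.
Proof.
move=> [mPhi Phi0] a0 uz wz.
(* The Gram matrix after removing from row [p] its component in the plane. *)
pose M0 := (gram z - (Dt u z ^+ 2 + Dt w z ^+ 2) *: delta_mx p p)%R.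
pose h (t : R) := (box (Dt u z) * box (Dt w z))%:E * Phi (M0 + t *: delta_mx p p)%R.
have mh : measurable_fun setT h.
  apply: emeasurable_funM; first exact: measurable_cst.
  apply: (mPhi _ _ (fun t : R => M0 + t *: delta_mx p p)%R).
  apply: mx_meas_add; first exact: mx_meas_cst.
  by apply: mx_meas_scale; [exact: measurable_id|exact: mx_meas_cst].
have h0 t : 0 <= h t by apply: mule_ge0 => //; rewrite lee_fin mulr_ge0.
have gsig y y' : gram (sig (upd (upd z A0 y) B0 y')) =
    (M0 + ((y - Dt u z) ^+ 2 + (y' - Dt w z) ^+ 2) *: delta_mx p p)%R.
  set z' := upd _ _ _.
  have zA : z' A0 = y by rewrite /z' {1}/upd neAB updE.
  have zB : z' B0 = y' by rewrite /z' updE.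
  have ze i b : z' (e i b) = z (e i b) by rewrite /z' /upd neA neB.
  apply/matrixP => i j; rewrite !mxE.
  under eq_bigr do rewrite !mxE !sigE zA zB !ze.
  rewrite [in RHS](eq_bigr (fun b => z (e i b) * z (e j b)))%R; last by move=> b _; rewrite !mxE.
  case: (eqVneq i p) => [->|ip]; case: (eqVneq j p) => [->|jp] /=; rewrite ?(mulr0, mulr1, subr0, addr0).
  - transitivity (\sum_b z (e p b) * z (e p b) + (y ^+ 2 * (\sum_b u b ^+ 2) + y' ^+ 2 * (\sum_b w b ^+ 2)
       + (y * y') *+ 2 * (\sum_b u b * w b)) - y *+ 2 * Dt u z - y' *+ 2 * Dt w z)%R.
      rewrite /Dt !mulr_sumr -!big_split -!sumrB/=; apply: eq_bigr => b _; ring.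
    rewrite u1 w1 uw; ring.
  - under eq_bigr do rewrite subr0 mulrBl mulrDl -!mulrA.
    by rewrite sumrB big_split/= -!mulr_sumr uz// wz// !mulr0 addr0 subr0.
  - under eq_bigr do rewrite subr0 mulrC mulrBl mulrDl -!mulrA.
    rewrite sumrB big_split/= -!mulr_sumr uz// wz// !mulr0 addr0 subr0.
    by apply: eq_bigr => b _; rewrite mulrC.
  - by under eq_bigr do rewrite !subr0.
(* Translations recentre the two variables at the projection of row [p] to the plane. *)
have key b : \int[leb]_y \int[leb]_y' h ((y - Dt u z) ^+ 2 + (y' - Dt w z) ^+ 2 + b)%R =
             \int[leb]_y \int[leb]_y' h (y ^+ 2 + y' ^+ 2 + b)%R.
  have mhb : measurable_fun setT (fun q : MR * MR => h (q.1 ^+ 2 + q.2 ^+ 2 + b)%R).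
    have mq : measurable_fun setT (fun q : MR * MR => (q.1 ^+ 2 + q.2 ^+ 2 + b)%R : R).
      apply: measurable_funD => //; apply: measurable_funD; apply: measurable_funX.
        exact: measurable_fst.
      exact: measurable_snd.
    exact: (measurableT_comp mh mq).
  have mhI := measurable_fun_fubini_tonelli_F (m2 := leb) _ mhb (fun q => h0 _).
  rewrite -[RHS](@integral_shift _ (- Dt u z)%R _ mhI); last first.
    by move=> y; apply: integral_ge0.
  apply: eq_integral => y _; rewrite /fubini_F/=.
  rewrite -[RHS](@integral_shift _ (- Dt w z)%R)//.
  apply: (measurableT_comp mh); apply: measurable_funD => //; apply: measurable_funD => //.
rewrite /= /coord_int.
under eq_integral do under eq_integral do
  rewrite !Dt_upd// gsig -addrA -scalerDl -/(h _).
under [leRHS]eq_integral do under eq_integral do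
  rewrite !Dt_upd// gsig -[X in X *: _]addr0 -/(h _).
apply: (le_trans _ (le_trans (integral_sqr_shift mh h0 a0) _)); rewrite le_eqVlt; apply/orP; left; apply/eqP.
  exact: key.
apply/esym/(etrans (key 0%R)).
by apply: eq_integral => y _; apply: eq_integral => y' _; rewrite addr0.
Qed.
End row.

Lemma gram_row_shift (Phi : 'M[R]_d -> \bar R) (p : 'I_d) (a : R) (x : tape) :
  mx_mnn Phi -> (0 <= a)%R ->
  coords_int (row_coords p) (fun z => Phi (gram z + a *: delta_mx p p)%R) x <=
  coords_int (row_coords p) (Phi \o gram) x.
Proof.
move=> mPhi a0.
(* The orthogonality conditions involve only the rows other than [p], which stay fixed while row [p]
   is integrated. *)
have [u [w [u1 w1 uw ux wx]]] := orthonormal_pair p (gmx x).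
(* Indices beyond the sum of all those in use are fresh. *)
pose A0 := (\sum_(j <- gram_coords) j).+1; pose B0 := A0.+1.
have le_gall j : j \in gram_coords -> (j < A0)%N.
  by move=> jg; rewrite ltnS (big_rem j)//= leq_addr.
have neA i b : (e i b == A0) = false by rewrite ltn_eqF// le_gall// mem_gram_coords.
have neB i b : (e i b == B0) = false.
  by rewrite ltn_eqF// ltnS ltnW// le_gall// mem_gram_coords.
have neAB : (A0 == B0) = false by rewrite ltn_eqF.
have gA z y : gram (upd z A0 y) = gram z.
  by apply/matrixP => i j; rewrite !gramE; apply: eq_bigr => b _; rewrite /upd !neA.
have gB z y : gram (upd z B0 y) = gram z.
  by apply/matrixP => i j; rewrite !gramE; apply: eq_bigr => b _; rewrite /upd !neB.
have mF b : mnn (fun z => Phi (gram z + b *: delta_mx p p)%R).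
  split=> [|z]; last exact: mPhi.2.
  apply: (mPhi.1 _ _ (fun z => gram z + b *: delta_mx p p)%R).
  by apply: mx_meas_add; [exact: mx_meas_gram|exact: mx_meas_cst].
have mG : mnn (Phi \o gram).
  by split=> [|z]; [apply: (mPhi.1 _ _ gram); exact: mx_meas_gram|exact: mPhi.2].
have PA F := @plane_average A0 B0 neA neB neAB p u w u1 w1 uw F x.
have FA b z y : Phi (gram (upd z A0 y) + b *: delta_mx p p)%R = Phi (gram z + b *: delta_mx p p)%R.
  by rewrite gA.
have FB b z y : Phi (gram (upd z B0 y) + b *: delta_mx p p)%R = Phi (gram z + b *: delta_mx p p)%R.
  by rewrite gB.
have GA z y : Phi (gram (upd z A0 y)) = Phi (gram z) by rewrite gA.
have GB z y : Phi (gram (upd z B0 y)) = Phi (gram z) by rewrite gB.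
rewrite [leLHS](PA _ (mF a) (FA a) (FB a)) [leRHS](PA _ mG GA GB).
have PM F (mF' : mnn F) := mnn_coords_int [:: A0; B0] (@plane_mnn A0 B0 p u w F mF').
apply: coords_int_le.
- exact: (PM _ (mF a)).
- exact: (PM _ mG).
move=> z xz; have xze i b : i != p -> z (e i b) = gmx x i b.
  by move=> ip; rewrite mxE xz// mem_row_coords.
apply: plane_compare => // i ip.
  by rewrite -[RHS](ux i ip); apply: eq_bigr => b _; rewrite xze.
by rewrite -[RHS](wx i ip); apply: eq_bigr => b _; rewrite xze.
Qed.

Section shear.
Variables (p : 'I_d) (c : 'I_d -> R).

(** The row operation that adds [c i] times row [p] to every other row [i]. *)
Definition shear_mx : 'M[R]_d :=
  \matrix_(i, j) ((i == j)%:R + (if (j == p) && (i != p) then c i else 0))%R.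

Let s (z : tape) (j : nat) : R :=
  if [pick q | e q.1 q.2 == j] is Some q then (c q.1 * z (e p q.2))%R else 0%R.

Let gmx_shear z :
  gmx (mapon (other_coords p) (fun j y => y + s z j)%R z) = shear_mx *m gmx z.
Proof.
have sE i a : s z (e i a) = (c i * z (e p a))%R.
  rewrite /s; case: pickP => [[j b] /= /eqP/e_inj[-> ->]//|/(_ (i, a))].
  by rewrite eqxx.
apply/matrixP => i a; rewrite !mxE /mapon mem_other_coords sE.
under eq_bigr do rewrite !mxE mulrDl.
rewrite big_split/= (bigD1 i)//= eqxx mul1r big1 ?addr0; last first.
  by move=> j ji; rewrite eq_sym (negbTE ji) mul0r.
rewrite (bigD1 p)//= eqxx big1 ?addr0; last first.
  by move=> j jp; rewrite (negbTE jp) mul0r.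
by case: (i != p) => //=; rewrite ?mul0r ?addr0.
Qed.

(** For a fixed row [p] the shear is a translation of the other rows, so no determinant formula is
    needed. *)
Lemma coords_int_shear (Psi : 'M[R]_(d, n) -> \bar R) (x : tape) : mx_mnn Psi ->
  coords_int gram_coords (fun z => Psi (shear_mx *m gmx z)) x = coords_int gram_coords (Psi \o gmx) x.
Proof.
move=> [mPsi Psi0].
have mF : mnn (Psi \o gmx).
  by split=> [|z]; [apply: mPsi; exact: mx_meas_gmx|exact: Psi0].
have mG : mnn (fun z => Psi (shear_mx *m gmx z)).
  split=> [|z]; last exact: Psi0.
  apply: (mPsi _ _ (fun z => shear_mx *m gmx z)).
  by apply: mx_meas_mul; [exact: mx_meas_cst|exact: mx_meas_gmx].
have pp : perm_eq gram_coords (row_coords p ++ other_coords p) by rewrite (perm_trans (gram_coords_perm p))// perm_catC.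
rewrite !(coords_int_perm pp)// !coords_int_cat.
apply: coords_int_eq => z _.
rewrite -[RHS](coords_int_shift (s z) z (other_coords_uniq p) mF).
apply: coords_int_eq => z' zz' /=; rewrite -gmx_shear; congr (Psi (gmx (mapon _ _ _))).
apply/funext => j; apply/funext => y; rewrite /s; case: pickP => // q _.
by rewrite zz'// mem_other_coords eqxx.
Qed.
End shear.

(* A shear makes v a multiple of the p-th basis vector.  Averaging row p of G over a plane
   orthogonal to the other rows then reduces the claim to [integral_sqr_shift]. *)
Lemma gram_rank1_shift (Phi : 'M[R]_d -> \bar R) (v : 'cV[R]_d) (x : tape) :
  mx_mnn Phi ->
  coords_int gram_coords (fun z => Phi (gram z + v *m v^T)%R) x <=
  coords_int gram_coords (Phi \o gram) x.
Proof.
move=> mPhi; have [->|/cV0Pn[p vp]] := eqVneq v 0%R.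
  rewrite le_eqVlt; apply/orP; left; apply/eqP; apply: coords_int_eq => z _ /=.
  by rewrite mul0mx addr0.
pose c i := (v i 0 / v p 0)%R.
pose B := shear_mx p c.
have vB : v = (v p 0 *: (B *m delta_mx p 0))%R.
  apply/colP => i; rewrite !mxE (bigD1 p)//= big1 ?addr0; last first.
    by move=> j jp; rewrite !mxE (negbTE jp) mulr0.
  rewrite !mxE !eqxx mulr1; case: eqVneq => [->|ip] /=; first by rewrite addr0 mulr1.
  by rewrite add0r mulrC divfK.
pose Phi' M := Phi (B *m M *m B^T).
have mPhi' : mx_mnn Phi'.
  split=> [d0 T f mf|M]; last exact: mPhi.2.
  apply: (mPhi.1 _ _ (fun t => B *m f t *m B^T)).
  by do 2?apply: mx_meas_mul => //; exact: mx_meas_cst.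
have mS (M : 'M[R]_d) : mx_mnn (fun G : 'M[R]_(d, n) => Phi (G *m G^T + M)%R).
  split=> [d0 T f mf|G]; last exact: mPhi.2.
  apply: (mPhi.1 _ _ (fun t => f t *m (f t)^T + M)%R).
  apply: mx_meas_add; last exact: mx_meas_cst.
  by apply: mx_meas_mul => //; exact: mx_meas_tr.
(* The Gram matrix of B G is B (G G^T) B^T, so invariance under the shear moves B into the test
   function. *)
have E M : coords_int gram_coords (fun z => Phi (gram z + B *m M *m B^T)%R) x =
    coords_int gram_coords (fun z => Phi' (gram z + M)%R) x.
  rewrite -(coords_int_shear p c x (mS (B *m M *m B^T)))//.
  apply: coords_int_eq => z _; rewrite /Phi' /gram trmx_mul !mulmxA; congr Phi.
  by rewrite mulmxDr mulmxDl !mulmxA.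
have vv : v *m v^T = B *m ((v p 0%R ^+ 2)%R *: delta_mx p p) *m B^T.
  rewrite {1 2}vB linearZ/= -scalemxAl -scalemxAr scalerA -expr2 trmx_mul trmx_delta.
  by rewrite -!mulmxA (mulmxA (delta_mx p 0%R)) mul_delta_mx -scalemxAl -scalemxAr.
have -> : coords_int gram_coords (Phi \o gram) x = coords_int gram_coords (Phi' \o gram) x.
  have := E 0%R; rewrite mulmx0 mul0mx.
  by under eq_fun do rewrite addr0; under [X in _ = coords_int _ X _]eq_fun do rewrite addr0.
rewrite vv E.
have mF b : mnn (fun z => Phi' (gram z + b *: delta_mx p p)%R).
  split=> [|z]; last exact: mPhi'.2.
  apply: (mPhi'.1 _ _ (fun z => gram z + b *: delta_mx p p)%R).
  by apply: mx_meas_add; [exact: mx_meas_gram|exact: mx_meas_cst].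
have mG : mnn (Phi' \o gram).
  by split=> [|z]; [apply: (mPhi'.1 _ _ gram); exact: mx_meas_gram|exact: mPhi'.2].
rewrite !(coords_int_perm (gram_coords_perm p))// !coords_int_cat.
apply: coords_int_le; try exact: mnn_coords_int.
by move=> z _; apply: gram_row_shift => //; exact: sqr_ge0.
Qed.
End gram.

(** * Gaussian integrals *)

Section gauss.
Variable R : realType.
Local Open Scope ereal_scope.
Notation leb := (@lebesgue_measure R).
Notation tape := (tape R).
Notation rho := (@normal_pdf R 0 1).
Notation peak := (@normal_peak R 1).

Lemma rhoE (y : R) : rho y = (peak * expR (- y ^+ 2 / 2))%R.
Proof.
rewrite normal_pdfE ?oner_neq0// /normal_fun subr0 expr1n.
by rewrite (_ : (1 *+ 2 = 2 :> R)%R).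
Qed.

Definition sqs (l : seq nat) (x : nat -> R) : R := (\sum_(j <- l) x j ^+ 2)%R.

Lemma sqs_ge0 l x : (0 <= sqs l x)%R.
Proof. by apply: sumr_ge0 => j _; exact: sqr_ge0. Qed.

Lemma measurable_sqs l : measurable_fun setT (sqs l : tape -> R).
Proof.
apply: measurable_sum => j; apply: measurable_funX; exact: measurable_coord.
Qed.

Definition gdens (l : seq nat) (x : nat -> R) : R := (\prod_(j <- l) rho (x j))%R.

Lemma gdens_ge0 l x : (0 <= gdens l x)%R.
Proof. by apply: prodr_ge0 => j _; exact: normal_pdf_ge0. Qed.

Lemma measurable_gdens l : measurable_fun setT (gdens l : tape -> R).
Proof.
apply: measurable_prod => j _.
exact: (measurableT_comp (measurable_normal_pdf 0 1) (measurable_coord j)).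
Qed.

Lemma gdensE l x : gdens l x = (peak ^+ size l * expR (- sqs l x / 2))%R.
Proof.
rewrite /gdens /sqs; elim: l => [|j l IH]; first by rewrite !big_nil oppr0 mul0r expR0 mulr1.
rewrite !big_cons IH rhoE /= (exprS peak); set S := (\sum_(_ <- l) _)%R.
rewrite (_ : - (x j ^+ 2 + S) / 2 = - x j ^+ 2 / 2 + - S / 2)%R; last by field.
by rewrite expRD; ring.
Qed.

(** The expectation when the coordinates in [l] are independent standard normal variables and all
    others are frozen. *)
Definition gauss_int l (F : tape -> \bar R) :=
  coords_int l (fun x => (gdens l x)%:E * F x).

Lemma mnn_gdens l F : mnn F -> mnn (fun x : tape => (gdens l x)%:E * F x).
Proof.
move=> [mF F0]; split; last by move=> x; rewrite mule_ge0 ?lee_fin ?gdens_ge0.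
by apply: emeasurable_funM => //; apply/measurable_EFinP; exact: measurable_gdens.
Qed.

Lemma mnn_gauss_int l F : mnn F -> mnn (gauss_int l F).
Proof. by move=> mF; apply: mnn_coords_int; exact: mnn_gdens. Qed.

Lemma gauss_int_eq l F G x : (forall z, agree_off l x z -> F z = G z) ->
  gauss_int l F x = gauss_int l G x.
Proof. by move=> h; apply: coords_int_eq => z /h ->. Qed.

Lemma gauss_int_le l F G x : mnn F -> mnn G ->
  (forall z, agree_off l x z -> F z <= G z) ->
  gauss_int l F x <= gauss_int l G x.
Proof.
move=> mF mG h; apply: coords_int_le; try exact: mnn_gdens.
by move=> z /h; apply: lee_wpmul2l; rewrite lee_fin gdens_ge0.
Qed.

Lemma gauss_int_perm l l' F : perm_eq l l' -> mnn F -> gauss_int l F = gauss_int l' F.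
Proof.
move=> ll' mF; rewrite /gauss_int (coords_int_perm ll')//; last exact: mnn_gdens.
by congr coords_int; apply/funext => x; rewrite /gdens (perm_big _ ll').
Qed.

Lemma gdens_agree l l' x z : {in l, forall j, j \notin l'} -> agree_off l' x z ->
  gdens l z = gdens l x.
Proof.
by move=> h xz; apply: eq_big_seq => j jl; rewrite xz// h.
Qed.

Lemma gauss_int_cat l l' F : {in l, forall j, j \notin l'} -> mnn F ->
  gauss_int (l ++ l') F = gauss_int l (gauss_int l' F).
Proof.
move=> h mF; apply/funext => x; rewrite /gauss_int coords_int_cat.
apply: coords_int_eq => z _;
have H : coords_int l' (fun y => (gdens l y)%:E * ((gdens l' y)%:E * F y)) z =
    (gdens l z)%:E * coords_int l' (fun y => (gdens l' y)%:E * F y) z.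
  apply: (coords_intZl (k := fun y => (gdens l y)%:E)); first exact: mnn_gdens.
    by rewrite lee_fin gdens_ge0.
  by move=> y zy; rewrite (gdens_agree h zy).
by rewrite -H; apply: coords_int_eq => y _; rewrite /gdens big_cat/= EFinM muleA.
Qed.

Lemma gauss_intZl l (k : tape -> \bar R) F x : mnn F ->
  0 <= k x -> (forall z, agree_off l x z -> k z = k x) ->
  gauss_int l (fun z => k z * F z) x = k x * gauss_int l F x.
Proof.
move=> mF k0 kl; rewrite /gauss_int -coords_intZl//; last exact: mnn_gdens.
by apply: coords_int_eq => z _; rewrite muleCA.
Qed.

Lemma coords_int_prod l (f : nat -> R -> R) (c : nat -> R) x : uniq l ->
  (forall j, measurable_fun setT (f j)) -> (forall j y, 0 <= f j y)%R ->
  (forall j, j \in l -> \int[leb]_y (f j y)%:E = (c j)%:E) ->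
  coords_int l (fun z => (\prod_(j <- l) f j (z j))%:E) x = (\prod_(j <- l) c j)%:E.
Proof.
move=> + mf f0; elim: l x => [|i l IH] x /=; first by rewrite !big_nil.
move=> /andP[il ul] hc.
have mP : mnn (fun z : tape => (\prod_(j <- l) f j (z j))%:E).
  split; last by move=> z; rewrite lee_fin prodr_ge0.
  apply/measurable_EFinP; apply: measurable_prod => j _.
  exact: (measurableT_comp (mf j) (measurable_coord j)).
transitivity (\int[leb]_y ((\prod_(j <- l) c j)%:E * (f i y)%:E)).
  apply: eq_integral => y _.
  rewrite -(IH (upd x i y))//; last by move=> j jl; rewrite hc// inE jl orbT.
  have H : coords_int l (fun z => (f i (z i))%:E * (\prod_(j <- l) f j (z j))%:E) (upd x i y) =
      (f i (upd x i y i))%:E * coords_int l (fun z => (\prod_(j <- l) f j (z j))%:E) (upd x i y).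
    apply: (coords_intZl (k := fun z => (f i (z i))%:E)) => //; first by rewrite lee_fin.
    by move=> z hz; rewrite hz.
  rewrite updE in H; rewrite [RHS]muleC -H.
  by apply: coords_int_eq => z _; rewrite big_cons EFinM.
rewrite lebesgue_integralZl ?hc ?mem_head//.
- by rewrite big_cons mulrC.
- rewrite big_seq; apply: prodr_ge0 => j jl; rewrite -lee_fin -hc ?inE ?jl ?orbT//.
  by apply: integral_ge0 => y _; rewrite lee_fin.
- by apply/measurable_EFinP.
- by move=> y; rewrite lee_fin.
Qed.

Lemma measurable_rho : measurable_fun setT rho.
Proof. exact: measurable_normal_pdf. Qed.

Lemma gauss_int_prod l (h : nat -> R -> R) (c : nat -> R) x : uniq l ->
  (forall j, measurable_fun setT (h j)) -> (forall j y, 0 <= h j y)%R ->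
  (forall j, j \in l -> \int[leb]_y (rho y * h j y)%:E = (c j)%:E) ->
  gauss_int l (fun z => (\prod_(j <- l) h j (z j))%:E) x = (\prod_(j <- l) c j)%:E.
Proof.
move=> ul mh h0 hc.
rewrite -(@coords_int_prod l (fun j y => rho y * h j y)%R c x)//.
- by apply: coords_int_eq => z _; rewrite -EFinM big_split.
- by move=> j; apply: measurable_funM => //; exact: measurable_rho.
- by move=> j y; rewrite mulr_ge0 ?normal_pdf_ge0.
Qed.

Lemma gauss_int1 l x : uniq l -> gauss_int l (fun=> 1) x = 1.
Proof.
move=> ul; transitivity (gauss_int l (fun z => (\prod_(j <- l) 1)%:E) x).
  by apply: gauss_int_eq => z _; rewrite big1_eq.
rewrite (@gauss_int_prod l (fun _ _ => 1%R) (fun=> 1%R)) ?big1_eq// => j _.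
by under eq_integral do rewrite mulr1; exact: integral_normal_pdf.
Qed.

Lemma gauss_int_cst l (F : tape -> \bar R) x : uniq l -> 0 <= F x ->
  (forall z, agree_off l x z -> F z = F x) -> gauss_int l F x = F x.
Proof.
move=> ul F0 Fl; transitivity (gauss_int l (fun z => F z * 1) x).
  by apply: gauss_int_eq => z _; rewrite mule1.
by rewrite gauss_intZl// ?gauss_int1 ?mule1//; split => //; exact: measurable_cst.
Qed.

(** A coordinate hyperplane is a null set. This disposes of the division by |g|^2 where g
    vanishes. *)
Lemma coords_int_ae l i (F G : tape -> \bar R) x : uniq l -> i \in l ->
  mnn F -> mnn G -> (forall z, z i != 0%R -> F z = G z) ->
  coords_int l F x = coords_int l G x.
Proof.
move=> ul il mF mG h.
have pl : perm_eq l (rem i l ++ [:: i]) by rewrite (perm_trans (perm_to_rem il))// -cat1s perm_catC.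
rewrite !(coords_int_perm pl)// !coords_int_cat; apply: coords_int_eq => z _ /=.
apply: ge0_ae_eq_integral => //.
- exact: (mnn_upd _ _ mF).
- exact: (mnn_upd _ _ mG).
- by move=> y _; case: mF.
- by move=> y _; case: mG.
exists [set 0%R]; split; [exact: measurable_set1|exact: lebesgue_measure_set1|].
move=> y /= /not_implyP[_ yh]; apply: contrapT => /eqP y0; apply: yh.
by apply: h; rewrite updE.
Qed.

(** Here [P] covers the coordinates that [F] reads; of the base point only those left unintegrated
    matter. *)
Lemma coords_int_dep l (P : pred nat) (F : tape -> \bar R) x x' :
  (forall y y' : nat -> R, (forall j, P j -> y j = y' j) -> F y = F y') ->
  (forall j, P j -> j \notin l -> x j = x' j) -> coords_int l F x = coords_int l F x'.
Proof.
move=> hF; elim: l x x' => [|i l IH] x x' h /=; first by apply: hF => j /h ->.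
apply: eq_integral => y _; apply: IH => j Pj jl; rewrite /upd; case: eqP => // /eqP ji.
by rewrite h// inE negb_or ji.
Qed.

Lemma measurable_funV_ge0 d0 (T : measurableType d0) (g : T -> R) :
  measurable_fun setT g -> (forall t, 0 <= g t)%R ->
  measurable_fun setT (fun t => (g t)^-1)%R.
Proof.
move=> mg g0; rewrite (_ : (fun t => _) = (fun t => g t `^ (-1))%R).
  exact: (measurableT_comp (measurable_powR (-1)) mg).
by apply/funext => t; rewrite powR_inv1.
Qed.

Lemma measurable_fun_sqrt d0 (T : measurableType d0) (g : T -> R) :
  measurable_fun setT g -> measurable_fun setT (fun t => Num.sqrt (g t)).
Proof.
move=> mg; apply: (measurableT_comp _ mg); apply: continuous_measurable_fun.
exact: sqrt_continuous.
Qed.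
End gauss.

(** * The law of the noise under rank-one shifts *)

Section noise.
Variables (R : realType) (d m : nat).
Local Open Scope ereal_scope.
Notation tape := (tape R).
Let n := (d + d)%N.
Let N := (d * n)%N.
Variables (e : 'I_d -> 'I_n -> nat) (f : 'I_m -> nat).
Hypotheses (e_inj : forall i a i' a', e i a = e i' a' -> i = i' /\ a = a')
  (f_inj : injective f) (ef : forall i a j, e i a != f j) (m_gt0 : (0 < m)%N).
Variable L : R.
Hypothesis L_gt0 : (0 < L)%R.
Notation peak := (@normal_peak R 1).

Definition scale_coords : seq nat := [seq f j | j <- enum 'I_m].
Notation lG := (gram_coords e).

Lemma scale_coords_uniq : uniq scale_coords. Proof. by rewrite map_inj_uniq ?enum_uniq. Qed.
Lemma size_scale_coords : size scale_coords = m. Proof. by rewrite size_map size_enum_ord. Qed.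
Lemma size_gram_coords : size lG = N.
Proof. by rewrite size_map -cardT card_prod !card_ord. Qed.
Lemma mem_scale_coords j : f j \in scale_coords. Proof. by apply: map_f; rewrite mem_enum. Qed.

Lemma scale_notin_gram : {in scale_coords, forall j, j \notin lG}.
Proof.
move=> _ /mapP[j _ ->]; apply/negP => /mapP[[i a] _ /=] /eqP.
by rewrite eq_sym (negbTE (ef _ _ _)).
Qed.
Lemma gram_notin_scale : {in lG, forall j, j \notin scale_coords}.
Proof. by move=> j jG; apply/negP => /scale_notin_gram; rewrite jG. Qed.

Definition noise (x : tape) : 'M[R]_d := ((L / sqs scale_coords x) *: gram e x)%R.

Lemma mx_meas_noise : mx_meas noise.
Proof.
apply: mx_meas_scale; last exact: mx_meas_gram.
apply: measurable_funM => //.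
by apply: measurable_funV_ge0 => [|x]; [exact: measurable_sqs|exact: sqs_ge0].
Qed.

Let gdensN (z : tape) : gdens (scale_coords ++ lG) z =
  (peak ^+ (m + N) * (expR (- sqs scale_coords z / 2) * expR (- sqs lG z / 2)))%R.
Proof.
by rewrite gdensE size_cat size_scale_coords size_gram_coords -expRD /sqs big_cat/= opprD mulrDl.
Qed.

Lemma sqs_gram (z : tape) : sqs lG z = \tr (gram e z).
Proof.
rewrite /sqs big_map big_enum /= /mxtrace.
rewrite (eq_bigr (fun i => \sum_a z (e i a) * z (e i a)))%R; last by move=> i _; rewrite gramE.
by rewrite pair_bigA/=; apply: eq_bigr => q _; rewrite expr2.
Qed.

Let sqs_agree l l' (x z : tape) : {in l, forall j, j \notin l'} -> agree_off l' x z ->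
  sqs l z = sqs l x.
Proof. by move=> h xz; apply: eq_big_seq => j jl; rewrite xz// h. Qed.

Let gram_agree (x z : tape) : agree_off scale_coords x z -> gram e z = gram e x.
Proof.
move=> xz; apply/matrixP => i j; rewrite !gramE; apply: eq_bigr => a _.
by rewrite !xz// gram_notin_scale// mem_gram_coords.
Qed.

(** Once G is replaced by [scale] times G, the noise is G G^T itself. *)
Let scale (z : tape) : R := Num.sqrt (sqs scale_coords z / L).
(** The factor that this substitution leaves in front of the test function: the Gaussian weights of
    g and G times the Jacobian, with t standing for the trace of G G^T. *)
Let wgt (t : R) (z : tape) : R :=
  (peak ^+ (m + N) * (scale z ^+ N * expR (- sqs scale_coords z * (1 + t / L) / 2)))%R.
Let wgt_ge0 t z : (0 <= wgt t z)%R.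
Proof.
by rewrite mulr_ge0 ?exprn_ge0 ?normal_peak_ge0// mulr_ge0 ?expR_ge0// exprn_ge0 ?sqrtr_ge0.
Qed.

Let mscale : measurable_fun setT scale.
Proof.
apply: measurable_fun_sqrt.
by apply: measurable_funM; [exact: measurable_sqs|exact: measurable_cst].
Qed.

Let mwgt (t : tape -> R) : measurable_fun setT t ->
  measurable_fun setT (fun z => wgt (t z) z).
Proof.
move=> mt; apply: measurable_funM; first exact: measurable_cst.
apply: measurable_funM; first exact: measurable_funX.
apply: (measurableT_comp (@measurable_expR R)).
apply: measurable_funM; last exact: measurable_cst.
apply: measurable_funM; first by apply: measurableT_comp => //; exact: measurable_sqs.
apply: measurable_funD; first exact: measurable_cst.
by apply: measurable_funM => //; exact: measurable_cst.
Qed.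

(* The radial profile of the density of the noise. *)
Let kap (t : R) : R := ((Num.sqrt (1 + t / L))^-1 ^+ (m + N))%R.
Let kap_ge0 t : (0 <= kap t)%R.
Proof. by rewrite exprn_ge0// invr_ge0 sqrtr_ge0. Qed.
Let mkap : measurable_fun setT kap.
Proof.
apply: measurable_funX.
apply: measurable_funV_ge0 => [|t]; last exact: sqrtr_ge0.
apply: measurable_fun_sqrt.
apply: measurable_funD; first exact: measurable_cst.
by apply: measurable_funM => //; exact: measurable_cst.
Qed.

Let noise_scaled (phi : 'M[R]_d -> \bar R) z : mx_mnn phi -> sqs scale_coords z != 0%R ->
  coords_int lG (fun y => (gdens (scale_coords ++ lG) y)%:E * phi (noise y)) z =
  coords_int lG (fun y => (wgt (sqs lG y) y)%:E * phi (gram e y)) z.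
Proof.
move=> mphi q0.
have q_gt0 : (0 < sqs scale_coords z)%R by rewrite lt_def q0 sqs_ge0.
have s0 : (0 < scale z)%R by rewrite sqrtr_gt0 divr_gt0.
have mF : mnn (fun y => (gdens (scale_coords ++ lG) y)%:E * phi (noise y)).
  apply: mnn_gdens; split=> [|y]; last exact: mphi.2.
  exact: (mphi.1 _ _ _ mx_meas_noise).
rewrite -(coords_int_scale z (gram_coords_uniq e_inj) mF s0) size_gram_coords.
rewrite -coords_intZl_cst/=; first last.
- by rewrite exprn_ge0// ltW.
- by apply: mnn_comp => //; apply: measurable_mapon => j; exact: measurable_funM.
apply: coords_int_eq => y zy /=; set y' := mapon _ _ y.
have yf : sqs scale_coords y' = sqs scale_coords y.
  by apply: eq_big_seq => j /scale_notin_gram jG; rewrite /y' /mapon (negbTE jG).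
have yz : sqs scale_coords y = sqs scale_coords z by exact: (sqs_agree scale_notin_gram zy).
have sy : scale y = scale z by rewrite /scale yz.
have yG : gram e y' = (scale z ^+ 2 *: gram e y)%R.
  apply/matrixP => i j; rewrite !mxE mulr_sumr; apply: eq_bigr => a _.
  by rewrite !mxE /y' /mapon !mem_gram_coords; ring.
have s2 : (scale z ^+ 2 = sqs scale_coords z / L)%R by rewrite sqr_sqrtr// divr_ge0// ltW.
rewrite muleA; congr (_ * phi _).
  rewrite -EFinM; congr EFin; rewrite gdensN /wgt sy yf !sqs_gram yG mxtraceZ s2.
  rewrite mulrCA; congr (_ * (_ * _))%R; rewrite -expRD; congr expR.
  by rewrite yz; field; rewrite gt_eqF.
rewrite /noise yf yz yG scalerA s2 (_ : L / sqs scale_coords z * (sqs scale_coords z / L) = 1)%R ?scale1r//.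
by field; rewrite q0 gt_eqF.
Qed.

(** After the substitution for G the noise no longer involves g. Dilating g by (1 + t / L)^(-1/2),
    where t is the trace, then removes t from the Gaussian weight. The dilation yields the power m
    as its Jacobian and the power N through the homogeneous factor [scale], which together give
    [kap]. The integral over g that remains is a normalizing constant and is never evaluated. *)
Lemma gauss_int_noise (phi : 'M[R]_d -> \bar R) x : mx_mnn phi ->
  gauss_int (scale_coords ++ lG) (phi \o noise) x =
  coords_int scale_coords (fun z => (wgt 0 z)%:E) x *
  coords_int lG (fun y => (kap (\tr (gram e y)))%:E * phi (gram e y)) x.
Proof.
move=> mphi.
have mphin : mnn (phi \o noise).
  by split=> [|y]; [exact: (mphi.1 _ _ _ mx_meas_noise)|exact: mphi.2].
have mphig : mnn (phi \o gram e).
  by split=> [|y]; [exact: (mphi.1 _ _ _ (mx_meas_gram e))|exact: mphi.2].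
have mW : mnn (fun y => (wgt (sqs lG y) y)%:E * phi (gram e y)).
  split=> [|y]; last by rewrite mule_ge0 ?lee_fin//; exact: mphi.2.
  apply: emeasurable_funM; last by case: mphig.
  by apply/measurable_EFinP; apply: mwgt; exact: measurable_sqs.
have mw t : mnn (fun z => (wgt t z)%:E).
  split=> [|y]; last by rewrite lee_fin.
  by apply/measurable_EFinP; apply: mwgt; exact: measurable_cst.
have mk : mnn (fun y => (kap (\tr (gram e y)))%:E * phi (gram e y)).
  split=> [|y]; last by rewrite mule_ge0 ?lee_fin//; exact: mphi.2.
  apply: emeasurable_funM; last by case: mphig.
  apply/measurable_EFinP; apply: (measurableT_comp mkap).
  by apply: measurable_sum => i; exact: mx_meas_gram.
have K_dep z : coords_int scale_coords (fun y => (wgt 0 y)%:E) z = coords_int scale_coords (fun y => (wgt 0 y)%:E) x.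
  apply: (@coords_int_dep _ scale_coords (mem scale_coords)) => [y y' yy'|j /= jf /negP//].
  have qq : sqs scale_coords y = sqs scale_coords y' by apply: eq_big_seq => j /yy' ->.
  by rewrite /wgt /scale qq.
rewrite /gauss_int coords_int_cat.
transitivity (coords_int scale_coords (coords_int lG (fun y => (wgt (sqs lG y) y)%:E * phi (gram e y))) x).
  (* One nonzero coordinate of g is enough for |g|^2 to be nonzero. *)
  apply: (coords_int_ae _ scale_coords_uniq (mem_scale_coords (Ordinal m_gt0))).
  - by apply: mnn_coords_int; exact: mnn_gdens.
  - exact: mnn_coords_int.
  move=> z z0; apply: noise_scaled => //.
  apply: contraNneq z0 => q0.
  move: q0; rewrite /sqs big_map big_enum/= => /psumr_eq0P h.
  by have /eqP := h (fun i _ => sqr_ge0 _) (Ordinal m_gt0) isT; rewrite sqrf_eq0.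
rewrite coords_intC//.
rewrite -coords_intZl//; last 1 first.
- by case: (mnn_coords_int scale_coords (mw 0%R)).
apply: coords_int_eq => z xz.
have tz : (0 <= sqs lG z)%R by exact: sqs_ge0.
have t1 : (0 < 1 + sqs lG z / L)%R by rewrite ltr_pwDl// divr_ge0// ltW.
transitivity (phi (gram e z) * coords_int scale_coords (fun y => (wgt (sqs lG z) y)%:E) z).
  rewrite -(coords_intZl (k := fun y => phi (gram e y)))//; last first.
  - by move=> y zy; rewrite (gram_agree zy).
  - exact: mphi.2.
  apply: coords_int_eq => y zy; rewrite muleC; congr (_ * (wgt _ _)%:E).
  by apply: sqs_agree zy; exact: gram_notin_scale.
rewrite muleC [RHS]muleA; congr (_ * _).
set c := ((Num.sqrt (1 + sqs lG z / L))^-1)%R.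
have c0 : (0 < c)%R by rewrite invr_gt0 sqrtr_gt0.
rewrite -(coords_int_scale z scale_coords_uniq (mw (sqs lG z)) c0) size_scale_coords.
rewrite [RHS]muleC /kap -sqs_gram -/c exprD EFinM -muleA; congr (_ * _).
rewrite -coords_intZl_cst//; last by rewrite exprn_ge0// ltW.
apply: coords_int_eq => y _ /=; rewrite -EFinM; congr EFin.
set y' := mapon _ _ y.
have c2 : (c ^+ 2 * (1 + sqs lG z / L) = 1)%R.
  by rewrite exprVn sqr_sqrtr ?ltW// mulVf// gt_eqF.
have qy : sqs scale_coords y' = (c ^+ 2 * sqs scale_coords y)%R.
  rewrite /sqs mulr_sumr; apply: eq_big_seq => j jf.
  by rewrite /y' /mapon jf exprMn.
have sy : scale y' = (c * scale y)%R.
  by rewrite /scale qy -mulrA sqrtrM ?sqr_ge0// sqrtr_sqr gtr0_norm.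
rewrite /wgt sy qy exprMn.
rewrite (_ : - (c ^+ 2 * sqs scale_coords y) * (1 + sqs lG z / L) / 2 = - sqs scale_coords y * (1 + 0 / L) / 2)%R; first ring.
rewrite mul0r addr0 mulr1.
rewrite [in RHS](_ : - sqs scale_coords y = - sqs scale_coords y * (c ^+ 2 * (1 + sqs lG z / L)))%R; first ring.
by rewrite c2 mulr1.
Qed.

(** This is 1 + t / L <= (1 + a / L) (1 + t' / L) together with 1 + a / L <= exp (a / L), raised to
    the power (m + N) / 2. The maximum is needed because an unshifted Gram matrix may have a trace
    below [a]. *)
Lemma kap_shift (a t : R) : (0 <= a)%R -> (0 <= t)%R ->
  (kap (Num.max (t - a) 0) <= expR (a * (m + N)%:R / (2 * L)) * kap t)%R.
Proof.
move=> a0 t0; set t' := Num.max _ _.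
have t'0 : (0 <= t')%R by rewrite le_max lexx orbT.
have tt' : (t <= t' + a)%R by rewrite -lerBlDr le_max lexx.
have p1 : (0 < 1 + t / L)%R by rewrite ltr_pwDl// divr_ge0// ltW.
have p1' : (0 < 1 + t' / L)%R by rewrite ltr_pwDl// divr_ge0// ltW.
have -> : (a * (m + N)%:R / (2 * L) = (a / (2 * L)) * (m + N)%:R)%R by ring.
rewrite expRM_natr -exprMn.
apply: lerXn2r; rewrite ?nnegrE ?mulr_ge0 ?invr_ge0 ?sqrtr_ge0 ?expR_ge0//.
rewrite ler_pdivlMr ?sqrtr_gt0// mulrC ler_pdivrMr ?sqrtr_gt0//.
have e2 : (expR (a / (2 * L)) = Num.sqrt (expR (a / L)))%R.
  rewrite (_ : a / L = a / (2 * L) *+ 2)%R; last by rewrite mulr2n; field; rewrite gt_eqF.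
  by rewrite mulr2n expRD -expr2 sqrtr_sqr ger0_norm ?expR_ge0.
rewrite e2 -sqrtrM ?expR_ge0// ler_sqrt; last by rewrite mulr_ge0 ?expR_ge0// ltW.
apply: (@le_trans _ _ ((1 + a / L) * (1 + t' / L))%R); last first.
  by rewrite ler_pM2r// expR_ge1Dx.
have : (0 <= (a / L) * (t' / L))%R by rewrite mulr_ge0// divr_ge0// ltW.
have : (t / L <= (t' + a) / L)%R by rewrite ler_pM2r// invr_gt0.
rewrite mulrDl; nra.
Qed.

Lemma noise_rank1_shift (phi : 'M[R]_d -> \bar R) (v : 'cV[R]_d) x : mx_mnn phi ->
  gauss_int (scale_coords ++ lG) (fun z => phi (noise z + v *m v^T)%R) x <=
  (expR ((\sum_i v i 0 ^+ 2) * (m + N)%:R / (2 * L)))%:E *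
  gauss_int (scale_coords ++ lG) (phi \o noise) x.
Proof.
move=> mphi.
set a := (\sum_i v i 0 ^+ 2)%R.
have a0 : (0 <= a)%R by apply: sumr_ge0 => i _; exact: sqr_ge0.
have trv : \tr (v *m v^T) = a.
  by apply: eq_bigr => i _; rewrite mxE big_ord1 mxE expr2.
have mphiv : mx_mnn (fun M => phi (M + v *m v^T)%R).
  split=> [d0 T g mg|M]; last exact: mphi.2.
  apply: (mphi.1 _ _ (fun t => g t + v *m v^T)%R).
  by apply: mx_meas_add => //; exact: mx_meas_cst.
have K0 : 0 <= coords_int scale_coords (fun z => (wgt 0 z)%:E) x.
  elim: scale_coords x => [|i l IH] y /=; first by rewrite lee_fin.
  by apply: integral_ge0 => ? _; exact: IH.
rewrite (gauss_int_noise x mphiv) (gauss_int_noise x mphi) muleCA.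
apply: lee_wpmul2l => //.
(* At a shifted Gram matrix the weight of [Phi] is the density at the unshifted one, so
   [gram_rank1_shift] can remove the shift from the whole integrand. *)
pose Phi M := (kap (Num.max (\tr M - a) 0))%:E * phi M.
have mtr d0 (T : measurableType d0) (g : T -> 'M[R]_d) : mx_meas g ->
    measurable_fun setT (fun t => \tr (g t)).
  by move=> mg; apply: measurable_sum => i; exact: mg.
have mPhi : mx_mnn Phi.
  split=> [d0 T g mg|M]; last by rewrite mule_ge0 ?lee_fin//; exact: mphi.2.
  apply: emeasurable_funM; last exact: (mphi.1 _ _ _ mg).
  apply/measurable_EFinP; apply: (measurableT_comp mkap).
  apply: measurable_maxr; last exact: measurable_cst.
  by apply: measurable_funB; [exact: mtr|exact: measurable_cst].
have mk : mx_mnn (fun M => (kap (\tr M))%:E * phi M).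
  split=> [d0 T g mg|M]; last by rewrite mule_ge0 ?lee_fin//; exact: mphi.2.
  apply: emeasurable_funM; last exact: (mphi.1 _ _ _ mg).
  by apply/measurable_EFinP; apply: (measurableT_comp mkap); exact: mtr.
have tr0 (z : tape) : (0 <= \tr (gram e z))%R by rewrite -sqs_gram sqs_ge0.
have mg (F : 'M[R]_d -> \bar R) : mx_mnn F -> mnn (F \o gram e).
  move=> mF; split=> [|z]; [exact: (mF.1 _ _ _ (mx_meas_gram e))|exact: mF.2].
rewrite -(coords_intZl_cst lG _ (mg _ mk)) ?expR_ge0//.
apply: le_trans (le_trans (gram_rank1_shift e_inj v x mPhi) _).
  rewrite le_eqVlt; apply/orP; left; apply/eqP; apply: coords_int_eq => z _.
  by rewrite /Phi raddfD/= trv addrK (max_idPl (tr0 z)).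
apply: coords_int_le.
- exact: mg.
- split=> [|z]; last by rewrite mule_ge0 ?lee_fin ?expR_ge0//; exact: (mg _ mk).2.
  by apply: emeasurable_funM; [exact: measurable_cst|exact: (mg _ mk).1].
move=> z _ /=; rewrite /Phi muleA -EFinM; apply: lee_wpmul2r; first exact: mphi.2.
by rewrite lee_fin (le_trans (kap_shift a0 (tr0 z))).
Qed.
End noise.

(** * The law of the random tape *)

Section law.
Variable R : realType.
Local Open Scope ereal_scope.
Notation leb := (@lebesgue_measure R).
Notation tape := (tape R).
Notation MR := (measurableTypeR R).
Notation rho := (@normal_pdf R 0 1).
Notation gam := (@normal_prob R 0 1).
Import HBNNSimple.

Lemma integral_normal_prob (f : R -> \bar R) : measurable_fun setT f ->
  (forall x, 0 <= f x) ->
  \int[gam]_x f x = \int[leb]_x ((rho x)%:E * f x).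
Proof.
move=> mf f0.
have mf' : measurable_fun [set: MR] f by exact: mf.
pose f_ := nnsfun_approx measurableT mf'.
have mrho : measurable_fun [set: MR] (fun x => (rho x)%:E).
  by apply/measurable_EFinP; exact: measurable_normal_pdf.
have mfn n : measurable_fun [set: MR] (fun x => (f_ n x)%:E) by apply/measurable_EFinP.
have mrfn n : measurable_fun [set: MR] (fun x => (rho x)%:E * (f_ n x)%:E).
  exact: emeasurable_funM.
transitivity (limn (fun n => \int[gam]_x (f_ n x)%:E)).
  rewrite -monotone_convergence//.
  - by apply: eq_integral => x _; apply/esym/cvg_lim => //; exact: cvg_nnsfun_approx.
  - by move=> n x _; rewrite lee_fin.
  - by move=> x _ p q pq; rewrite lee_fin; exact/lefP/nd_nnsfun_approx.
transitivity (limn (fun n => \int[leb]_x ((rho x)%:E * (f_ n x)%:E))); last first.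
  rewrite -monotone_convergence//.
  - apply: eq_integral => x _; apply/cvg_lim => //.
    apply: cvgeZl => //; exact: cvg_nnsfun_approx.
  - by move=> n x _; rewrite mule_ge0 ?lee_fin ?normal_pdf_ge0.
  - move=> x _ p q pq; apply: lee_wpmul2l; first by rewrite lee_fin normal_pdf_ge0.
    by rewrite lee_fin; exact/lefP/nd_nnsfun_approx.
congr (limn _); apply/funext => n.
transitivity (\sum_(r \in range (f_ n)) r%:E * gam (f_ n @^-1` [set r])).
  by rewrite integralT_nnsfun sintegralE.
transitivity (\int[leb]_x (\sum_(r \in range (f_ n)) (r%:E * ((rho x)%:E * (\1_(f_ n @^-1` [set r]) x)%:E)))).
  rewrite ge0_integral_fsum//.
  - apply: eq_fsbigr => r; rewrite inE => -[y _ <-].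
    rewrite ge0_integralZl//.
    + congr (_ * _); rewrite /normal_prob [LHS]integral_mkcond; apply: eq_integral => x _.
      by rewrite patchE indicE; case: ifP => _; rewrite ?mule1 ?mule0.
    + apply: emeasurable_funM => //; apply/measurable_EFinP; exact: measurable_indic.
    + by move=> x _; rewrite mule_ge0 ?lee_fin ?normal_pdf_ge0.
    + by rewrite lee_fin.
  - move=> r; apply: emeasurable_funM => //; apply: emeasurable_funM => //.
    by apply/measurable_EFinP; exact: measurable_indic.
  - move=> r x _; rewrite muleCA; apply: mule_ge0; first by rewrite lee_fin normal_pdf_ge0.
    exact: nnfun_muleindic_ge0.
apply: eq_integral => x _.
transitivity ((rho x)%:E * (\sum_(r \in range (f_ n)) (r%:E * (\1_(f_ n @^-1` [set r]) x)%:E))).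
  rewrite ge0_mule_fsumr//; last by move=> r; exact: nnfun_muleindic_ge0.
  by apply: eq_fsbigr => r _; rewrite muleCA.
by congr (_ * _); rewrite fsumEFin// -fimfunE.
Qed.

Section image.
Context d1 d2 (T1 : measurableType d1) (T2 : measurableType d2).
Variables (m : {measure set T1 -> \bar R}) (g : T1 -> T2) (mg : measurable_fun setT g).

Definition image_measure : {measure set T2 -> \bar R}.
Proof. by refine (pushforward m g); exact: mg. Defined.

Lemma image_measureE A : image_measure A = m (g @^-1` A).
Proof. by []. Qed.

Lemma integral_image_measure (F : T2 -> \bar R) : measurable_fun setT F ->
  (forall x, 0 <= F x) -> \int[image_measure]_x F x = \int[m]_x F (g x).
Proof. by move=> mF F0; rewrite (ge0_integral_pushforward mg). Qed.
End image.

Section iid.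
Context (disp : measure_display) (W : measurableType disp) (Pr : probability W R).
Variable xi : nat -> {RV Pr >-> R}.
Hypothesis iid : iid_normal xi.

(** Filling up with zeros keeps the values in the space of tapes, so that the law can be computed by
    induction on [N]. *)
Definition prefix N (w : W) : tape := fun j => if (j < N)%N then xi j w else 0%R.

Lemma measurable_prefix N : measurable_fun setT (prefix N).
Proof.
apply: measurable_tape => j; case nl : (j < N)%N; rewrite /prefix nl.
  exact: measurable_funPT.
exact: measurable_cst.
Qed.

HB.instance Definition _ N := isMeasurableFun.Build _ _ _ _ (prefix N) (measurable_prefix N).

(** Sets constraining a single coordinate are not stable under intersection; boxes are, as
    uniqueness of measures requires. *)
Definition boxes : set (set tape) :=
  [set A | exists n (B : nat -> set R), (forall j, measurable (B j)) /\
     A = [set x | forall j, (j < n)%N -> B j (x j)]].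

Lemma boxesE : @measurable _ tape = <<s boxes >>.
Proof.
apply/seteqP; split.
  apply: smallest_sub; first exact: smallest_sigma_algebra.
  move=> _ [n [B [mB ->]]]; apply: sub_sigma_algebra.
  exists n.+1, (fun j => if j == n then B else setT); split.
    by move=> j; case: eqP.
  apply/seteqP; split => x /=.
    by move=> Bx j _; case: eqP => [->|].
  by move=> /(_ n (ltnSn n)); rewrite eqxx.
apply: smallest_sub; first exact: sigma_algebra_measurable.
move=> _ [n [B [mB ->]]].
rewrite (_ : [set x | _] = \bigcap_(j in [set j | (j < n)%N]) [set x : tape | B j (x j)]); last first.
  by apply/seteqP; split => x /= h j; exact: h.
apply: bigcap_measurableType => j _.
by rewrite -[X in measurable X]setTI; exact: (@measurable_coord R j).
Qed.

(** The hypothesis [iid] speaks about boxes only; uniqueness of measures on a generating pi-system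
    extends it to all events of the prefix. *)
Let indep N (A : set tape) (B : set R) : measurable A -> measurable B ->
  Pr (prefix N @^-1` A `&` xi N @^-1` B) = Pr (prefix N @^-1` A) * gam B.
Proof.
move=> mA mB.
have mxB : measurable (xi N @^-1` B) by rewrite -[X in measurable X]setTI; exact: measurable_funPT.
have gfin : gam B \is a fin_num by exact: fin_num_measure.
have g0 : (0 <= fine (gam B))%R by exact: fine_ge0.
pose m1 := image_measure (mrestr Pr mxB) (measurable_prefix N).
pose m0 := image_measure Pr (measurable_prefix N).
pose m2 : {measure set tape -> \bar R} := mscale (NngNum g0) m0.
have m2E A0 : m2 A0 = gam B * Pr (prefix N @^-1` A0).
  transitivity ((fine (gam B))%:E * m0 A0) => //.
  by rewrite fineK.
suff -> : Pr (prefix N @^-1` A `&` xi N @^-1` B) = m2 A.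
  by rewrite m2E muleC.
apply: (measure_unique boxes (fun=> setT) boxesE _ _ _ m1 m2) => //.
- move=> _ _ [n1 [B1 [mB1 ->]]] [n2 [B2 [mB2 ->]]].
  exists (maxn n1 n2), (fun j => (if (j < n1)%N then B1 j else setT) `&` (if (j < n2)%N then B2 j else setT)).
  split=> [j|]; first by apply: measurableI; case: ifP.
  apply/seteqP; split => x /=.
    by move=> [h1 h2] j _; split; case: ifP => // jn; [exact: h1|exact: h2].
  move=> h; split=> j jn; have := h j; rewrite leq_max jn ?orbT => /(_ isT) [].
    by [].
  by [].
- move=> _; exists 0%N, (fun=> setT); split => //.
  by apply/seteqP; split.
- by apply/seteqP; split => // x _; exists 0%N.
- move=> _ [n [B1 [mB1 ->]]].
  (* From index [N] on the prefix is 0, so a box that excludes 0 at such an index has an empty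
     preimage. *)
  have [h|h] := pselect (forall j, (N <= j < n)%N -> B1 j 0%R); last first.
    have e0 : prefix N @^-1` [set x | forall j, (j < n)%N -> B1 j (x j)] = set0.
      apply/seteqP; split => w //= hw; apply: h => j /andP[Nj jn].
      by have := hw j jn; rewrite /prefix ltnNge Nj.
    rewrite m2E image_measureE e0 !measure0 mule0//.
  pose B' j := if (j < n)%N then B1 j else setT.
  have mB' j : measurable (B' j) by rewrite /B'; case: ifP.
  have E : prefix N @^-1` [set x | forall j, (j < n)%N -> B1 j (x j)] =
      \bigcap_(j in `I_N) (xi j @^-1` B' j).
    apply/seteqP; split => w /= hw j.
      by move=> jN; rewrite /B' /=; case: ifP => // /(hw j); rewrite /prefix jN.
    move=> jn; rewrite /prefix; case: ltnP => jN; last by apply: h; rewrite jN.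
    by have := hw j jN; rewrite /B' /= jn.
  pose B'' j := if j == N then B else B' j.
  have mB'' j : measurable (B'' j) by rewrite /B''; case: eqP.
  have B''N : B'' N = B by rewrite /B'' eqxx.
  have := iid N.+1 mB''; rewrite big_ord_recr /= B''N.
  rewrite (eq_bigr (fun j : 'I_N => gam (B' j))); last first.
    by move=> j _; rewrite /B'' ltn_eqF.
  rewrite -iid// => iidN.
  apply/esym; apply: (etrans (m2E _)); rewrite E muleC -iidN; apply/esym.
  change (mrestr Pr mxB (prefix N @^-1` [set x | forall j, (j < n)%N -> B1 j (x j)]) =
    Pr (\bigcap_(j in `I_N.+1) (xi j @^-1` B'' j))).
  rewrite E /mrestr; congr (Pr _); apply/seteqP; split => w /=.
    move=> [h1 h2] j /=; rewrite ltnS leq_eqVlt /B''; case: eqP => [->//|_] /= jN.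
    exact: h1.
  move=> hw; split; last by have := hw N (ltnSn N); rewrite /B'' eqxx.
  by move=> j /= jN; have := hw j (ltnW jN); rewrite /B'' ltn_eqF.
- move=> _; change (Pr (setT `&` xi N @^-1` B) < +oo).
  by rewrite setTI (le_lt_trans (probability_le1 Pr mxB))// ltry.
Qed.

Lemma gauss_int1E i (F : tape -> \bar R) x :
  gauss_int [:: i] F x = \int[leb]_y ((rho y)%:E * F (upd x i y)).
Proof. by apply: eq_integral => y _; rewrite /gdens big_seq1 updE. Qed.

Let step N (F : tape -> \bar R) : mnn F ->
  \int[Pr]_w F (prefix N.+1 w) = \int[Pr]_w gauss_int [:: N] F (prefix N w).
Proof.
move=> mF.
pose pr (w : W) : tape * MR := (prefix N w, xi N w).
have mpr : measurable_fun setT pr.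
  apply/measurable_fun_pair; first exact: measurable_prefix.
  exact: (@measurable_funPT _ _ _ _ (xi N)).
pose mu := distribution Pr (prefix N : {mfun W >-> tape}).
pose G (p : tape * MR) := F (upd p.1 N p.2).
have mG : measurable_fun setT G.
  have mu' : measurable_fun setT (fun p : tape * MR => upd p.1 N p.2 : tape).
    by apply: measurable_upd; [exact: measurable_fst|exact: measurable_snd].
  exact: (measurableT_comp mF.1 mu').
have G0 p : 0 <= G p by exact: mF.2.
transitivity (\int[Pr]_w G (pr w)).
  apply: eq_integral => w _; congr F; apply/funext => j.
  rewrite /upd /prefix /= ltnS leq_eqVlt; by case: eqP => [->|].
rewrite -(integral_image_measure Pr mpr mG G0).
rewrite (eq_measure_integral (mu \x gam)); last first.
  move=> A mA _; apply/esym.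
  apply: (@product_measure_unique _ _ _ _ R mu gam (image_measure Pr mpr)) => //.
  move=> A1 B1 mA1 mB1; rewrite image_measureE.
  by rewrite -(indep N mA1 mB1).
rewrite fubini_tonelli1// -(integral_image_measure Pr (measurable_prefix N)); last 2 first.
- by case: (mnn_gauss_int [:: N] mF).
- by case: (mnn_gauss_int [:: N] mF).
apply: eq_integral => x _; rewrite gauss_int1E /fubini_F.
rewrite integral_normal_prob//; exact: (mnn_upd _ _ mF).
Qed.

Lemma integral_prefix N (F : tape -> \bar R) : mnn F ->
  \int[Pr]_w F (prefix N w) = gauss_int (iota 0 N) F (fun=> 0%R).
Proof.
elim: N F => [|N IH] F mF.
  rewrite /gauss_int /= /gdens big_nil mul1e.
  rewrite (_ : (fun w => _) = cst (F (fun=> 0%R))); last first.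
    by apply/funext => w; congr F; apply/funext.
  transitivity (F (fun=> 0%R) * Pr setT); first exact: integral_cst.
  by rewrite probability_setT mule1.
rewrite step// IH; last exact: mnn_gauss_int.
rewrite -gauss_int_cat//; first by rewrite -addn1 iotaD.
by move=> j; rewrite mem_iota add0n inE => /andP[_ jN]; rewrite ltn_eqF.
Qed.

Lemma integral_iid l (F : tape -> \bar R) x : uniq l -> mnn F ->
  (forall y y' : nat -> R, {in l, y =1 y'} -> F y = F y') ->
  \int[Pr]_w F (fun j => xi j w) = gauss_int l F x.
Proof.
move=> ul mF hF; pose N := (\sum_(j <- l) j).+1.
have lN j : j \in l -> (j < N)%N by move=> jl; rewrite ltnS (big_rem j)//= leq_addr.
transitivity (\int[Pr]_w F (prefix N w)).
  by apply: eq_integral => w _; apply: hF => j jl; rewrite /prefix lN.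
rewrite integral_prefix//.
(* The coordinates below [N] that [F] does not read integrate to 1. *)
pose r := [seq j <- iota 0 N | j \notin l].
have pl : perm_eq (iota 0 N) (l ++ r).
  apply: uniq_perm; first exact: iota_uniq.
    rewrite cat_uniq ul filter_uniq ?iota_uniq ?andbT//=.
    by apply/hasPn => j; rewrite mem_filter => /andP[].
  move=> j; rewrite mem_cat mem_filter mem_iota /= add0n.
  by case: (boolP (j \in l)) => //= /lN ->.
rewrite (gauss_int_perm pl)// gauss_int_cat//; last first.
  by move=> j jl; rewrite mem_filter jl.
transitivity (gauss_int l F (fun=> 0%R)).
  apply: gauss_int_eq => z _; apply: gauss_int_cst.
  - by rewrite filter_uniq// iota_uniq.
  - exact: mF.2.
  by move=> y zy; apply: hF => j jl; rewrite zy// mem_filter jl.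
apply: (@coords_int_dep _ l (mem l)) => [y y' yy'|j /= jl /negP//].
rewrite (hF y y')//; congr (_%:E * _); apply: eq_big_seq => j jl.
by rewrite yy'.
Qed.
End iid.
End law.

(** * Moments of the noise *)

Section lattice.
Variable R : realType.

(* Integer vectors with a redundant sign, as [(-1)^b k]. *)
Definition zval D (f : {ffun 'I_D -> bool * 'I_D.+2}) (i : 'I_D) : R :=
  (-1) ^+ (f i).1 * ((f i).2 : nat)%:R.

(** The bound 4 D is what rounding a vector of squared norm at most D may produce: coordinatewise
    (|u_i| + 1)^2 <= 2 u_i^2 + 2. *)
Definition zball D : {set {ffun 'I_D -> bool * 'I_D.+2}} :=
  [set f | \sum_i zval f i ^+ 2 <= (4 * D)%:R].

Lemma expR1_ge2 : 2 <= expR 1 :> R.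
Proof. by rewrite -[leLHS]/(1 + 1) expR_ge1Dx. Qed.

(** A Chernoff bound: each point of the ball contributes at least 1 to the sum of exp (4 D - |z|^2),
    which factors over the coordinates. One factor is at most 2 * 2 <= exp 2, where one 2 counts the
    signs and the other is a geometric series, by exp (- k^2) <= 2^(-k). *)
Lemma card_zball D : (#|zball D|%:R : R) <= expR (6 * D%:R).
Proof.
have zsq (f : {ffun 'I_D -> bool * 'I_D.+2}) i : zval f i ^+ 2 = ((f i).2 : nat)%:R ^+ 2.
  by rewrite /zval exprMn -exprM mulnC exprM sqrrN expr1n expr1n mul1r.
apply: (@le_trans _ _ (\sum_(f : {ffun 'I_D -> bool * 'I_D.+2})
    expR (4 * D%:R - \sum_i ((f i).2 : nat)%:R ^+ 2 : R))).
  rewrite -sum1_card natr_sum [leRHS](bigID (mem (zball D)))/=.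
  apply: ler_wpDr; first by apply: sumr_ge0 => f _; exact: expR_ge0.
  apply: ler_sum => f; rewrite inE => fz.
  rewrite (le_trans _ (expR_ge1Dx _))// lerDl subr_ge0 -natrM (le_trans _ fz)//.
  by apply: ler_sum => i _; rewrite zsq.
have -> : \sum_(f : {ffun 'I_D -> bool * 'I_D.+2})
    expR (4 * D%:R - \sum_i ((f i).2 : nat)%:R ^+ 2 : R) =
    expR (4 * D%:R) * \prod_(i < D) \sum_(q : bool * 'I_D.+2) expR (- (q.2 : nat)%:R ^+ 2 : R).
  rewrite bigA_distr_bigA mulr_sumr; apply: eq_bigr => f _.
  rewrite expRD; congr (_ * _); rewrite -sumrN.
  by rewrite expR_sum.
rewrite (_ : 6 * D%:R = 4 * D%:R + 2 * D%:R); last by rewrite -mulrDl; congr (_ * _); rewrite -natrD.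
rewrite expRD ler_pM2l ?expR_gt0// prodr_const card_ord -(mulrC D%:R) expRM_natl.
apply: lerXn2r; rewrite ?nnegrE ?expR_ge0 ?sumr_ge0//.
rewrite -(pair_bigA _ (fun (b : bool) (k : 'I_D.+2) => expR (- (k : nat)%:R ^+ 2)))/=.
rewrite sumr_const card_bool.
have geo n : \sum_(k < n) expR (- (k : nat)%:R ^+ 2) <= 2 - 2 * (2^-1) ^+ n :> R.
  elim: n => [|n IH]; first by rewrite big_ord0 expr0 mulr1 subrr.
  rewrite big_ord_recr/= (_ : (2^-1 : R) ^+ n.+1 = 2^-1 * 2^-1 ^+ n); last by rewrite exprS.
  have : expR (- n%:R ^+ 2) <= (2^-1 : R) ^+ n.
    rewrite expRN exprVn lef_pV2 ?posrE ?expR_gt0 ?exprn_gt0//.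
    rewrite (@le_trans _ _ (expR 1 ^+ n))//.
      by apply: lerXn2r; rewrite ?nnegrE ?expR_ge0// expR1_ge2.
    rewrite -expRM_natr mul1r ler_expR -natrX ler_nat.
    by case: n {IH} => // n; rewrite expnS leq_pmulr// expn_gt0.
  by move: IH; lra.
have : expR 2 = expR 1 * expR 1 :> R by rewrite -expRD.
have := geo D.+2; have : 0 <= (2^-1 : R) ^+ D.+2 by rewrite exprn_ge0.
have := expR1_ge2; rewrite mulr2n; nra.
Qed.

Lemma round_scalar (v p : R) (T : nat) : 0 <= v -> T%:R <= v -> v < T%:R + 1 ->
  v * p <= (T + (0 < v * p)%R)%:R * p.
Proof.
move=> v0 h2 h1; have T0 : 0 <= T%:R :> R by [].
have [vp|vp] := ltrP 0 (v * p); rewrite ?addn0 ?addn1 -?natr1.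
  have vn0 : 0 < v by rewrite lt_def v0 andbT; apply: contraTneq vp => ->; rewrite mul0r ltxx.
  by move: vp; rewrite pmulr_rgt0// => p0; rewrite ler_pM2r// ltW.
have [p0|p0] := lerP p 0; first nra.
have v00 : v = 0 by apply/eqP; rewrite eq_le v0 andbT -(pmulr_lle0 _ p0).
by rewrite v00 mul0r mulr_ge0// ltW.
Qed.

(** Each |u_i| is rounded up or down, whichever favours the sign of the corresponding term. The
    linear form does not decrease, and the result lies in a finite set that does not depend on
    [c]. *)
Lemma round_dir D (u c : 'I_D -> R) : \sum_i u i ^+ 2 <= D%:R ->
  exists2 f, f \in zball D & \sum_i u i * c i <= \sum_i zval f i * c i.
Proof.
move=> u2.
have uD i : `|u i| <= D%:R.
  have ui : u i ^+ 2 <= D%:R by rewrite (le_trans _ u2)// (bigD1 i)//= lerDl sumr_ge0// => j _; exact: sqr_ge0.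
  have D0 : (0 < D)%N := leq_ltn_trans (leq0n i) (ltn_ord i).
  rewrite -(@ler_sqr _ `|u i|) ?nnegrE// real_normK ?num_real// (le_trans ui)//.
  by rewrite -natrX ler_nat expnS expn1 leq_pmulr.
pose k i := (Num.truncn `|u i| + (0 < u i * c i)%R)%N.
have t1 i : (Num.truncn `|u i|)%:R <= `|u i| by rewrite truncn_le.
have t2 i : `|u i| < (Num.truncn `|u i|).+1%:R by rewrite truncnS_gt.
have kle i : (k i)%:R <= `|u i| + 1.
  by rewrite /k natrD lerD//; case: (0 < _).
have kD i : (k i < D.+2)%N.
  by rewrite ltnS -(ler_nat R) (le_trans (kle i))// -natr1 lerD2r.
pose f : {ffun 'I_D -> bool * 'I_D.+2} := [ffun i => (u i < 0, Ordinal (kD i))].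
have zf i : zval f i = (-1) ^+ (u i < 0)%R * (k i)%:R by rewrite /zval ffunE.
have us i : u i = (-1) ^+ (u i < 0)%R * `|u i|.
    case: (ltrP (u i) 0) => ui; first by rewrite expr1 mulN1r ltr0_norm// opprK.
    by rewrite expr0 mul1r ger0_norm.
exists f.
  rewrite inE; apply: (@le_trans _ _ (\sum_i (2 * u i ^+ 2 + 2))).
    apply: ler_sum => i _; rewrite zf exprMn -exprM mulnC exprM sqrrN expr1n expr1n mul1r.
    rewrite -[u i ^+ 2]real_normK ?num_real//.
    have h3 : (k i)%:R ^+ 2 <= (`|u i| + 1) ^+ 2 by apply: lerXn2r; rewrite ?nnegrE ?addr_ge0.
    by have := sqr_ge0 (`|u i| - 1); nra.
  rewrite big_split/= -mulr_sumr sumr_const card_ord -mulr_natr natrM.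
  by move: u2; lra.
apply: ler_sum => i _; rewrite zf.
have uc : u i * c i = `|u i| * ((-1) ^+ (u i < 0)%R * c i) by rewrite {1}us; ring.
have E : (-1) ^+ (u i < 0)%R * (k i)%:R * c i = (k i)%:R * ((-1) ^+ (u i < 0)%R * c i) by ring.
rewrite uc E /k uc; apply: round_scalar => //.
by rewrite natr1 t2.
Qed.

(** Beyond the threshold [a] the exponential pays for the square, by x - a <= 2 exp ((x - a) / 2).
    If [a] is the logarithm of a bound on E[exp x], the last term has expectation at most 8. *)
Lemma sqr_le_exp (a x : R) : 0 <= a -> 0 <= x -> x ^+ 2 <= 2 * a ^+ 2 + 8 * expR (x - a).
Proof.
move=> a0 x0; have e0 := expR_ge0 (x - a).
have [xa|ax] := lerP x a; first nra.
have h1 : x ^+ 2 <= 2 * a ^+ 2 + 2 * (x - a) ^+ 2 by have := sqr_ge0 (x - 2 * a); nra.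
have E2 : expR (x - a) = expR ((x - a) / 2) ^+ 2.
  by rewrite expr2 -expRD; congr expR; field.
have := expR_ge1Dx ((x - a) / 2); rewrite E2; set E := expR _ => h.
have h2 : x - a <= 2 * E by lra.
have h3 : (x - a) ^+ 2 <= (2 * E) ^+ 2.
  by apply: lerXn2r => //; rewrite nnegrE; [rewrite subr_ge0 ltW|lra].
by nra.
Qed.
End lattice.

Section moments.
Variable R : realType.
Local Open Scope ereal_scope.
Notation leb := (@lebesgue_measure R).
Notation tape := (tape R).
Notation rho := (@normal_pdf R 0 1).
Notation peak := (@normal_peak R 1).

Lemma normal_mgf (c : R) : \int[leb]_y (rho y * expR (c * y))%:E = (expR (c ^+ 2 / 2))%:E.
Proof.
transitivity (\int[leb]_y ((expR (c ^+ 2 / 2))%:E * (rho (y - c))%:E)).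
  apply: eq_integral => y _; rewrite -EFinM; congr EFin; rewrite !rhoE.
  rewrite -mulrA -expRD mulrCA -expRD; congr (_ * expR _)%R; by field.
rewrite lebesgue_integralZl ?expR_ge0//.
- rewrite (integral_shift (- c) (f := fun y => (rho y)%:E)).
  + by rewrite integral_normal_pdf mule1.
  + by apply/measurable_EFinP; exact: measurable_rho.
  + by move=> y; rewrite lee_fin normal_pdf_ge0.
- apply/measurable_EFinP; apply: (measurableT_comp (@measurable_rho R)).
  by apply: measurable_funB.
- by move=> y; rewrite lee_fin normal_pdf_ge0.
Qed.

Lemma normal_mgf_sqr (s : R) : (0 <= s)%R ->
  \int[leb]_y (rho y * expR (- s * y ^+ 2))%:E = ((Num.sqrt (1 + 2 * s))^-1)%:E.
Proof.
move=> s0; have p0 : (0 < 1 + 2 * s)%R by rewrite ltr_pwDl// mulr_ge0.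
have q0 : (0 < Num.sqrt (1 + 2 * s))%R by rewrite sqrtr_gt0.
have mf : measurable_fun setT (fun y => (rho y)%:E).
  by apply/measurable_EFinP; exact: measurable_rho.
have f0 y : 0 <= (rho y)%:E by rewrite lee_fin normal_pdf_ge0.
have := integral_scale q0 mf f0.
rewrite integral_normal_pdf => h.
transitivity (\int[leb]_y (rho (Num.sqrt (1 + 2 * s) * y))%:E).
  apply: eq_integral => y _; congr EFin; rewrite !rhoE -mulrA -expRD; congr (_ * expR _)%R.
  by rewrite exprMn sqr_sqrtr ?ltW//; field.
set I := \int[leb]_y _ in h *.
rewrite -[LHS]mul1e -[X in X%:E * _](mulVf (lt0r_neq0 q0)) EFinM -muleA h mule1 //.
Qed.

Lemma measurable_nonneg : measurable_fun setT (fun s : R => (0 <= s)%R%:R : R).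
Proof.
rewrite (_ : (fun s => _) = \1_(`[0%R, +oo[%classic : set R)).
  by apply: measurable_indic; exact: measurable_itv.
apply/funext => s; rewrite indicE; congr (nat_of_bool _)%:R.
by apply/idP/idP; rewrite inE/= in_itv/= andbT.
Qed.

(** An inequality because of q = 0, where the inverse is 0 by convention while the integral
    diverges. *)
Lemma inv_le_int_exp (q : R) : (0 <= q)%R ->
  (q^-1)%:E <= \int[leb]_s (((0 <= s)%R%:R * expR (- s * q))%:E).
Proof.
move=> q0; have [->|qn0] := eqVneq q 0%R.
  by rewrite invr0; apply: integral_ge0 => s _; rewrite lee_fin mulr_ge0 ?expR_ge0.
have qp : (0 < q)%R by rewrite lt_def qn0.
have := integral_exponential_pdf qp.
have -> : \int[leb]_x (exponential_pdf q x)%:E = q%:E * \int[leb]_s (((0 <= s)%R%:R * expR (- s * q))%:E).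
  rewrite -lebesgue_integralZl ?ltW//.
  - apply: eq_integral => s _; rewrite -EFinM; congr EFin.
    rewrite /exponential_pdf patchE; case: ifPn => [|].
      by rewrite inE/= in_itv/= andbT => ->; rewrite mul1r; congr (_ * expR _)%R; ring.
    by rewrite notin_setE/= in_itv/= andbT => /negP/negbTE ->; rewrite mul0r mulr0.
  - apply/measurable_EFinP; apply: measurable_funM; last first.
      by apply: (measurableT_comp (@measurable_expR R)); apply: measurable_funM => //; exact: measurableT_comp.
    exact: measurable_nonneg.
by move=> h; rewrite -[leLHS]mule1 -h muleA -EFinM mulVf// mul1e.
Qed.

Lemma is_derive_inv_affineX (n : nat) (s : R) : (0 <= s)%R ->
  is_derive s 1%R (fun s : R => (1 + 2 * s)^-1 ^+ n)%R
    (- 2 * n%:R * (1 + 2 * s)^-1 ^+ n.+1)%R.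
Proof.
move=> s0; have p0 : (1 + 2 * s != 0)%R by rewrite gt_eqF// ltr_pwDl// mulr_ge0.
have d1 : is_derive s 1%R (fun s : R => 1 + 2 * s)%R 2%R.
  by apply: is_derive_eq; rewrite /GRing.scale/=; ring.
have dX := is_deriveX n (is_deriveV (f := (fun s : R => 1 + 2 * s)%R) p0 d1).
rewrite (_ : (fun s : R => (1 + 2 * s)^-1 ^+ n)%R = ((fun s : R => (1 + 2 * s)^-1) ^+ n)%R); last first.
  by apply/funext => y; rewrite exprfctE.
apply: is_derive_eq dX _; rewrite /GRing.scale/=.
case: n => [|n]; first by rewrite !(mul0r, mulr0).
by rewrite !exprS /= !expr0; field.
Qed.

Lemma integral_inv_affineX (r : nat) :
  \int[leb]_s (((0 <= s)%R%:R * (1 + 2 * s)^-1 ^+ r.+2)%:E) = ((2 * r.+1%:R)^-1)%:E.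
Proof.
pose c : R := ((2 * r.+1%:R)^-1)%R.
have c0 : (0 < c)%R by rewrite invr_gt0 mulr_gt0.
pose g (s : R) := ((1 + 2 * s)^-1)%R.
pose F (s : R) := (- c * g s ^+ r.+1)%R.
pose f (s : R) := (g s ^+ r.+2)%R.
transitivity (\int[leb]_(s in `[0%R, +oo[) (f s)%:E).
  rewrite [RHS]integral_mkcond; apply: eq_integral => s _; rewrite patchE.
  case: ifPn => [|].
    by rewrite inE/= in_itv/= andbT => ->; rewrite mul1r.
  by rewrite notin_setE/= in_itv/= andbT => /negP/negbTE ->; rewrite mul0r.
have dF (s : R) : (0 <= s)%R -> is_derive s 1%R F (f s).
  move=> s0; have dX := is_deriveZ (- c)%R (is_derive_inv_affineX r.+1 s0).
  apply: is_derive_eq dX _; rewrite /GRing.scale/= /f /c /g.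
  by field; rewrite gt_eqF ?ltr_pwDl ?mulr_ge0//= addrC natr1 pnatr_eq0.
have df (s : R) : (0 <= s)%R -> {for s, continuous f}.
  by move=> /(is_derive_inv_affineX r.+2) [h _]; exact/differentiable_continuous/derivable1_diffP.
rewrite (@ge0_continuous_FTC2y _ f F 0%R 0%R).
- by rewrite /F /g mulr0 addr0 invr1 expr1n mulr1 -EFinB sub0r opprK.
- by move=> s s0; rewrite /f exprn_ge0// invr_ge0 addr_ge0// mulr_ge0.
- by apply: continuous_in_subspaceT => s; rewrite inE/= in_itv/= andbT; exact: df.
- apply/cvgrPdist_lt => e e0; near=> s.
  have s0 : (0 < s)%R by near: s; exact: nbhs_pinfty_gt.
  have se : (e^-1 < s)%R by near: s; apply: nbhs_pinfty_gt; rewrite num_real.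
  have g0 : (0 < g s)%R by rewrite invr_gt0 addr_gt0// mulr_gt0.
  have g1 : (g s <= 1)%R by rewrite invf_le1 ?lerDl ?addr_gt0 ?mulr_gt0// mulr_ge0// ltW.
  have ge : (g s < e)%R.
    by rewrite invf_plt ?posrE ?addr_gt0 ?mulr_gt0//; lra.
  have c1 : (c <= 1)%R.
    rewrite invf_le1 ?mulr_gt0// -natrM ler1n//.
  rewrite sub0r normrN normrM normrN (gtr0_norm c0) gtr0_norm ?exprn_gt0//.
  apply: le_lt_trans ge; rewrite exprS mulrCA ler_piMr ?(ltW g0)//.
  by rewrite mulr_ile1 ?exprn_ge0 ?exprn_ile1 ?(ltW c0) ?(ltW g0).
- by move=> s /ltW /dF [].
- apply: cvg_at_right_filter.
  have [h _] := dF 0%R (lexx _).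
  by apply/differentiable_continuous/derivable1_diffP.
- by move=> s; rewrite in_itv/= andbT => /ltW /dF h; rewrite derive1E derive_val.
Unshelve. all: by end_near. Qed.

(* E[1/|g|^2] = \int_0^\infty E[exp(-s |g|^2)] ds = \int_0^\infty (1 + 2 s)^(-r) ds. *)
Lemma gauss_int_inv_sqs (l : seq nat) (r : nat) (x : tape) : uniq l -> size l = (r.+2 * 2)%N ->
  gauss_int l (fun z : tape => ((sqs l z)^-1)%:E) x <= ((2 * r.+1%:R)^-1)%:E.
Proof.
move=> ul sl; pose s0 := (\sum_(j <- l) j).+1.
have s0l : s0 \notin l.
  (* The cell [s0] is fresh; it holds the variable s of the exponential integral, so that exchanging
     the integrals over s and g is an instance of [coords_intC]. *)
  apply/negP => sl0; suff : (s0 < s0)%N by rewrite ltnn.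
  by rewrite {2}/s0 ltnS (big_rem s0)//= leq_addr.
have agr (z : tape) y : sqs l (upd z s0 y) = sqs l z.
  by apply: eq_big_seq => j jl; rewrite /upd; case: eqP jl => // -> /idPn; rewrite s0l.
pose F (z : tape) := (((0 <= z s0)%R%:R * expR (- z s0 * sqs l z))%:E).
have mF : mnn F.
  split; last by move=> z; rewrite lee_fin mulr_ge0 ?expR_ge0.
  apply/measurable_EFinP; apply: measurable_funM.
    exact: (measurableT_comp measurable_nonneg (@measurable_coord R s0)).
  apply: (measurableT_comp (@measurable_expR R)); apply: measurable_funM.
    by apply: measurableT_comp => //; exact: measurable_coord.
  exact: measurable_sqs.
apply: (@le_trans _ _ (gauss_int l (coord_int s0 F) x)).
  apply: gauss_int_le.
  - split=> [|z]; last by rewrite lee_fin invr_ge0 sqs_ge0.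
    apply/measurable_EFinP; apply: measurable_funV_ge0; last by move=> z; exact: sqs_ge0.
    exact: measurable_sqs.
  - exact: mnn_coord_int.
  move=> z _; apply: le_trans (inv_le_int_exp (sqs_ge0 l z)) _.
  by rewrite le_eqVlt; apply/orP; left; apply/eqP; apply: eq_integral => y _; rewrite /F updE agr.
have -> : gauss_int l (coord_int s0 F) x = coord_int s0 (gauss_int l F) x.
  rewrite /gauss_int -[RHS]/(coords_int [:: s0] _ x) coords_intC//; last exact: mnn_gdens.
  apply: coords_int_eq => z _ /=.
  rewrite -[LHS](coords_intZl (l := [:: s0]) (k := fun z => (gdens l z)%:E))//.
  - by rewrite lee_fin gdens_ge0.
  - by move=> y zy; congr EFin; apply: eq_big_seq => j jl; rewrite zy// inE; apply: contraNneq s0l => <-.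
rewrite -[leRHS]integral_inv_affineX le_eqVlt; apply/orP; left; apply/eqP.
apply: eq_integral => s _; set z := upd _ _ _.
have zs : z s0 = s by rewrite /z updE.
have Fz y : agree_off l z y -> F y = ((0 <= s)%R%:R * expR (- s * sqs l y))%:E.
  by move=> zy; rewrite /F zy// zs.
have [s_ge0|s_lt0] := lerP 0%R s; last first.
  rewrite mul0r (gauss_int_eq (G := fun=> 0)); last first.
    by move=> y /Fz ->; rewrite leNgt s_lt0 mul0r.
  by rewrite (gauss_int_cst (F := fun=> 0)).
rewrite mul1r (gauss_int_eq (G := fun y => (\prod_(j <- l) expR (- s * y j ^+ 2))%:E)); last first.
  by move=> y /Fz ->; rewrite s_ge0 mul1r /sqs mulr_sumr expR_sum.
rewrite (@gauss_int_prod _ l (fun _ y => expR (- s * y ^+ 2)) (fun=> (Num.sqrt (1 + 2 * s))^-1)%R)//.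
(* The even number of coordinates turns the square roots into integer powers. *)
- rewrite big_const_seq count_predT iter_mulr_1 sl mulnC exprM.
  rewrite (exprVn (Num.sqrt _) 2) sqr_sqrtr//.
  by rewrite addr_ge0// mulr_ge0.
- move=> j; apply: (measurableT_comp (@measurable_expR R)); apply: measurable_funM; first exact: measurable_cst.
  by apply: measurable_funX; exact: measurable_id.
- by move=> j _; exact: normal_mgf_sqr.
Qed.
End moments.

(** * Expected squared operator norm of a Gaussian matrix *)

Section opnorm.
Variable R : realType.
Local Open Scope ereal_scope.
Notation leb := (@lebesgue_measure R).
Notation tape := (tape R).

Lemma coords_intD l (F G : tape -> \bar R) x : mnn F -> mnn G ->
  coords_int l (fun z => F z + G z) x = coords_int l F x + coords_int l G x.
Proof.
move=> mF mG; elim: l x => [//|i l IH] x /=.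
rewrite /coord_int -ge0_integralD//.
- by apply: eq_integral => y _; exact: IH.
- by move=> y _; exact: (mnn_coords_int l mF).2.
- by apply: mnn_upd; exact: mnn_coords_int.
- by move=> y _; exact: (mnn_coords_int l mG).2.
- by apply: mnn_upd; exact: mnn_coords_int.
Qed.

Lemma gauss_intD l (F G : tape -> \bar R) x : mnn F -> mnn G ->
  gauss_int l (fun z => F z + G z) x = gauss_int l F x + gauss_int l G x.
Proof.
move=> mF mG; rewrite /gauss_int -coords_intD; try exact: mnn_gdens.
by apply: coords_int_eq => z _; rewrite ge0_muleDr ?mF.2 ?mG.2.
Qed.

Lemma gauss_intZl_cst l (k : R) (F : tape -> \bar R) x : mnn F -> (0 <= k)%R ->
  gauss_int l (fun z => k%:E * F z) x = k%:E * gauss_int l F x.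
Proof. by move=> mF k0; rewrite (@gauss_intZl _ l (fun=> k%:E)). Qed.

Lemma mnn_EFin (F : tape -> R) : measurable_fun setT F -> (forall z, 0 <= F z)%R ->
  mnn (fun z => (F z)%:E).
Proof. by move=> mF F0; split=> [|z]; [apply/measurable_EFinP|rewrite lee_fin]. Qed.

Lemma measurable_sum_cond (I : Type) (r : seq I) (P : pred I) (F : I -> tape -> R) :
  (forall i, measurable_fun setT (F i)) ->
  measurable_fun setT (fun z => (\sum_(i <- r | P i) F i z)%R).
Proof.
move=> mF; have -> : (fun z => \sum_(i <- r | P i) F i z)%R =
    (fun z => \sum_(i <- r) (if P i then F i z else 0))%R.
  by apply/funext => z; rewrite big_mkcond.
by apply: measurable_sum => i; case: (P i).
Qed.

Lemma gauss_int_sum_le l (I : Type) (r : seq I) (P : pred I) (F : I -> tape -> R) (b : R) x :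
  uniq l -> (forall i, measurable_fun setT (F i)) -> (forall i z, 0 <= F i z)%R ->
  (forall i, P i -> gauss_int l (fun z => (F i z)%:E) x <= b%:E) ->
  gauss_int l (fun z => (\sum_(i <- r | P i) F i z)%:E) x <=
    (\sum_(i <- r | P i) b)%:E.
Proof.
move=> ul mF F0 hb.
have ms s : mnn (fun z => (\sum_(i <- s | P i) F i z)%:E).
  apply: mnn_EFin => [|z]; last by apply: sumr_ge0 => i _.
  exact: measurable_sum_cond.
elim: r => [|i r IH].
  rewrite big_nil (gauss_int_eq (G := fun=> 0)); last by move=> z _; rewrite big_nil.
  by rewrite (gauss_int_cst (F := fun=> 0)).
rewrite big_cons; case: ifPn => Pi; last first.
  by rewrite (gauss_int_eq (G := fun z => (\sum_(i <- r | P i) F i z)%:E))// => z _; rewrite big_cons (negbTE Pi).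
rewrite (gauss_int_eq (G := fun z => (F i z)%:E + (\sum_(i <- r | P i) F i z)%:E)); last first.
  by move=> z _; rewrite big_cons Pi EFinD.
rewrite gauss_intD ?EFinD//; last exact: mnn_EFin.
by apply: leeD => //; exact: hb.
Qed.

Section bound.
Variable d : nat.
Hypothesis d_gt0 : (0 < d)%N.
Let n := (d + d)%N.
Let s : R := (Num.sqrt n%:R)^-1.
(** With n = 2 d this is 6 d + 6 n + 8 d: the bounds on the logarithms of the sizes of the two
    lattice balls and of the moment generating function. *)
Let al : R := (26 * d%:R)%R.

Let n_gt0 : (0 < n%:R :> R)%R. Proof. by rewrite ltr0n addn_gt0 d_gt0. Qed.
Let dR : (0 < d%:R :> R)%R. Proof. by rewrite ltr0n. Qed.

(** The sum dominates the exponential of the maximum over lattice points, and its expectation is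
    explicit. *)
Definition expsum (G : 'M[R]_(d, n)) : R :=
  (\sum_(f in zball R d) \sum_(g in zball R n)
    expR (s * \sum_i \sum_a zval R f i * zval R g a * G i a))%R.

(** The right-hand side of [sqr_le_exp] at the threshold [al], for x = sqrt d |G|_op, divided by d
    and with exp x replaced by [expsum]. *)
Definition opbound (G : 'M[R]_(d, n)) : R :=
  (d%:R^-1 * (2 * al ^+ 2) + d%:R^-1 * (8 * expR (- al)) * expsum G)%R.

Lemma expsum_ge0 G : (0 <= expsum G)%R.
Proof. by apply: sumr_ge0 => f _; apply: sumr_ge0 => g _; exact: expR_ge0. Qed.

Lemma opbound_ge0 G : (0 <= opbound G)%R.
Proof.
have := expsum_ge0 G; have := expR_ge0 (- al); have := sqr_ge0 al => h1 h2 h3.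
by rewrite addr_ge0 ?mulr_ge0 ?invr_ge0 ?ler0n.
Qed.

(* Rounding the extremal vectors of the bilinear form to integer vectors in the
   direction of increase bounds the operator norm by a maximum over a finite set. *)
Lemma opboundP (G : 'M[R]_(d, n)) (v : 'I_d -> R) :
  (\sum_a (\sum_i v i * G i a) ^+ 2 <= opbound G * \sum_i v i ^+ 2)%R.
Proof.
set V := (\sum_i v i ^+ 2)%R; set Gv := (\sum_a _)%R.
have V0 : (0 <= V)%R by apply: sumr_ge0 => i _; exact: sqr_ge0.
have Gv0 : (0 <= Gv)%R by apply: sumr_ge0 => i _; exact: sqr_ge0.
have [->|Gvn0] := eqVneq Gv 0%R; first by rewrite mulr_ge0// opbound_ge0.
have [Ve0|Vn0] := eqVneq V 0%R.
  move: Gvn0; rewrite /Gv big1 ?eqxx// => a _; rewrite big1 ?expr0n// => i _.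
  move: Ve0 => /psumr_eq0P h; have /eqP := h (fun j _ => sqr_ge0 (v j)) i isT.
  by rewrite sqrf_eq0 => /eqP ->; rewrite mul0r.
have Vp : (0 < V)%R by rewrite lt_def Vn0.
have Gp : (0 < Gv)%R by rewrite lt_def Gvn0.
pose w a := (\sum_i v i * G i a)%R.
(* These factors give v and G^T v the squared norms d and n that [round_dir] allows. *)
pose cu := Num.sqrt (d%:R / V); pose cw := Num.sqrt (n%:R / Gv).
have u2 : (\sum_i (cu * v i) ^+ 2 <= d%:R)%R.
  under eq_bigr do rewrite exprMn; rewrite -mulr_sumr sqr_sqrtr ?divr_ge0 ?ler0n//.
  by rewrite divfK.
have w2 : (\sum_a (cw * w a) ^+ 2 <= n%:R)%R.
  under eq_bigr do rewrite exprMn; rewrite -mulr_sumr sqr_sqrtr ?divr_ge0 ?ler0n//.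
  by rewrite divfK.
have [f fz fle] := round_dir (fun i => \sum_a G i a * (cw * w a))%R u2.
have [g gz gle] := round_dir (fun a => \sum_i zval R f i * G i a)%R w2.
set B := (\sum_i \sum_a zval R f i * zval R g a * G i a)%R.
have le1 : (cu * cw * Gv <= B)%R.
  have -> : (cu * cw * Gv = \sum_i cu * v i * (\sum_a G i a * (cw * w a)))%R.
    under [RHS]eq_bigr do rewrite mulr_sumr; rewrite exchange_big/= mulr_sumr.
    apply: eq_bigr => a _; rewrite -/(w a) {1}expr2 {1}/w !mulr_suml mulr_sumr.
    by apply: eq_bigr => i _; ring.
  apply: (le_trans fle).
  have -> : (\sum_i zval R f i * (\sum_a G i a * (cw * w a)) =
     \sum_a (cw * w a) * (\sum_i zval R f i * G i a))%R.
    under eq_bigr do rewrite mulr_sumr; rewrite exchange_big/=.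
    apply: eq_bigr => a _; rewrite [RHS]mulr_sumr.
    by apply: eq_bigr => i _; ring.
  apply: (le_trans gle); rewrite le_eqVlt; apply/orP; left; apply/eqP.
  under eq_bigr do rewrite mulr_sumr; rewrite exchange_big/=.
  by apply: eq_bigr => i _; apply: eq_bigr => a _; ring.
have s0 : (0 < s)%R by rewrite invr_gt0 sqrtr_gt0.
(* This is sqrt d times |G^T v| / |v|. *)
pose x := (s * (cu * cw * Gv))%R.
have x0 : (0 <= x)%R by rewrite !mulr_ge0 ?sqrtr_ge0// ltW.
have x2 : (x ^+ 2 = d%:R * Gv / V)%R.
  rewrite /x !exprMn exprVn !sqr_sqrtr ?divr_ge0 ?ler0n//.
  by field; rewrite Vn0 Gvn0 gt_eqF//=; apply/andP; split => //; rewrite gt_eqF.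
have xS : (expR x <= expsum G)%R.
  apply: (@le_trans _ _ (expR (s * B))); first by rewrite ler_expR ler_pM2l.
  rewrite /expsum (bigD1 f)//= (bigD1 g)//= -addrA lerDl addr_ge0 ?sumr_ge0// => *.
  by apply: sumr_ge0 => *; exact: expR_ge0.
have al0 : (0 <= al)%R by rewrite mulr_ge0 ?ler0n.
have := sqr_le_exp al0 x0; rewrite expRD x2 => h.
have E0 := expR_ge0 (- al).
have h2 : (d%:R * Gv / V <= 2 * al ^+ 2 + 8 * expR (- al) * expsum G)%R.
  apply: (le_trans h); rewrite lerD2l -mulrA ler_pM2l// mulrC.
  by rewrite ler_wpM2l.
rewrite -ler_pdivrMr// /opbound -mulrA -mulrDr ler_pdivlMl//.
by rewrite mulrA.
Qed.

Variable e : 'I_d -> 'I_n -> nat.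
Hypothesis e_inj : forall i a i' a', e i a = e i' a' -> i = i' /\ a = a'.
Notation lG := (gram_coords e).

Lemma measurable_expsum : measurable_fun setT (fun z : tape => expsum (gmx e z)).
Proof.
apply: measurable_sum_cond => f; apply: measurable_sum_cond => g.
apply: (measurableT_comp (@measurable_expR R)); apply: measurable_funM => //.
apply: measurable_sum => i; apply: measurable_sum => a; apply: measurable_funM => //.
exact: mx_meas_gmx.
Qed.

Lemma measurable_opbound : measurable_fun setT (fun z : tape => opbound (gmx e z)).
Proof.
apply: measurable_funD; first exact: measurable_cst.
by apply: measurable_funM => //; exact: measurable_expsum.
Qed.

Let gauss_int_bilinear (c : 'I_d -> 'I_n -> R) (x : tape) :
  gauss_int lG (fun z => (expR (\sum_i \sum_a c i a * gmx e z i a))%:E) x =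
  (expR ((\sum_i \sum_a c i a ^+ 2) / 2))%:E.
Proof.
pose k (j : nat) : R := if [pick q | e q.1 q.2 == j] is Some q then c q.1 q.2 else 0%R.
have kE i a : k (e i a) = c i a.
  rewrite /k; case: pickP => [[j b] /= /eqP/e_inj[-> ->]//|/(_ (i, a))].
  by rewrite eqxx.
rewrite (gauss_int_eq (G := fun z => (\prod_(j <- lG) expR (k j * z j))%:E)); last first.
  move=> z _; congr EFin; rewrite big_map big_enum/= pair_bigA/= expR_sum.
  by apply: eq_bigr => -[i a] _ /=; rewrite kE mxE.
rewrite (@gauss_int_prod _ lG (fun j y => expR (k j * y)) (fun j => expR (k j ^+ 2 / 2)))//.
- congr EFin; rewrite -expR_sum; congr expR.
  rewrite big_map big_enum/= pair_bigA/= mulr_suml.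
  by apply: eq_bigr => -[i a] _ /=; rewrite kE.
- exact: gram_coords_uniq.
- move=> j; apply: (measurableT_comp (@measurable_expR R)).
  by apply: measurable_funM; [exact: measurable_cst|exact: measurable_id].
- by move=> j _; exact: normal_mgf.
Qed.

Lemma gauss_int_expsum (x : tape) :
  gauss_int lG (fun z => (expsum (gmx e z))%:E) x <= (expR al)%:E.
Proof.
have mE f g : measurable_fun setT (fun z : tape =>
    expR (s * \sum_i \sum_a zval R f i * zval R g a * gmx e z i a)).
  apply: (measurableT_comp (@measurable_expR R)); apply: measurable_funM => //.
  apply: measurable_sum => i; apply: measurable_sum => a; apply: measurable_funM => //.
  exact: mx_meas_gmx.
(* The exponent s^2 |f|^2 |g|^2 / 2 is at most (4 d) (4 n) / (2 n) = 8 d. *)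
pose b : R := expR (8 * d%:R).
apply: (@le_trans _ _ (\sum_(f in zball R d) \sum_(g in zball R n) b)%:E).
  apply: gauss_int_sum_le; first exact: gram_coords_uniq.
  - by move=> f; apply: measurable_sum_cond => g.
  - by move=> f z; apply: sumr_ge0 => g _; exact: expR_ge0.
  move=> f fz; apply: gauss_int_sum_le => //; first exact: gram_coords_uniq.
  move=> g gz.
  rewrite (gauss_int_eq (G := fun z => (expR (\sum_i \sum_a (s * zval R f i * zval R g a) * gmx e z i a))%:E)); last first.
    move=> z _; congr (expR _)%:E; rewrite mulr_sumr; apply: eq_bigr => i _.
    by rewrite mulr_sumr; apply: eq_bigr => a _; ring.
  rewrite gauss_int_bilinear lee_fin ler_expR.
  have -> : (\sum_i \sum_a (s * zval R f i * zval R g a) ^+ 2 =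
     n%:R^-1 * ((\sum_i zval R f i ^+ 2) * (\sum_a zval R g a ^+ 2)))%R.
    rewrite mulr_suml mulr_sumr; apply: eq_bigr => i _.
    rewrite !mulr_sumr; apply: eq_bigr => a _.
    have s2 : (s ^+ 2 = n%:R^-1)%R by rewrite /s exprVn sqr_sqrtr// ler0n.
    by rewrite -s2; ring.
  move: fz gz; rewrite !inE => fz gz.
  have : ((\sum_i zval R f i ^+ 2) * (\sum_a zval R g a ^+ 2) <= (4 * d)%:R * (4 * n)%:R)%R.
    apply: ler_pM => //; apply: sumr_ge0 => *; exact: sqr_ge0.
  rewrite -(ler_pM2l (x := n%:R^-1)) ?invr_gt0// => h.
  rewrite ler_pdivrMr//; apply: (le_trans h); rewrite le_eqVlt; apply/orP; left; apply/eqP.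
  by rewrite !natrM; field; rewrite gt_eqF.
rewrite !sumr_const lee_fin -mulrnA -[leLHS]mulr_natl natrM.
have -> : al = (6 * n%:R + 6 * d%:R + 8 * d%:R)%R by rewrite /n natrD /al; ring.
rewrite !expRD; apply: ler_pM => //; rewrite ?mulr_ge0 ?ler0n ?expR_ge0//.
by apply: ler_pM => //; exact: card_zball.
Qed.

Lemma gauss_int_opbound (x : tape) :
  gauss_int lG (fun z => (opbound (gmx e z))%:E) x <= (1360 * d%:R)%:E.
Proof.
have k1 : (0 <= d%:R^-1 * (2 * al ^+ 2))%R by rewrite !mulr_ge0 ?invr_ge0 ?ler0n ?sqr_ge0.
have k2 : (0 <= d%:R^-1 * (8 * expR (- al)))%R by rewrite !mulr_ge0 ?invr_ge0 ?ler0n ?expR_ge0.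
have mS : mnn (fun z : tape => (expsum (gmx e z))%:E).
  by apply: mnn_EFin => [|z]; [exact: measurable_expsum|exact: expsum_ge0].
rewrite (gauss_int_eq (G := fun z => (d%:R^-1 * (2 * al ^+ 2))%:E * 1 +
  (d%:R^-1 * (8 * expR (- al)))%:E * (expsum (gmx e z))%:E)); last first.
  by move=> z _; rewrite mule1 -EFinM -EFinD.
rewrite gauss_intD; last 2 first.
- by split=> [|z]; [exact: measurable_cst|rewrite mule1 lee_fin].
- split=> [|z]; last by rewrite mule_ge0 ?lee_fin// expsum_ge0.
  by apply: emeasurable_funM; [exact: measurable_cst|case: mS].
rewrite !gauss_intZl_cst// ?gauss_int1 ?mule1//; last exact: gram_coords_uniq.
apply: (@le_trans _ _ ((d%:R^-1 * (2 * al ^+ 2))%:E + (d%:R^-1 * (8 * expR (- al)))%:E * (expR al)%:E)).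
  by apply: leeD => //; apply: lee_wpmul2l; [rewrite lee_fin|exact: gauss_int_expsum].
rewrite -EFinM -EFinD lee_fin -!mulrA -expRD addNr expR0 mulr1 -mulrDr ler_pdivrMl//.
(* 2 * 26^2 + 8 = 1360. *)
rewrite /al; have : (1 <= d%:R :> R)%R by rewrite ler1n.
nra.
Qed.
End bound.
End opnorm.

(** * Total correctness of programs *)

Section hoare.
Variables (R : realType) (dg : diag_routine R) (xi : nat -> R).
Notation state := (state R).
Notation exec := (exec dg xi).
Notation step := (instr_step dg xi).
Notation cell := (@Defs.mem R).

(** Determinism makes the choice in [output] pick the result of whichever run is exhibited. *)
Lemma exec_fun c s s1 t1 : exec c s s1 t1 -> forall s2 t2, exec c s s2 t2 ->
  s1 = s2 /\ t1 = t2.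
Proof.
elim=> {c s s1 t1}.
- by move=> s s2 t2 E; inversion E.
- by move=> o s s2 t2 E; inversion E.
- move=> c1 c2 s1 s2 s3 t1 t2 _ IH1 _ IH2 s4 t4 E.
  inversion E as [| |c1' c2' s1' s2' s3' u1 u2 E1 E2| |]; subst.
  by have [e1 <-] := IH1 _ _ E1; rewrite -e1 in E2; have [<- <-] := IH2 _ _ E2.
- move=> b c1 c2 s s' t _ IH s2 t2 E.
  by inversion E as [| | |b' c1' c2' u u' v E1|]; subst; have [<- <-] := IH _ _ E1.
- move=> b c s s' t _ IH s2 t2 E.
  by inversion E as [| | | |b' c' u u' v E1]; subst; have [<- <-] := IH _ _ E1.
Qed.

Definition runs (c : prog) (s : state) (Q : state -> Prop) (T : nat) : Prop :=
  exists s' t, [/\ exec c s s' t, (t <= T)%N & Q s'].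

Lemma runs_le c s (P Q : state -> Prop) T T' :
  runs c s P T -> (T <= T')%N -> (forall s', P s' -> Q s') -> runs c s Q T'.
Proof.
move=> [s' [t [E tT Ps]]] TT' PQ; exists s', t; split=> //; [exact: leq_trans TT'|exact: PQ].
Qed.

Lemma runs_do o s (Q : state -> Prop) : Q (step o s) -> runs (Do o) s Q (instr_cost o s).
Proof. by move=> q; exists (step o s), (instr_cost o s); split=> //; constructor. Qed.

Lemma runs_skip s (Q : state -> Prop) : Q s -> runs Skip s Q 0.
Proof. by move=> q; exists s, 0%N; split=> //; constructor. Qed.

Lemma runs_seq c1 c2 s Q T1 T2 : runs c1 s (fun s1 => runs c2 s1 Q T2) T1 ->
  runs (Seq c1 c2) s Q (T1 + T2).
Proof.
move=> [s1 [t1 [E1 le1 [s2 [t2 [E2 le2 q]]]]]]; exists s2, (t1 + t2)%N.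
by split=> //; [exact: exec_seq E2|exact: leq_add].
Qed.

Lemma runs_do_seq o c s Q T :
  runs c (step o s) Q T -> runs (Seq (Do o) c) s Q (instr_cost o s + T).
Proof. by move=> h; apply: runs_seq; exact: runs_do. Qed.

Lemma runs_if b c1 c2 s Q T :
  (test_val b s -> runs c1 s Q T) -> (~~ test_val b s -> runs c2 s Q T) ->
  runs (If b c1 c2) s Q T.+1.
Proof.
move=> h1 h2; suff [s' [t [E le q]]] : runs (if test_val b s then c1 else c2) s Q T.
  by exists s', t.+1; split=> //; exact: exec_if.
by case: ifPn => h; [exact: h1|exact: h2].
Qed.

(* The counter i runs from 1 to the value of register b; register 2 holds 1. *)
Definition For (i b : nat) (c : prog) : prog :=
  Seq (Do (NConst i 1)) (While (NLe i b) (Seq c (Do (NAdd i i 2)))).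

Definition setr (s : state) (i v : nat) : state :=
  State (upd (reg s) i v) (cell s) (draws s).

(** After j rounds [I j] holds and the counter is j + 1; the invariant must survive any change of
    the counter. A round costs one test and one increment besides its body; the initialization and
    the last test give the final 2. *)
Lemma runs_for i b c n T (I : nat -> state -> Prop) (Q : state -> Prop) s :
  i != b -> i != 2%N ->
  (forall j s v, I j s -> I j (setr s i v)) ->
  (forall j s, I j s -> reg s b = n /\ reg s 2 = 1%N) ->
  I 0%N s ->
  (forall j s, (j < n)%N -> reg s i = j.+1 -> I j s ->
     runs c s (fun s' => reg s' i = j.+1 /\ I j.+1 s') T) ->
  (forall s, I n s -> Q s) ->
  runs (For i b c) s Q (n * (T + 2) + 2)%N.
Proof.
move=> ib i2 Iset Ireg I0 body IQ.
have h m j s1 : (j + m = n)%N -> reg s1 i = j.+1 -> I j s1 ->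
    runs (While (NLe i b) (Seq c (Do (NAdd i i 2)))) s1 Q (m * (T + 2) + 1)%N.
  elim: m j s1 => [|m IH] j s1 jm ri Ij.
    exists s1, 1%N; split=> //; last by apply: IQ; move: jm; rewrite addn0 => <-.
    apply/exec_while/exec_if; rewrite /= ri (Ireg _ _ Ij).1 -jm addn0 ltnn.
    exact: exec_skip.
  have jn : (j < n)%N by rewrite -jm -addn1 leq_add2l.
  have [s2 [t2 [E2 le2 [ri2 Ij2]]]] := body j s1 jn ri Ij.
  have [] := IH j.+1 (setr s2 i j.+2).
  - by rewrite addSnnS.
  - by rewrite /= /upd eqxx.
  - exact: Iset.
  move=> s3 [t3 [E3 le3 q3]]; exists s3, ((t2 + 1) + t3).+1; split=> //.
    apply/exec_while/exec_if; rewrite /= ri (Ireg _ _ Ij).1 jn.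
    apply: exec_seq E3; apply: (exec_seq E2).
    have -> : setr s2 i j.+2 = step (NAdd i i 2) s2.
      by rewrite /= ri2 (Ireg _ _ Ij2).2 addn1.
    exact: exec_do.
  by rewrite mulSn; lia.
apply: (@runs_le _ _ Q Q (1 + (n * (T + 2) + 1))%N) => //; last by lia.
apply: runs_do_seq; apply: (h n 0%N) => //; first by rewrite /= /upd eqxx.
exact: Iset.
Qed.

Lemma output_runs (p : prog) d k A gamma eps delta Q T :
  runs p (init_state k A gamma eps delta) Q T ->
  exists s, Q s /\ output dg p k A gamma eps delta xi = load_mx d d 0 (cell s).
Proof.
move=> [s [t [E le q]]]; exists s; split=> //.
apply: xget_unique; first by exists s, t.
by move=> _ [s' [t' [E' ->]]]; have [-> _] := exec_fun E E'.
Qed.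
End hoare.

(** * The program *)

Section gram.
Variables (R : realType) (dg : diag_routine R) (xi : nat -> R).
Notation state := (state R).
Notation cell := (@Defs.mem R).

(** Register discipline for nested loops: an inner loop writes only to registers above the level of
    the loop around it, apart from the running addresses that the two share. *)
Definition keep (n : nat) (s s' : state) : Prop :=
  (forall r, (r < n)%N -> reg s' r = reg s r) /\ draws s' = draws s.

Lemma keep_trans n s s' s'' : keep n s s' -> keep n s' s'' -> keep n s s''.
Proof.
by move=> [h1 d1] [h2 d2]; split=> [r rn|]; [rewrite h2// h1|rewrite d2 d1].
Qed.

Lemma keepW m n s s' : keep n s s' -> (m <= n)%N -> keep m s s'.
Proof. by move=> [h1 d1] mn; split=> // r rm; apply: h1; exact: leq_trans mn. Qed.

Lemma keep_setr n s s' i v : keep n s s' -> (n <= i)%N -> keep n s (setr s' i v).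
Proof.
move=> [h1 d1] ni; split=> // r rn /=; rewrite /upd ltn_eqF ?h1//.
exact: leq_trans ni.
Qed.

(** An entry of P diag(w) Q^*, from a row of P at [p] and a row of Q at [q]. *)
Definition dsum (M : nat -> R[i]) (w sw p q n : nat) : R[i] :=
  \sum_(c < n) M (w + c * sw)%N * (M (p + c)%N * conjc (M (q + c)%N)).

Definition row_prog : prog :=
  Seq (Do (CConj 4 31)) (Seq (Do (CMul 4 32 4)) (Seq (Do (CMul 4 33 4))
  (Seq (Do (CAdd 30 30 4)) (Seq (Do (NAdd 31 31 2)) (Seq (Do (NAdd 32 32 2))
  (Do (NAdd 33 33 23))))))).

Definition mid_prog : prog :=
  Seq (Do (NAdd 32 27 3)) (Seq (Do (NAdd 33 22 3))
  (Seq (For 34 26 row_prog) (Do (NAdd 30 30 2)))).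

(* Adds to the a x a matrix at o the product of the a x n matrix at x, the diagonal
   matrix of the weights at w, and the conjugate transpose of the a x n matrix at y;
   consecutive weights are sw cells apart.  Registers 20, ..., 26 hold
   x, y, w, sw, o, a and n, register 4 the address of a scratch cell. *)
Definition gram_prog : prog :=
  Seq (Do (NAdd 27 20 3)) (Seq (Do (NAdd 30 24 3))
  (For 28 25 (Seq (Do (NAdd 31 21 3))
    (Seq (For 29 25 mid_prog) (Do (NAdd 27 32 3)))))).

Lemma runs_row s n sw p q w o tmp :
  reg s 2 = 1%N -> reg s 4 = tmp -> reg s 23 = sw -> reg s 26 = n ->
  reg s 30 = o -> reg s 31 = q -> reg s 32 = p -> reg s 33 = w -> o != tmp ->
  (forall c, (c < n)%N -> forall b, b \in [:: p + c; q + c; w + c * sw]%N ->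
     b != tmp /\ b != o) ->
  runs dg xi (For 34 26 row_prog) s (fun s' =>
    [/\ keep 31 s s', reg s' 31 = (q + n)%N, reg s' 32 = (p + n)%N &
        forall b, b != tmp -> cell s' b =
          if b == o then cell s b + dsum (cell s) w sw p q n else cell s b])
    (n * 9 + 2).
Proof.
move=> r2 r4 r23 r26 r30 r31 r32 r33 ot hd.
pose I c s' := [/\ keep 31 s s', reg s' 31 = (q + c)%N, reg s' 32 = (p + c)%N,
  reg s' 33 = (w + c * sw)%N & forall b, b != tmp -> cell s' b =
    if b == o then cell s b + dsum (cell s) w sw p q c else cell s b].
apply: (@runs_for _ dg xi 34 26 row_prog n 7 I) => //.
- move=> j s' v [k e1 e2 e3 e4]; split=> //; exact: keep_setr.
- by move=> j s' [[k _] _ _ _ _]; rewrite !k.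
- split; rewrite ?addn0 ?mul0n ?addn0//.
  by move=> b _; rewrite /dsum big_ord0 addr0; case: eqP.
- move=> j s' jn r34 [k e1 e2 e3 e4].
  have [d1 d2] := hd j jn (p + j)%N (mem_head _ _).
  have [d3 d4] : (q + j)%N != tmp /\ (q + j)%N != o by apply: (hd j jn); rewrite !inE eqxx orbT.
  have [d5 d6] : (w + j * sw)%N != tmp /\ (w + j * sw)%N != o by apply: (hd j jn); rewrite !inE eqxx !orbT.
  do 6 apply: runs_do_seq; apply: (@runs_do _ dg xi); split; first exact: r34.
  have k2 : reg s' 2 = 1%N by rewrite k.1.
  have k4 : reg s' 4 = tmp by rewrite k.1.
  have k23 : reg s' 23 = sw by rewrite k.1.
  have k30 : reg s' 30 = o by rewrite k.1.
  split.
  + split=> [r r31'|]; last by rewrite /= k.2.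
    by rewrite /= /upd; do 3 rewrite [r == _]ltn_eqF ?(leq_trans r31')//; rewrite k.1.
  + by rewrite /= /upd /= e1 k2 addn1 addnS.
  + by rewrite /= /upd /= e2 k2 addn1 addnS.
  + by rewrite /= /upd /= e3 k23 mulSn addnAC addnA.
  move=> b bt; rewrite /= /upd /= k4 k30 e1 e2 e3 (negbTE bt) !eqxx.
  rewrite (negbTE d1) (negbTE d5) (negbTE ot).
  rewrite !e4// eqxx (negbTE d2) (negbTE d4) (negbTE d6).
  by case: eqP => // ->; rewrite /dsum big_ord_recr/= addrA.
- by move=> s' [].
Qed.

Lemma runs_mid s a n sw px y w o tmp :
  reg s 2 = 1%N -> reg s 3 = 0%N -> reg s 4 = tmp -> reg s 22 = w -> reg s 23 = sw ->
  reg s 25 = a -> reg s 26 = n ->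
  reg s 27 = px -> reg s 30 = o -> reg s 31 = y -> (0 < a)%N ->
  ~~ (o <= tmp < o + a)%N ->
  (forall c, (c < n)%N -> (px + c)%N != tmp /\ ~~ (o <= px + c < o + a)%N) ->
  (forall c, (c < a * n)%N -> (y + c)%N != tmp /\ ~~ (o <= y + c < o + a)%N) ->
  (forall c, (c < n)%N -> (w + c * sw)%N != tmp /\ ~~ (o <= w + c * sw < o + a)%N) ->
  runs dg xi (For 29 25 mid_prog) s (fun s' =>
    [/\ keep 29 s s', reg s' 30 = (o + a)%N, reg s' 32 = (px + n)%N &
        forall b, b != tmp -> cell s' b =
          if (o <= b < o + a)%N then cell s b + dsum (cell s) w sw px (y + (b - o) * n) n
          else cell s b])
    (a * (n * 9 + 7) + 2).
Proof.
move=> r2 r3 r4 r22 r23 r25 r26 r27 r30 r31 a0 ht hx hy hw.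
(* Register 32 reaches the end of the row only in a round of the loop; since a > 0, the outer loop
   can take its next row address from it. *)
pose I j s' := [/\ keep 29 s s', reg s' 30 = (o + j)%N, reg s' 31 = (y + j * n)%N,
  (0 < j)%N -> reg s' 32 = (px + n)%N & forall b, b != tmp -> cell s' b =
          if (o <= b < o + j)%N then cell s b + dsum (cell s) w sw px (y + (b - o) * n) n
          else cell s b].
apply: (@runs_le _ dg xi _ _ (I a) _ (a * (n * 9 + 5 + 2) + 2)) => //; last first.
- by move=> s' [k e1 e2 e3 e4]; split=> //; exact: e3.
- by rewrite -addnA.
apply: (@runs_for _ dg xi 29 25 mid_prog a _ I) => //.
- move=> j s' v [k e1 e2 e3 e4]; split=> //; exact: keep_setr.
- by move=> j s' [[k _] _ _ _ _]; rewrite !k.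
- split; rewrite ?mul0n ?addn0//.
  by move=> b _; case: ifP => //; lia.
move=> j s' ja r29 [k e1 e2 e3 e4].
have -> : (n * 9 + 5 = 1 + (1 + ((n * 9 + 2) + 1)))%N by lia.
do 2 apply: runs_do_seq; set s1 := (X in runs _ _ _ X).
apply: runs_seq.
have k1 : keep 29 s s1.
  apply: (keep_trans k); split=> // r r29'; rewrite /= /upd.
  by do 2 rewrite [r == _]ltn_eqF ?(leq_trans r29')//.
have q1 r : (r < 29)%N -> reg s1 r = reg s r by move=> rn; exact: k1.1.
have jn c : (c < n)%N -> (j * n + c < a * n)%N.
  move=> cn; apply: (@leq_trans (j.+1 * n)); first by rewrite mulSn addnC ltn_add2r.
  by rewrite leq_mul2r ja orbT.
have := @runs_row s1 n sw px (y + j * n)%N w (o + j)%N tmp.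
rewrite (q1 2%N)// (q1 4%N)// (q1 23%N)// (q1 26%N)// => /(_ r2 r4 r23 r26) h.
apply: runs_le (h _ _ _ _ _ _) _ _ => {h}.
- by rewrite /= /upd /=.
- by rewrite /= /upd /=.
- by rewrite /= /upd /= !k.1// r27 r3 addn0.
- by rewrite /= /upd /= !k.1// r22 r3 addn0.
- by apply: contraNneq ht => <-; lia.
- move=> c cn; have [a1 a2] := hx c cn; have [b1 b2] := hw c cn.
  have := hy _ (jn c cn); rewrite addnA => -[c1 c2] b.
  by rewrite !inE => /or3P[]/eqP ->; split=> //; lia.
- by [].
move=> s2 [k2 f1 f2 f3]; apply: (@runs_do _ dg xi).
split.
  rewrite /= /upd /=; rewrite k2.1// /s1 /= /upd /=; exact: r29.
have k12 : keep 29 s s2 by apply: (keep_trans k1); exact: keepW k2 _.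
split.
- split=> [r rn|]; last by rewrite /= k12.2.
  by rewrite /= /upd [r == _]ltn_eqF ?(leq_trans rn)// k12.1.
- by rewrite /= /upd /= !k2.1// /s1 /= /upd /= e1 k.1// r2 addn1 addnS.
- by rewrite /= /upd /= f1 mulSn; lia.
- by rewrite /= /upd /= f2.
move=> b bt; rewrite /= f3// {1 3}/s1 /=.
have ds : dsum (cell s1) w sw px (y + j * n) n = dsum (cell s) w sw px (y + j * n) n.
  apply: eq_bigr => -[c cn] _ /=; rewrite /s1 /=.
  have [a1 a2] := hx c cn; have [b1 b2] := hw c cn.
  have := hy _ (jn c cn); rewrite addnA => -[c1 c2].
  by rewrite !e4// !ifF//; lia.
rewrite ds; have [->|bo] := eqVneq b (o + j)%N.
  rewrite e4//; last by rewrite -?bo//; apply: contraNneq ht => <-; lia.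
  by rewrite ifF ?ifT ?addKn//; lia.
by rewrite e4//; congr (if _ then _ else _); lia.
Qed.

Definition gram_cost (a n : nat) : nat := (2 + (a * (a * (n * 9 + 7) + 6) + 2))%N.

Lemma runs_gram s a n sw x y w o tmp :
  reg s 2 = 1%N -> reg s 3 = 0%N -> reg s 4 = tmp -> reg s 20 = x -> reg s 21 = y ->
  reg s 22 = w -> reg s 23 = sw -> reg s 24 = o -> reg s 25 = a -> reg s 26 = n ->
  (0 < a)%N ->
  ~~ (o <= tmp < o + a * a)%N ->
  (forall c, (c < a * n)%N -> (x + c)%N != tmp /\ ~~ (o <= x + c < o + a * a)%N) ->
  (forall c, (c < a * n)%N -> (y + c)%N != tmp /\ ~~ (o <= y + c < o + a * a)%N) ->
  (forall c, (c < n)%N -> (w + c * sw)%N != tmp /\ ~~ (o <= w + c * sw < o + a * a)%N) ->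
  runs dg xi gram_prog s (fun s' =>
    [/\ keep 27 s s',
        forall i j, (i < a)%N -> (j < a)%N -> cell s' (o + i * a + j) =
          cell s (o + i * a + j) + dsum (cell s) w sw (x + i * n) (y + j * n) n &
        forall b, b != tmp -> ~~ (o <= b < o + a * a)%N -> cell s' b = cell s b])
    (gram_cost a n).
Proof.
move=> r2 r3 r4 r20 r21 r22 r23 r24 r25 r26 a0 ht hx hy hw.
(* Offset b in a matrix with rows of length a belongs to the entry (b / a, b mod a). *)
pose v b := dsum (cell s) w sw (x + (b %/ a) * n) (y + (b %% a) * n) n.
pose I i s' := [/\ keep 27 s s', reg s' 27 = (x + i * n)%N, reg s' 30 = (o + i * a)%N &
  forall b, b != tmp -> cell s' b =
    if (o <= b < o + i * a)%N then cell s b + v (b - o)%N else cell s b].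
apply: (@runs_le _ dg xi _ _ (I a) _ (1 + (1 + (a * ((1 + ((a * (n * 9 + 7) + 2) + 1)) + 2) + 2)))%N) => //; last 2 first.
- by rewrite /gram_cost; lia.
- move=> s' [k _ _ e]; split=> //.
    move=> i j ia ja.
    have ij : (i * a + j < a * a)%N.
      by apply: (@leq_trans (i.+1 * a)); [rewrite mulSn; lia|rewrite leq_mul2r ia orbT].
    rewrite e; last by apply: contraNneq ht => <-; lia.
    rewrite ifT; last by lia.
    by rewrite -addnA addKn /v divnMDl// divn_small// addn0 modnMDl modn_small.
  by move=> b bt hb; rewrite e// (negbTE hb).
do 2 apply: runs_do_seq; set s0 := (X in runs _ _ _ X).
have k0 : keep 27 s s0.
  split=> // r rn; rewrite /= /upd.
  by do 2 rewrite [r == _]ltn_eqF ?(leq_trans rn)//.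
apply: (@runs_for _ dg xi 28 25 _ a _ I) => //.
- move=> j s' u [k e1 e2 e3]; split=> //; exact: keep_setr.
- by move=> j s' [[k _] _ _ _]; rewrite !k.
- split; rewrite ?mul0n ?addn0//.
  + by rewrite /= /upd /= r20 r3 addn0.
  + by rewrite /= /upd /= r24 r3 addn0.
  + by move=> b _; case: ifP => //; lia.
move=> i s' ia r28 [k e1 e2 e3].
apply: runs_do_seq; set s1 := (X in runs _ _ _ X).
apply: runs_seq.
have k1 : keep 27 s s1.
  apply: (keep_trans k); split=> // r rn; rewrite /= /upd.
  by rewrite [r == _]ltn_eqF ?(leq_trans rn)//.
have q1 r : (r < 27)%N -> reg s1 r = reg s r by move=> rn; exact: k1.1.
have ian : (i * n + n <= a * n)%N by rewrite addnC -mulSn leq_mul2r ia orbT.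
have iaa : (i * a + a <= a * a)%N by rewrite addnC -mulSn leq_mul2r ia orbT.
have := @runs_mid s1 a n sw (x + i * n)%N y w (o + i * a)%N tmp.
rewrite (q1 2%N)// (q1 3%N)// (q1 4%N)// (q1 22%N)// (q1 23%N)// (q1 25%N)// (q1 26%N)//.
move=> /(_ r2 r3 r4 r22 r23 r25 r26) h.
apply: runs_le (h _ _ _ _ _ _ _ _) _ _ => {h} //.
- by rewrite /= /upd /= !k.1// r21 r3 addn0.
- by apply: contraNN ht; lia.
- by move=> c cn; have := hx (i * n + c)%N; rewrite addnA => -[|h1 h2]; [lia|split=> //; apply: contraNN h2; lia].
- by move=> c cn; have [h1 h2] := hy c cn; split=> //; apply: contraNN h2; lia.
- by move=> c cn; have [h1 h2] := hw c cn; split=> //; apply: contraNN h2; lia.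
move=> s2 [k2 f1 f2 f3]; apply: (@runs_do _ dg xi).
split; first by rewrite /= /upd /= k2.1// /s1 /= /upd /=.
have k12 : keep 27 s s2 by apply: (keep_trans k1); exact: keepW k2 _.
split.
- split=> [r rn|]; last by rewrite /= k12.2.
  by rewrite /= /upd [r == _]ltn_eqF ?(leq_trans rn)// k12.1.
- by rewrite /= /upd /= f2 k12.1// r3 mulSn; lia.
- by rewrite /= /upd /= f1 mulSn; lia.
move=> b bt; rewrite /= f3// {1 3}/s1 /=.
have ds j : (j < a)%N -> dsum (cell s1) w sw (x + i * n) (y + j * n) n =
    dsum (cell s) w sw (x + i * n) (y + j * n) n.
  move=> ja; apply: eq_bigr => -[c cn] _ /=; rewrite /s1 /=.
  have jan : (j * n + n <= a * n)%N by rewrite addnC -mulSn leq_mul2r ja orbT.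
  have [|a1 a2] := hx (i * n + c)%N; first by lia.
  have [|b1 b2] := hy (j * n + c)%N; first by lia.
  have [c1 c2] := hw c cn; rewrite !addnA in a1 a2 b1 b2.
  by rewrite !e3// !ifF//; apply/negbTE; [apply: contraNN b2|apply: contraNN a2|apply: contraNN c2]; lia.
case: ifPn => hb.
  rewrite ds; last by lia.
  rewrite e3// ifF ?ifT; [|by lia|by lia].
  congr (_ + _); rewrite /v.
  have -> : (b - o = i * a + (b - (o + i * a)))%N by lia.
  have bl : (b - (o + i * a) < a)%N by lia.
  by rewrite divnMDl// divn_small// addn0 modnMDl modn_small.
rewrite e3//; congr (if _ then _ else _); rewrite mulSn; lia.
Qed.
End gram.

(** * Loops for real parts, clearing and the selection of eigenvalues *)

Section loops.
Variables (R : realType) (dg : diag_routine R) (xi : nat -> R).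
Notation state := (state R).
Notation cell := (@Defs.mem R).
Notation step := (instr_step dg xi).

Lemma store_mx_at m n a (M : 'M[R[i]]_(m, n)) f (i : 'I_m) (j : 'I_n) :
  store_mx a M f (a + i * n + j)%N = M i j.
Proof.
rewrite /store_mx; case: pickP => [[i' j'] /= /eqP e|/(_ (i, j))]; last by rewrite /= eqxx.
have n0 : (0 < n)%N by apply: leq_ltn_trans (ltn_ord j).
have {}e : (i * n + j = i' * n + j')%N by lia.
have /ord_inj -> : (i : nat) = i'.
  by have := congr1 (divn^~ n) e; rewrite !divnMDl// !divn_small// !addn0.
by have /ord_inj -> // : (j : nat) = j'; have := congr1 (modn^~ n) e; rewrite !modnMDl !modn_small.
Qed.

Lemma store_mx_out m n a (M : 'M[R[i]]_(m, n)) f b :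
  ~~ (a <= b < a + m * n)%N -> store_mx a M f b = f b.
Proof.
rewrite /store_mx => hb; case: pickP => [[i j] /= /eqP e|//].
case/negP: hb; rewrite e; have ji := ltn_ord j.
have : (i.+1 * n <= m * n)%N by rewrite leq_mul2r ltn_ord orbT.
by rewrite mulSn; lia.
Qed.

Definition straight (o : instr) : bool :=
  match o with Sphere _ _ | Diag _ _ _ _ => false | _ => true end.

Definition block (l : seq instr) (c : prog) : prog :=
  foldr (fun o c => Seq (Do o) c) c l.

Lemma runs_block l c s Q T : all straight l ->
  runs dg xi c (foldl (fun s o => step o s) s l) Q T -> runs dg xi (block l c) s Q (size l + T).
Proof.
elim: l s => [//|o l IH] s /= /andP[so sl] h; rewrite -add1n -addnA.
have -> : 1%N = instr_cost o s by clear h; case: o so.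
by apply: runs_do_seq; exact: IH.
Qed.

(** Adding the conjugate gives twice the real part; the factor 2 cancels in the noise, like the
    normalization of the sphere vector. *)
Definition real_prog : prog := For 31 14 (block [:: CConj 4 27; CAdd 27 27 4] (Do (NAdd 27 27 2))).

Lemma runs_real s n z tmp :
  reg s 2 = 1%N -> reg s 4 = tmp -> reg s 14 = n -> reg s 27 = z ->
  ~~ (z <= tmp < z + n)%N ->
  runs dg xi real_prog s (fun s' => keep 27 s s' /\
    forall b, b != tmp -> cell s' b =
      if (z <= b < z + n)%N then cell s b + conjc (cell s b) else cell s b)
    (n * 5 + 2).
Proof.
move=> r2 r4 r14 r27 ht.
pose I c s' := [/\ keep 27 s s', reg s' 27 = (z + c)%N & forall b, b != tmp -> cell s' b =
      if (z <= b < z + c)%N then cell s b + conjc (cell s b) else cell s b].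
apply: (@runs_for _ dg xi 31 14 _ n 3 I) => //.
- move=> j s' v [k e1 e2]; split=> //; exact: keep_setr.
- by move=> j s' [[k _] _ _]; rewrite !k.
- split; rewrite ?addn0//; first by move=> b _; case: ifP => //; lia.
- move=> j s' jn r31 [k e1 e2].
  apply: (@runs_block [:: _; _]) => //; apply: (@runs_do _ dg xi); split; first exact: r31.
  split.
  + split=> [r rn|]; last by rewrite /= k.2.
    by rewrite /= /upd [r == _]ltn_eqF ?(leq_trans rn)// k.1.
  + by rewrite /= /upd /= e1 k.1// r2 addn1 addnS.
  have zt : (z + j)%N != tmp by apply: contraNneq ht => <-; lia.
  have k4 : reg s' 4 = tmp by rewrite k.1.
  move=> b bt; rewrite /= /upd /= k4 e1 (negbTE bt) (negbTE zt) eqxx.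
  rewrite !e2//.
  have -> : (z <= z + j < z + j)%N = false by lia.
  have [->|bz] := eqVneq b (z + j)%N; first by rewrite ifT//; lia.
  by congr (if _ then _ else _); lia.
- by move=> s' [].
Qed.

Definition zero_prog : prog := For 31 6 (block [:: CNat 27 3] (Do (NAdd 27 27 2))).

Lemma runs_zero s n : reg s 2 = 1%N -> reg s 3 = 0%N -> reg s 6 = n -> reg s 27 = 0%N ->
  runs dg xi zero_prog s (fun s' => keep 27 s s' /\
    forall b, cell s' b = if (b < n)%N then 0 else cell s b) (n * 4 + 2).
Proof.
move=> r2 r3 r6 r27.
pose I c s' := [/\ keep 27 s s', reg s' 27 = c &
  forall b, cell s' b = if (b < c)%N then 0 else cell s b].
apply: (@runs_for _ dg xi 31 6 _ n 2 I) => //.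
- move=> j s' v [k e1 e2]; split=> //; exact: keep_setr.
- by move=> j s' [[k _] _ _]; rewrite !k.
- move=> j s' jn r31 [k e1 e2].
  apply: (@runs_block [:: _]) => //; apply: (@runs_do _ dg xi); split; first exact: r31.
  split.
  + split=> [r rn|]; last by rewrite /= k.2.
    by rewrite /= /upd [r == _]ltn_eqF ?(leq_trans rn)// k.1.
  + by rewrite /= /upd /= e1 k.1// r2 addn1.
  have k3 : reg s' 3 = 0%N by rewrite k.1.
  move=> b; rewrite /= /upd /= k3 e1 e2 ltnS (leq_eqVlt b j).
  by case: eqP.
- by move=> s' [].
Qed.

(** Decreasing order of the values with ties broken by the index, so that the number of such j is
    the rank of c, counted from 1. *)
Definition no_later (lam : nat -> R) (c j : nat) : bool :=
  (lam c <= lam j) && ((lam j <= lam c) ==> (j <= c)%N).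

Definition rank_prog : prog :=
  For 32 0 (Seq (If (CLe 27 30) (If (CLe 30 27) (If (NLe 32 31) (Do (NAdd 29 29 2)) Skip)
    (Do (NAdd 29 29 2))) Skip) (Do (NAdd 30 30 2))).

Lemma runs_rank s d l c : reg s 2 = 1%N -> reg s 0 = d -> reg s 27 = (l + c)%N ->
  reg s 30 = l -> reg s 29 = 0%N -> reg s 31 = c.+1 ->
  runs dg xi rank_prog s (fun s' => [/\ keep 29 s s', reg s' 31 = c.+1, cell s' = cell s &
    reg s' 29 = \sum_(j < d) no_later (fun j => complex.Re (cell s (l + j))) c j]%N) (d * 7 + 2).
Proof.
move=> r2 r0 r27 r30 r29 r31; pose lam j := complex.Re (cell s (l + j)%N).
pose I n s' := [/\ keep 29 s s', reg s' 31 = c.+1, reg s' 30 = (l + n)%N, cell s' = cell s &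
  reg s' 29 = \sum_(j < n) no_later lam c j]%N.
apply: (@runs_for _ dg xi 32 0 _ d 5 I) => //.
- move=> j s' v [k e1 e2 e3 e4]; split=> //; exact: keep_setr.
- by move=> j s' [[k _] _ _ _ _]; rewrite !k.
- by split; rewrite ?addn0// big_ord0.
- move=> j s' jn r32 [k e1 e2 e3 e4].
  have cle1 : test_val (CLe 27 30) s' = (lam c <= lam j).
    by rewrite /= e3 k.1// r27 e2.
  have cle2 : test_val (CLe 30 27) s' = (lam j <= lam c).
    by rewrite /= e3 e2 k.1// r27.
  have nle : test_val (NLe 32 31) s' = (j <= c)%N by rewrite /= r32 e1.
  apply: (@runs_seq _ dg xi _ _ _ _ 4 1).
  have fin s1 (b : bool) : (forall r, r != 29%N -> reg s1 r = reg s' r) ->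
      draws s1 = draws s' -> cell s1 = cell s' -> reg s1 29 = (reg s' 29 + b)%N ->
      b = no_later lam c j -> runs dg xi (Do (NAdd 30 30 2)) s1 (fun s2 => reg s2 32 = j.+1 /\ I j.+1 s2) 1.
    move=> h1 h2 h3 h4 h5; apply: (@runs_do _ dg xi); split; first by rewrite /= /upd /= h1.
    split.
    - split=> [r rn|]; last by rewrite /= h2 k.2.
      by rewrite /= /upd [r == _]ltn_eqF ?(leq_trans rn)// h1 ?k.1// ltn_eqF.
    - by rewrite /= /upd /= h1.
    - by rewrite /= /upd /= !h1// e2 k.1// r2 addn1 addnS.
    - by rewrite /= h3.
    - by rewrite /= /upd /= h4 e4 h5 big_ord_recr.
  have inc : runs dg xi (Do (NAdd 29 29 2)) s' (fun s1 => [/\ forall r, r != 29%N -> reg s1 r = reg s' r,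
     draws s1 = draws s', cell s1 = cell s' & reg s1 29 = (reg s' 29 + true)%N]) 1.
    apply: (@runs_do _ dg xi); split=> //; first by move=> r rn; rewrite /= /upd (negbTE rn).
    have k2 : reg s' 2 = 1%N by rewrite k.1.
    by rewrite /= /upd /= k2.
  apply: (@runs_if _ dg xi _ _ _ _ _ 3); rewrite cle1 => h1; last first.
    apply: (runs_le (runs_skip _ _ (Q := fun s1 => s1 = s') erefl)) => // _ ->.
    by apply: (@fin _ false) => //; rewrite ?addn0// /no_later (negbTE h1).
  apply: (@runs_if _ dg xi _ _ _ _ _ 2); rewrite cle2 => h2; last first.
    apply: (runs_le inc) => // s1 [f1 f2 f3 f4].
    by apply: (@fin _ true) => //; rewrite /no_later h1 (negbTE h2).
  apply: (@runs_if _ dg xi _ _ _ _ _ 1); rewrite nle => h3; last first.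
    apply: (runs_le (runs_skip _ _ (Q := fun s1 => s1 = s') erefl)) => // _ ->.
    by apply: (@fin _ false) => //; rewrite ?addn0// /no_later h1 h2 (negbTE h3).
  apply: (runs_le inc) => // s1 [f1 f2 f3 f4].
  by apply: (@fin _ true) => //; rewrite /no_later h1 h2 h3.
- by move=> s' [].
Qed.

Definition sel_prog : prog :=
  For 31 0 (block [:: NConst 29 0; NAdd 30 16 3] (Seq rank_prog
    (Seq (If (NLe 29 1) (Do (CNat 28 2)) (Do (CNat 28 3)))
      (block [:: NAdd 27 27 2] (Do (NAdd 28 28 2)))))).

Definition top_sel (lam : nat -> R) (d k c : nat) : bool :=
  (\sum_(j < d) no_later lam c j <= k)%N.

Lemma runs_sel s d k l f : reg s 2 = 1%N -> reg s 3 = 0%N -> reg s 0 = d -> reg s 1 = k ->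
  reg s 16 = l -> reg s 27 = l -> reg s 28 = f -> (l + d <= f)%N ->
  runs dg xi sel_prog s (fun s' => [/\ keep 27 s s',
    forall c, (c < d)%N ->
      cell s' (f + c) = (top_sel (fun j => complex.Re (cell s (l + j)%N)) d k c)%:R &
    forall b, ~~ (f <= b < f + d)%N -> cell s' b = cell s b])
    (d * (d * 7 + 10) + 2).
Proof.
move=> r2 r3 r0 r1 r16 r27 r28 scale_coords; pose lam j := complex.Re (cell s (l + j)%N).
pose I n s' := [/\ keep 27 s s', reg s' 27 = (l + n)%N, reg s' 28 = (f + n)%N &
  forall b, cell s' b = if (f <= b < f + n)%N then (top_sel lam d k (b - f))%:R else cell s b].
apply: (@runs_le _ dg xi _ _ (I d) _ (d * (2 + ((d * 7 + 2) + (2 + (1 + 1))) + 2) + 2)%N).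
- apply: (@runs_for _ dg xi 31 0 _ d _ I) => //.
  + move=> j s' v [ke e1 e2 e3]; split=> //; exact: keep_setr.
  + by move=> j s' [[ke _] _ _ _]; rewrite !ke.
  + by split; rewrite ?addn0// => b; case: ifP => //; lia.
  move=> c s' cd r31 [ke e1 e2 e3].
  apply: (@runs_block [:: _; _]) => //; rewrite [foldl _ _ _]/=; set s1 := State _ _ _.
  have k1 : keep 27 s s1.
    split=> [r rn|]; last by rewrite /= ke.2.
    by rewrite /= /upd; do 2 rewrite [r == _]ltn_eqF ?(leq_trans rn)//; rewrite ke.1.
  apply: (@runs_seq _ dg xi).
  have := @runs_rank s1 d l c; rewrite (k1.1 2%N)// (k1.1 0%N)// => /(_ r2 r0) h.
  apply: runs_le (h _ _ _ _) _ _ => {h} //.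
  + by rewrite /= /upd /= ke.1// r16 ke.1// r3 addn0.
  move=> s2 [k2 f1 f2 f3].
  have k12 : keep 27 s s2 by apply: (keep_trans k1); exact: keepW k2 _.
  have r28' : reg s2 28 = (f + c)%N by rewrite k2.1.
  have r27' : reg s2 27 = (l + c)%N by rewrite k2.1.
  have r29 : (reg s2 29 <= k)%N = top_sel lam d k c.
    rewrite f3 /top_sel; congr (_ <= _)%N; apply: eq_bigr => -[j jd] _.
    rewrite /no_later /s1 /= !e3.
    have out i : (i < d)%N -> ~~ (f <= l + i < f + c)%N by lia.
    by rewrite !(negbTE (out _ _))//.
  apply: (@runs_seq _ dg xi).
  have fin s3 : (forall r, reg s3 r = reg s2 r) -> draws s3 = draws s2 ->
      cell s3 = upd (cell s2) (f + c)%N (top_sel lam d k c)%:R ->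
      runs dg xi (block [:: NAdd 27 27 2] (Do (NAdd 28 28 2))) s3
        (fun s' => reg s' 31 = c.+1 /\ I c.+1 s') (1 + 1).
    move=> h1 h2 h3; apply: (@runs_block [:: _]) => //; apply: (@runs_do _ dg xi).
    split; first by rewrite /= /upd /= h1.
    split.
    + split=> [r rn|]; last by rewrite /= h2 k12.2.
      by rewrite /= /upd; do 2 rewrite [r == _]ltn_eqF ?(leq_trans rn)//; rewrite h1 k12.1.
    + by rewrite /= /upd /= !h1 r27' k12.1// r2 addn1 addnS.
    + by rewrite /= /upd /= !h1 r28' k12.1// r2 addn1 addnS.
    move=> b; rewrite /= h3 /upd f2 /s1 /= e3.
    have [->|bf] := eqVneq b (f + c)%N; first by rewrite addKn ifT//; lia.
    by congr (if _ then _ else _); lia.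
  have k1' : reg s2 1 = k by rewrite k12.1.
  have k2' : reg s2 2 = 1%N by rewrite k12.1.
  have k3' : reg s2 3 = 0%N by rewrite k12.1.
  apply: (@runs_if _ dg xi _ _ _ _ _ 1); rewrite /= k1' r29 => hs;
    apply: (@runs_do _ dg xi); apply: fin => //.
  + by rewrite /= r28' k2' hs.
  + by rewrite /= r28' k3' (negbTE hs).
- by rewrite leq_eqVlt; apply/orP; left; apply/eqP; congr (_ * _ + _)%N; lia.
- move=> s' [ke _ _ e]; split=> //.
    by move=> c cd; rewrite e addKn ifT//; lia.
  by move=> b hb; rewrite e (negbTE hb).
Qed.
End loops.

(** * The projection onto the top eigenvectors *)

Section topproj.
Variables (R : realType) (d : nat).

Definition uproj (U : 'M[R[i]]_d) (S : pred 'I_d) : 'M[R[i]]_d :=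
  \matrix_(i, j) \sum_c (S c)%:R * (U i c * conjc (U j c)).

Definition topk (lam : 'I_d -> R) (k : nat) (c : 'I_d) : bool :=
  (\sum_(j < d) ((lam c <= lam j)%R && ((lam j <= lam c)%R ==> (j <= c)%N)) <= k)%N.

Definition topproj (dg : diag_routine R) (k : nat) (H : 'M[R[i]]_d) : 'M[R[i]]_d :=
  uproj (dg d H).1 (topk (fun c => complex.Re ((dg d H).2 0 c)) k).
End topproj.

(** * The mechanism as a program *)

Section main_prog.

(* Memory layout after the input, which ends before B = 2 + d + d^2: the constant 1, a scratch
   cell, |g_1|^2, |g_2|^2, a further scalar, the 12 d^2 random numbers, the eigenvectors, the
   eigenvalues and the flags of the selected eigenvectors. *)
Definition setup : seq instr :=
  [:: NConst 2 1; NConst 3 0; NConst 4 0; NAdd 5 0 0; NMul 6 0 0; NAdd 7 6 6; NAdd 8 7 7;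
    NAdd 7 8 7; NConst 9 2; NAdd 9 9 0; NAdd 9 9 6; NAdd 4 9 2; NAdd 10 4 2;
    NAdd 11 10 2; NAdd 12 11 2; NAdd 13 12 2; NAdd 14 7 7; NAdd 15 13 14; NAdd 16 15 6;
    NAdd 17 16 0; NConst 18 2; NAdd 18 18 0; NAdd 19 13 7]%N.

(** The squared norm is a 1 x 1 Gram matrix; stride 0 makes the cell of the constant 1 the weight of
    every term. *)
Definition norm_prog (rz rc : nat) : prog :=
  block [:: NAdd 20 rz 6; NAdd 20 20 6; NAdd 21 20 3; NAdd 22 9 3; NConst 23 0;
    NAdd 24 rc 3; NConst 25 1; NAdd 26 8 3]%N gram_prog.

(** Stride 0 uses one scalar as the weight of every column, so a multiple of G G^T is added to the
    stored matrix. *)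
Definition add_prog (rz rc : nat) : prog :=
  block [:: NAdd 20 rz 3; NAdd 21 rz 3; NAdd 22 rc 3; NConst 23 0;
    NAdd 24 18 3; NAdd 25 0 3; NAdd 26 5 3]%N gram_prog.

Variables (R : realType) (dg : diag_routine R) (xi : nat -> R).
Notation state := (state R).
Notation cell := (@Defs.mem R).
Notation step := (instr_step dg xi).

Variables (d k : nat) (eps : R).
Hypothesis d_gt0 : (0 < d)%N.
Let dd := (d * d)%N.
Let m := (dd + dd + (dd + dd))%N.
Let M := (m + (dd + dd))%N.
Let B := (2 + d + dd)%N.
Let n := (d + d)%N.

Definition regs0 : seq nat :=
  [:: d; k; 1; 0; B + 1; n; dd; M; m; B; B + 1 + 1; B + 1 + 1 + 1; B + 1 + 1 + 1 + 1;
     B + 1 + 1 + 1 + 1 + 1; M + M;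
     B + 1 + 1 + 1 + 1 + 1 + (M + M);
     B + 1 + 1 + 1 + 1 + 1 + (M + M) + dd;
     B + 1 + 1 + 1 + 1 + 1 + (M + M) + dd + d; 2 + d;
     B + 1 + 1 + 1 + 1 + 1 + M]%N.

Let regs_ok (s : state) := forall r, (r < 20)%N -> reg s r = nth 0%N regs0 r.

Definition agree (s : state) (L : seq nat) : Prop :=
  forall r, (r < size L)%N -> reg s r = nth 0%N L r.

(* Unfolding the nested states of a long block would take exponential time. *)
Fixpoint absrun (p : seq instr) (L : seq nat) : option (seq nat) :=
  match p with
  | [::] => Some L
  | NConst x v :: p' =>
      if (x <= size L)%N then absrun p' (set_nth 0%N L x v) else None
  | NAdd x y z :: p' =>
      if [&& x <= size L, y < size L & z < size L]%N
      then absrun p' (set_nth 0%N L x (nth 0 L y + nth 0 L z)%N) else None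
  | NMul x y z :: p' =>
      if [&& x <= size L, y < size L & z < size L]%N
      then absrun p' (set_nth 0%N L x (nth 0 L y * nth 0 L z)%N) else None
  | _ => None
  end.

Lemma absrun_agree p s L L' : agree s L -> absrun p L = Some L' ->
  let s' := foldl (fun s o => step o s) s p in
  [/\ agree s' L', cell s' = cell s & draws s' = draws s].
Proof.
have h s1 L1 x v : agree s1 L1 -> (x <= size L1)%N -> agree (setr s1 x v) (set_nth 0%N L1 x v).
  move=> ag xL r; rewrite size_set_nth nth_set_nth /= /upd; case: eqP => // rx rL.
  by apply: ag; move: xL rL rx; rewrite /maxn; case: ifP; lia.
elim: p s L => [|o p IH] s L ag /=; first by case=> <-.
case: o => // [x v|x y z'|x y z'].
- by case: ifP => // xL /IH; apply; exact: h.
- case: ifP => // /and3P[xL yL zL] ar; apply: (IH _ _ _ ar).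
  by rewrite -!ag//; exact: h.
- case: ifP => // /and3P[xL yL zL] ar; apply: (IH _ _ _ ar).
  by rewrite -!ag//; exact: h.
Qed.

Lemma setup_regs (s : state) : agree s [:: d; k] ->
  let s' := foldl (fun s o => step o s) s setup in
  [/\ regs_ok s', cell s' = cell s & draws s' = draws s].
Proof. by move=> ag; apply: (@absrun_agree setup s [:: d; k] regs0 ag). Qed.

Let tmp := (B + 1)%N.
Let z := (B + 1 + 1 + 1 + 1 + 1)%N.
Let U := (z + (M + M))%N.
Let l := (U + dd)%N.
Let fl := (l + d)%N.

(* Twice the real parts of the coordinates of the sphere vector. *)
Definition rnd (j : nat) : R :=
  2 * (xi j.*2 / Num.sqrt (\sum_(i < (M + M).*2) xi i ^+ 2)).

Let zb (b : bool) := (b * M)%N.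

Definition sqnorm (b : bool) : R := \sum_(j < m) rnd (zb b + (dd + dd) + j) ^+ 2.

Definition gramof (b : bool) : 'M[R]_d :=
  \matrix_(i, j) \sum_(a < n) rnd (zb b + i * n + a) * rnd (zb b + j * n + a).

Definition scale : R := M%:R / eps.

Definition noisy (A : 'M[R[i]]_d) : 'M[R[i]]_d :=
  A + map_mx (real_complex R) ((scale / sqnorm false) *: gramof false)
    - map_mx (real_complex R) ((scale / sqnorm true) *: gramof true).

(** The invariant once the random numbers are drawn. [H] is the present content of the place of the
    input matrix; [c] gives two cells that hold 0 at first, then the squared norms, then the
    coefficients of the Gram matrices. *)
Let Phi (c : bool -> R) (H : 'M[R[i]]_d) (s : state) :=
  [/\ regs_ok s, cell s 0%N = eps%:C /\ cell s B = 1,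
    forall i j : 'I_d, cell s (2 + d + i * d + j)%N = H i j,
    forall j, (j < M + M)%N -> cell s (z + j)%N = (rnd j)%:C &
    forall b : bool, cell s (B + 1 + 1 + b)%N = (c b)%:C].

Lemma idx_lt (i j : 'I_d) : (i * d + j < dd)%N.
Proof.
have : (i.+1 * d <= d * d)%N by rewrite leq_mul2r ltn_ord orbT.
by rewrite mulSn /dd; have := ltn_ord j; lia.
Qed.

Lemma agree_keep s s' : regs_ok s -> keep 27 s s' -> regs_ok s'.
Proof. by move=> h [ke _] r rn; rewrite ke ?h// (leq_trans rn). Qed.

Lemma agree_R0 s L : agree s (regs0 ++ L) -> regs_ok s.
Proof.
by move=> ag r rn; rewrite ag ?nth_cat ?rn// size_cat ltn_addr.
Qed.

Lemma runs_norm (b : bool) c H s : Phi c H s -> c b = 0 ->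
  runs dg xi (norm_prog (if b then 19 else 13) (if b then 11 else 10)) s
    (Phi (fun b' => if b' == b then sqnorm b else c b') H) (8 + gram_cost 1 m)%N.
Proof.
move=> [h0 [h1 h1'] h2 h3 h4] cb.
apply: (@runs_block _ _ _ [:: _; _; _; _; _; _; _; _]); first by [].
set s1 := foldl _ _ _.
have [L [ag aL ce dr]] : exists L, [/\ agree s1 (regs0 ++ L),
    L = [:: z + zb b + dd + dd; z + zb b + dd + dd; B ; 0; B + 1 + 1 + b; 1; m]%N,
    cell s1 = cell s & draws s1 = draws s].
  rewrite /s1 /zb; exists [:: z + b * M + dd + dd; z + b * M + dd + dd; B ; 0; B + 1 + 1 + b; 1; m]%N.
  case: (b).
  - have [] := @absrun_agree [:: NAdd 20 19 6; NAdd 20 20 6; NAdd 21 20 3; NAdd 22 9 3; NConst 23 0;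
       NAdd 24 11 3; NConst 25 1; NAdd 26 8 3]%N s regs0 _ h0 erefl.
    by rewrite /= !addn0 => ag ce dr; split=> //; rewrite mul1n.
  - have [] := @absrun_agree [:: NAdd 20 13 6; NAdd 20 20 6; NAdd 21 20 3; NAdd 22 9 3; NConst 23 0;
       NAdd 24 10 3; NConst 25 1; NAdd 26 8 3]%N s regs0 _ h0 erefl.
    by rewrite /= !addn0 => ag ce dr; split=> //; rewrite mul0n addn0.
have zbM : (zb b + m + dd + dd <= M + M)%N by rewrite /zb /M; case: (b); lia.
have Bz : (B + 5 = z)%N by rewrite /z; lia.
have b1 : (b <= 1)%N by case: (b).
have tE : (tmp = B + 1)%N by [].
have BE : (2 + d + dd = B)%N by [].
have zE : (z = B + 5)%N by rewrite /z -!addnA.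
subst L; apply: (runs_le (T := gram_cost 1 m) (@runs_gram R dg xi s1 1 m 0
  (z + zb b + dd + dd)%N (z + zb b + dd + dd)%N B (B + 1 + 1 + b)%N tmp
  (ag 2%N isT) (ag 3%N isT) (ag 4%N isT) (ag 20%N isT) (ag 21%N isT) (ag 22%N isT)
  (ag 23%N isT) (ag 24%N isT) (ag 25%N isT) (ag 26%N isT) isT _ _ _ _)) => //.
- by lia.
- by move=> e ce'; split; lia.
- by move=> e ce'; split; lia.
- by move=> e ce'; split; lia.
move=> s2 [ke e1 e2]; split.
- apply: agree_keep ke; exact: agree_R0 ag.
- by split; rewrite e2 ?ce//; lia.
- move=> i j; have ij := idx_lt i j; rewrite e2 ?ce ?h2//; lia.
- move=> j jM; rewrite e2 ?ce ?h3//; lia.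
move=> b'; have [->|bb] := eqVneq b' b.
  have := e1 0%N 0%N isT isT; rewrite ce mul0n !addn0 => ->.
  rewrite h4 cb add0r /dsum /sqnorm rmorph_sum/=; apply: eq_bigr => -[j jm] _ /=.
  have -> : (z + zb b + dd + dd + j = z + (zb b + (dd + dd) + j))%N by lia.
  rewrite muln0 addn0 h1' mul1r h3; last by lia.
  by rewrite conjc_real -rmorphM.
rewrite e2 ?ce ?h4//.
  by rewrite -addnA addnA; case: (b') (b) bb => [] []; lia.
by case: (b') (b) bb => [] []; lia.
Qed.

Lemma runs_add (b : bool) c H s : Phi c H s ->
  runs dg xi (add_prog (if b then 19 else 13) (if b then 11 else 10)) s
    (Phi c (H + map_mx (real_complex R) (c b *: gramof b))) (7 + gram_cost d n)%N.
Proof.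
move=> [h0 [h1 h1'] h2 h3 h4].
apply: (@runs_block _ _ _ [:: _; _; _; _; _; _; _]); first by [].
set s1 := foldl _ _ _.
have [L [ag aL ce dr]] : exists L, [/\ agree s1 (regs0 ++ L),
    L = [:: z + zb b; z + zb b; B + 1 + 1 + b; 0; 2 + d; d; n]%N,
    cell s1 = cell s & draws s1 = draws s].
  rewrite /s1 /zb; exists [:: z + b * M; z + b * M; B + 1 + 1 + b; 0; 2 + d; d; n]%N.
  case: (b).
  - have [] := @absrun_agree [:: NAdd 20 19 3; NAdd 21 19 3; NAdd 22 11 3; NConst 23 0;
    NAdd 24 18 3; NAdd 25 0 3; NAdd 26 5 3]%N s regs0 _ h0 erefl.
    by rewrite /= !addn0 => ag ce dr; split=> //; rewrite mul1n.
  - have [] := @absrun_agree [:: NAdd 20 13 3; NAdd 21 13 3; NAdd 22 10 3; NConst 23 0;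
    NAdd 24 18 3; NAdd 25 0 3; NAdd 26 5 3]%N s regs0 _ h0 erefl.
    by rewrite /= !addn0 => ag ce dr; split=> //; rewrite mul0n addn0.
have zbM : (zb b + (dd + dd) <= M + M)%N by rewrite /zb /M; case: (b); lia.
have zE : (z = B + 5)%N by rewrite /z -!addnA.
have b1 : (b <= 1)%N by case: (b).
have tE : (tmp = B + 1)%N by [].
have BE : (2 + d + dd = B)%N by [].
have dn : (d * n = dd + dd)%N by rewrite /n mulnDr.
have ddE : (d * d = dd)%N by [].
subst L; apply: (runs_le (T := gram_cost d n) (@runs_gram R dg xi s1 d n 0
  (z + zb b)%N (z + zb b)%N (B + 1 + 1 + b)%N (2 + d)%N tmp
  (ag 2%N isT) (ag 3%N isT) (ag 4%N isT) (ag 20%N isT) (ag 21%N isT) (ag 22%N isT)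
  (ag 23%N isT) (ag 24%N isT) (ag 25%N isT) (ag 26%N isT) d_gt0 _ _ _ _)) => //.
- by lia.
- by move=> e ce'; split; lia.
- by move=> e ce'; split; lia.
- by move=> e ce'; split; lia.
move=> s2 [ke e1 e2]; split.
- apply: agree_keep ke; exact: agree_R0 ag.
- by split; rewrite e2 ?ce//; lia.
- move=> i j; rewrite e1// ce h2 !mxE; congr (_ + _).
  rewrite mulr_sumr rmorph_sum/=; apply: eq_bigr => -[e en] _ /=.
  have lt (q : 'I_d) : (zb b + q * n + e < M + M)%N.
    have : (q.+1 * n <= d * n)%N by rewrite leq_mul2r ltn_ord orbT.
    by rewrite mulSn dn; lia.
  have adr (q : 'I_d) : (z + zb b + q * n + e = z + (zb b + q * n + e))%N by lia.
  by rewrite muln0 addn0 h4 !adr !h3// conjc_real -!rmorphM.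
- move=> j jM; rewrite e2 ?ce ?h3//; lia.
- by move=> b'; rewrite e2 ?ce ?h4//; case: (b'); lia.
Qed.

(** Register 3 contains 0, the address of epsilon. The second coefficient is negated by subtraction
    from the cleared scratch cell, so that [add_prog] also serves to subtract X_2. *)
Definition coeff_prog (c : prog) : prog :=
  block [:: CNat 12 7; CDiv 12 12 3; CDiv 10 12 10; CDiv 11 12 11; CSub 4 4 4; CSub 11 4 11]%N c.

Lemma runs_coeff c H s Q T p : Phi c H s ->
  (forall s', Phi (fun b : bool => if b then - (scale / c true) else scale / c false) H s' ->
    runs dg xi p s' Q T) ->
  runs dg xi (coeff_prog p) s Q (6 + T)%N.
Proof.
move=> [h0 [h1 h1'] h2 h3 h4] hQ; apply: (@runs_block _ _ _ [:: _; _; _; _; _; _]) => //.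
apply: hQ; set s1 := foldl _ _ _.
have r7 : reg s 7 = M by rewrite h0. have r3 : reg s 3 = 0%N by rewrite h0.
have r4 : reg s 4 = tmp by rewrite h0.
have r10 : reg s 10 = (B + 1 + 1)%N by rewrite h0.
have r11 : reg s 11 = (B + 1 + 1 + 1)%N by rewrite h0.
have r12 : reg s 12 = (B + 1 + 1 + 1 + 1)%N by rewrite h0.
have tE : (tmp = B + 1)%N by [].
have BE : (2 + d + dd = B)%N by [].
have zE : (z = B + 5)%N by rewrite /z -!addnA.
have z0 x : (0%N == B + x.+1)%N = false by rewrite addnS.
have bE : (B + 1 + 1 = B + 2)%N * (B + 2 + 1 = B + 3)%N * (B + 3 + 1 = B + 4)%N by rewrite -!addnA.
have cE b : cell s1 b = if b == (B + 3)%N then - (M%:R / eps%:C / (c true)%:C)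
    else if b == (B + 1)%N then 0
    else if b == (B + 2)%N then M%:R / eps%:C / (c false)%:C
    else if b == (B + 4)%N then M%:R / eps%:C else cell s b.
  rewrite /s1 /= r7 r3 r4 r10 r11 r12 /upd /tmp !bE !eqn_add2l /= subrr sub0r h1.
  have := h4 true; rewrite /= !bE => ->; have := h4 false; rewrite /= !bE addn0 => ->.
  by case: (b =P (B + 3)%N) => // _; do 3 case: eqP => // _.
have MC : M%:R / eps%:C = (scale)%:C :> R[i].
  by rewrite /scale -(rmorph_nat (real_complex R)) -fmorph_div.
have sm b : b != (B + 1)%N -> b != (B + 2)%N -> b != (B + 3)%N -> b != (B + 4)%N ->
    cell s1 b = cell s b.
  by move=> e1 e2 e3 e4; rewrite cE (negbTE e1) (negbTE e2) (negbTE e3) (negbTE e4).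
have g1 : regs_ok s1 by move=> r rn; rewrite -h0.
clearbody s1; split=> //.
- by rewrite !sm//; lia.
- by move=> i j; have ij := idx_lt i j; rewrite sm ?h2//; lia.
- by move=> j jM; rewrite sm ?h3//; lia.
case; rewrite /= !bE ?addn0 cE !eqn_add2l /= MC.
- by rewrite -fmorph_div -rmorphN.
- by rewrite -fmorph_div.
Qed.

(** With the selection flags as weights at stride 1, the projection is another instance of
    [gram_prog]. It is accumulated at address 0, over the input, which has to be cleared before. *)
Definition diag_prog : prog :=
  Seq (Do (Diag 15 16 18 0)) (block [:: NAdd 27 16 3; NAdd 28 17 3] (Seq sel_prog
  (block [:: NConst 27 0] (Seq zero_prog
  (block [:: NAdd 20 15 3; NAdd 21 15 3; NAdd 22 17 3; NConst 23 1; NConst 24 0; NAdd 25 0 3;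
     NAdd 26 0 3] gram_prog)))))%N.

Lemma runs_diag c H s : Phi c H s ->
  runs dg xi diag_prog s (fun s' => load_mx d d 0 (cell s') = topproj dg k H)
    ((d ^ 3).+1 + (2 + ((d * (d * 7 + 10) + 2) + (1 + ((dd * 4 + 2) + (7 + gram_cost d d))))))%N.
Proof.
move=> [h0 [h1 h1'] h2 h3 h4].
have hH : load_mx d d (2 + d) (cell s) = H by apply/matrixP => i j; rewrite mxE h2.
set V : 'M[R[i]]_d := (@dg d H).1.
set lam : 'rV[R[i]]_d := (@dg d H).2.
have r0 : reg s 0 = d by rewrite h0. have r18 : reg s 18 = (2 + d)%N by rewrite h0.
have r15 : reg s 15 = U by rewrite h0. have r16 : reg s 16 = l by rewrite h0.
have -> : (d ^ 3).+1 = instr_cost (Diag 15 16 18 0) s by rewrite /= r0.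
apply: runs_do_seq; set s1 := (X in runs _ _ _ X).
have ddE : (d * d = dd)%N by [].
have c1 : cell s1 = store_mx l lam (store_mx U V (cell s)).
  by rewrite /s1 /= r0 r18 r15 r16 hH.
have g1 : regs_ok s1 by move=> r rn; rewrite -h0.
have half_coords (j : 'I_d) : cell s1 (l + j)%N = lam 0 j.
  by rewrite c1 -(store_mx_at l lam (store_mx U V (cell s)) 0 j) /= mul0n addn0.
have cU (i j : 'I_d) : cell s1 (U + i * d + j)%N = V i j.
  rewrite c1 store_mx_out ?store_mx_at//; have := idx_lt i j; rewrite /l; lia.
apply: (@runs_block _ _ _ [:: _; _]) => //; set s2 := foldl _ _ _.
have e2 r : (r < 27)%N -> reg s2 r = reg s1 r.
  by move=> rn; rewrite /s2 /= /upd; do 2 rewrite [r == _]ltn_eqF ?(leq_trans rn)//.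
have g2 : regs_ok s2 by move=> r rn; rewrite e2 ?g1// (leq_trans rn).
have q2 : reg s2 2 = 1%N by rewrite g2.
have q3 : reg s2 3 = 0%N by rewrite g2.
have q0 : reg s2 0 = d by rewrite g2.
have q1 : reg s2 1 = k by rewrite g2.
have q16 : reg s2 16 = l by rewrite g2.
have q27 : reg s2 27 = l.
  by rewrite /s2 /= /upd [LHS]/= g1// g1// addn0.
have q28 : reg s2 28 = fl.
  by rewrite /s2 /= /upd [LHS]/= g1// g1// addn0.
apply: runs_seq; apply: (runs_le (runs_sel _ _ q2 q3 q0 q1 q16 q27 q28 _)) => //.
move=> s3 [k3 e3 f3]; have g3 := agree_keep g2 k3.
apply: (@runs_block _ _ _ [:: _]) => //; set s4 := foldl _ _ _.
have e4 r : (r < 27)%N -> reg s4 r = reg s3 r.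
  by move=> rn; rewrite /s4 /= /upd; rewrite [r == _]ltn_eqF ?(leq_trans rn)//.
have g4 : regs_ok s4 by move=> r rn; rewrite e4 ?g3// (leq_trans rn).
apply: runs_seq; apply: (runs_le (runs_zero (n := dd) (s := s4) _ _ _ _ _ _)) => //.
- by rewrite g4.
- by rewrite g4.
- by rewrite g4.
move=> s5 [k5 e5]; have g5 := agree_keep g4 k5.
apply: (@runs_block _ _ _ [:: _; _; _; _; _; _; _]) => //; set s6 := foldl _ _ _.
have [] := @absrun_agree [:: NAdd 20 15 3; NAdd 21 15 3; NAdd 22 17 3; NConst 23 1; NConst 24 0;
  NAdd 25 0 3; NAdd 26 0 3]%N s5 regs0 _ g5 erefl.
rewrite -/s6 /= !addn0 => ag c6 _.
have BE : (2 + d + dd = B)%N by [].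
have zE : (z = B + 5)%N by rewrite /z -!addnA.
have UE : (U = z + (M + M))%N by [].
have lE : (l = U + dd)%N by [].
have flE : (fl = l + d)%N by [].
have tE : (tmp = B + 1)%N by [].
apply: (runs_le (T := gram_cost d d) (@runs_gram R dg xi s6 d d 1 U U fl 0 tmp
  (ag 2%N isT) (ag 3%N isT) (ag 4%N isT) (ag 20%N isT) (ag 21%N isT) (ag 22%N isT)
  (ag 23%N isT) (ag 24%N isT) (ag 25%N isT) (ag 26%N isT) d_gt0 _ _ _ _)) => //.
- by lia.
- by move=> e ce'; split; lia.
- by move=> e ce'; split; lia.
- by move=> e ce'; split; lia.
move=> s7 [_ e7 _]; apply/matrixP => i j; rewrite !mxE e7// c6 e5.
rewrite ifT; last by have := idx_lt i j; rewrite add0n.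
rewrite add0r; apply: eq_bigr => e _ /=.
have cV (i' : 'I_d) : cell s5 (U + i' * d + e)%N = V i' e.
  have ie := idx_lt i' e; rewrite e5 ifF; last by lia.
  by rewrite f3 ?cU//; lia.
rewrite !cV muln1 e5 ifF; last by lia.
rewrite e3// /top_sel /topk; congr ((nat_of_bool (_ <= _)%N)%:R * _).
by apply: eq_bigr => q _; rewrite /no_later !half_coords.
Qed.

Definition mech_prog : prog :=
  block setup (Seq (Do (Sphere 13 14)) (block [:: NAdd 27 13 3] (Seq real_prog
  (block [:: CNat 9 2] (Seq (norm_prog 13 10) (Seq (norm_prog 19 11)
  (coeff_prog (Seq (add_prog 13 10) (Seq (add_prog 19 11) diag_prog)))))))))%N.

Lemma runs_mech A gamma delta :
  runs dg xi mech_prog (init_state k A gamma eps delta)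
    (fun s' => load_mx d d 0 (cell s') = topproj dg k (noisy A)) (1000 * d ^ 3)%N.
Proof.
pose T1 := ((d ^ 3).+1 + (2 + ((d * (d * 7 + 10) + 2) + (1 + ((dd * 4 + 2) + (7 + gram_cost d d))))))%N.
suff h : runs dg xi mech_prog (init_state k A gamma eps delta)
    (fun s' => load_mx d d 0 (cell s') = topproj dg k (noisy A))
    (23 + ((M + M).+1 + (1 + (((M + M) * 5 + 2) + (1 + ((8 + gram_cost 1 m) + ((8 + gram_cost 1 m)
    + (6 + ((7 + gram_cost d n) + ((7 + gram_cost d n) + T1))))))))))%N.
  apply: (runs_le h) => //.
  rewrite /T1 /gram_cost /M /m /n /dd.
  have -> : (d ^ 3 = d * (d * d))%N by rewrite !expnS muln1.
  have d1 : (d * 1 <= d * d)%N by rewrite leq_mul2l d_gt0 orbT.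
  have d2 : (d * (d * 1) <= d * (d * d))%N by rewrite !leq_mul2l d_gt0 !orbT.
  nia.
apply: runs_block => //.
have [] := @setup_regs (init_state k A gamma eps delta); first by case=> [|[|]].
set s1 := foldl _ _ _ => g1 c1 dr1.
move: s1 g1 c1 dr1 => s1 g1 c1 dr1.
have q13 : reg s1 13 = z by rewrite g1. have q14 : reg s1 14 = (M + M)%N by rewrite g1.
have -> : (M + M).+1 = instr_cost (Sphere 13 14) s1 by rewrite /= q14.
apply: runs_do_seq; set s2 := (X in runs _ _ _ X).
have g2 : regs_ok s2 by move=> r rn; rewrite -g1.
have BE : (2 + d + dd = B)%N by [].
have zE : (z = B + 5)%N by rewrite /z -!addnA.
have tE : (tmp = B + 1)%N by [].
have c2 : cell s2 = store_mx z (sphere_vec xi 0 (M + M)) (cell s1).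
  by rewrite /s2 /= q13 q14 dr1.
apply: (@runs_block _ _ _ [:: _]) => //; set s3 := foldl _ _ _.
have g3 : regs_ok s3.
  by move=> r rn; rewrite /s3 /= /upd [r == _]ltn_eqF ?g2// (leq_trans rn).
apply: runs_seq; apply: (runs_le (runs_real (s := s3) (n := (M + M)%N) (z := z) (tmp := tmp) _ _ _ _ _ _ _)) => //.
- by rewrite g3.
- by rewrite g3.
- by rewrite /s3 /= /upd /= !g2// addn0.
- by lia.
move=> s4 [k4 e4]; have g4 := agree_keep g3 k4.
apply: (@runs_block _ _ _ [:: _]) => //; set s5 := foldl _ _ _.
have g5 : regs_ok s5 by move=> r rn; rewrite -g4.
have r9 : reg s4 9 = B by rewrite g4. have r2 : reg s4 2 = 1%N by rewrite g4.
have e5 b : cell s5 b = if b == B then 1 else cell s4 b.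
  by rewrite /s5 /= /upd r9 r2.
have o4 b : b != tmp -> ~~ (z <= b < z + (M + M))%N -> cell s4 b = cell (init_state k A gamma eps delta) b.
  move=> bt bz; rewrite e4// (negbTE bz) (_ : cell s3 = cell s2)// c2 store_mx_out ?c1//.
  by rewrite mul1n.
have P0 : Phi (fun=> 0) A s5.
  have i0 : (0 < d)%N := d_gt0.
  split=> //.
  - split; last by rewrite e5 eqxx.
    rewrite e5 (_ : (0%N == B) = false); last by lia.
    rewrite o4; [|by lia|by lia].
    rewrite /= !store_mx_out//; lia.
  - move=> i j; have ij := idx_lt i j; rewrite e5 ifF; last by lia.
    by rewrite o4 /= ?store_mx_at//; lia.
  - move=> j jM; rewrite e5 ifF; last by lia.
    rewrite e4; last by lia.
    rewrite ifT; last by lia.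
    have -> : cell s3 (z + j)%N = sphere_vec xi 0 (M + M) 0 (Ordinal jM).
      by rewrite (_ : cell s3 = cell s2)// c2 -(store_mx_at z _ (cell s1)) /= mul0n addn0.
    rewrite mxE /rnd /= mulr2n mulrDl !mul1r; apply/eqP; rewrite eq_complex /=.
    by rewrite addrN !eqxx.
  move=> b; rewrite e5 ifF; last by lia.
  rewrite o4; [|by lia|by case: b; lia].
  rewrite /= !store_mx_out; [|by lia|by rewrite -/dd; lia].
  have n0 : (B + 1 + 1 + b == 0)%N = false by lia.
  have n1 : (B + 1 + 1 + b == 1)%N = false by lia.
  by rewrite /upd n0 n1.
apply: runs_seq; apply: (runs_le (@runs_norm false _ _ _ P0 erefl)) => // s6 P6.
apply: runs_seq; apply: (runs_le (@runs_norm true _ _ _ P6 erefl)) => // s7 P7.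
apply: (runs_coeff P7) => s8 P8.
apply: runs_seq; apply: (runs_le (@runs_add false _ _ _ P8)) => // s9 P9.
apply: runs_seq; apply: (runs_le (@runs_add true _ _ _ P9)) => // s10 P10.
apply: (runs_le (runs_diag P10)) => // s11 ->; congr topproj.
by rewrite /noisy scaleNr map_mxN.
Qed.
End main_prog.

(** * Spectral projections *)

Section topk.
Variables (R : realType) (d : nat).
Implicit Type lam : 'I_d -> R.

Let before lam (c j : 'I_d) := (lam c <= lam j) && ((lam j <= lam c) ==> (j <= c)%N).

Lemma topkE lam k c : topk lam k c = (#|before lam c| <= k)%N.
Proof. by rewrite /topk -sum1_card [in RHS]big_mkcond. Qed.

Let beforeP lam c j : reflect (lam c < lam j \/ lam c = lam j /\ (j <= c)%N) (before lam c j).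
Proof.
rewrite /before; case: (ltgtP (lam c) (lam j)) => h /=; apply: (iffP idP) => //.
- by left.
- by case=> [//|[e _]]; move: h; rewrite e ltxx.
- by right.
- by case=> [|[]].
Qed.

Let before_trans lam c j i : before lam c j -> before lam j i -> before lam c i.
Proof.
move=> /beforeP[h1|[h1 l1]] /beforeP[h2|[h2 l2]]; apply/beforeP.
- by left; exact: lt_trans h2.
- by left; rewrite -h2.
- by left; rewrite h1.
- by right; split; [rewrite h1|exact: leq_trans l1].
Qed.

Let before_total lam c j : before lam c j || before lam j c.
Proof.
have [h|h|h] := ltgtP (lam c) (lam j).
- by apply/orP; left; apply/beforeP; left.
- by apply/orP; right; apply/beforeP; left.
- by case: (leqP j c) => [l|/ltnW l]; apply/orP; [left|right]; apply/beforeP; right.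
Qed.

Let before_anti lam c j : before lam c j -> before lam j c -> c = j.
Proof.
move=> /beforeP[h1|[h1 l1]] /beforeP[h2|[h2 l2]].
- by have := lt_trans h1 h2; rewrite ltxx.
- by move: h1; rewrite h2 ltxx.
- by move: h2; rewrite h1 ltxx.
- by apply/ord_inj/eqP; rewrite eqn_leq l1 l2.
Qed.

Let rk lam c := #|before lam c|.

Let rk_lt lam c j : before lam c j -> c != j -> (rk lam j < rk lam c)%N.
Proof.
move=> cj /eqP ncj; apply/proper_card/properP; split.
  by apply/fintype.subsetP => i; rewrite !unfold_in; exact: before_trans.
exists c; rewrite !unfold_in; first by have := before_total lam c c; rewrite orbb.
by apply/negP => jc; apply: ncj; exact: before_anti jc.
Qed.

Let rk_gt0 lam c : (0 < rk lam c)%N.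
Proof. by apply/card_gt0P; exists c; rewrite unfold_in; have := before_total lam c c; rewrite orbb. Qed.

Let rk_lt_d lam c : ((rk lam c).-1 < d)%N.
Proof.
rewrite prednK ?rk_gt0//; apply: leq_trans (max_card _) _; by rewrite card_ord.
Qed.

(** Ranks are distinct and lie between 1 and d, even for equal values, so exactly k of them are at
    most k. *)
Lemma card_topk lam k : (k <= d)%N -> #|topk lam k| = k.
Proof.
move=> kd; pose f c := Ordinal (rk_lt_d lam c).
have f_inj : injective f.
  move=> c j /(congr1 val)/= e; apply/eqP; apply: contraTT isT => ncj.
  have {}e : rk lam c = rk lam j by rewrite -(prednK (rk_gt0 lam c)) e prednK ?rk_gt0.
  case/orP: (before_total lam c j) => /rk_lt; rewrite e ltnn; first by move=> /(_ ncj).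
  by rewrite eq_sym => /(_ ncj).
transitivity #|[pred i : 'I_d | (i < k)%N]|.
  rewrite -(fintype.card_image f_inj); apply: eq_card => i; rewrite !inE.
  apply/fintype.imageP/idP => [[c]|ik].
    by rewrite -[c \in _]/(topk lam k c) topkE -/(rk lam c) => ck -> /=; rewrite prednK ?rk_gt0.
  have [g fK gK] := injF_bij f_inj; exists (g i); last by rewrite gK.
  rewrite -[_ \in _]/(topk lam k _) topkE -/(rk lam _) -(prednK (rk_gt0 lam (g i))).
  by have := congr1 val (gK i) => /= ->.
rewrite -sum1_card -(big_ord_widen d (fun=> 1%N) kd) sum_nat_const card_ord muln1 //.
Qed.

Lemma topk_le lam k c j : topk lam k c -> ~~ topk lam k j -> lam j <= lam c.
Proof.
rewrite !topkE -ltnNge => ck kj; rewrite leNgt; apply/negP => cj.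
have b : before lam c j by apply/beforeP; left.
have ncj : c != j by apply/eqP => e; move: cj; rewrite e ltxx.
by have := leq_trans (rk_lt b ncj) ck; rewrite /rk; lia.
Qed.

(** A linear program over fractional k-subsets: if t separates the selected values from the others,
    every term (lam c - t) (1_S(c) - q c) is nonnegative, and t itself cancels because both weights
    sum to k. *)
Lemma topk_max lam (q : 'I_d -> R) k : (k <= d)%N ->
  (forall c, 0 <= q c <= 1) -> \sum_c q c = k%:R ->
  \sum_c lam c * q c <= \sum_(c | topk lam k c) lam c.
Proof.
move=> kd q01 qk; pose S := topk lam k.
(* The least selected value; the greatest value if none is selected; any number if there are no
   indices. *)
have [t tS tN] : exists2 t, (forall c, S c -> t <= lam c) & (forall c, ~~ S c -> lam c <= t).
  have [/existsP[c0 c0S]|/existsPn none] := boolP [exists c, S c].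
    have [c cS cmin] := arg_minP lam c0S.
    by exists (lam c) => // j jS; exact: topk_le cS jS.
  have [/existsP[c0 c0S]|/existsPn all] := boolP [exists c, ~~ S c].
    have [c cS cmax] := @arg_maxP _ _ _ c0 (predC S) lam c0S.
    by exists (lam c) => // j jS; have := none j; rewrite jS.
  by exists 0 => c cS; [have := none c; rewrite cS|have := all c; rewrite negbK; move: cS => /negbTE ->].
rewrite -subr_ge0.
have -> : \sum_(c | S c) lam c - \sum_c lam c * q c = \sum_c (lam c - t) * ((S c)%:R - q c).
  under [RHS]eq_bigr do rewrite mulrBl !mulrBr.
  rewrite !sumrB -!mulr_sumr qk.
  have -> : \sum_i (S i)%:R = k%:R :> R.
    rewrite -natr_sum; congr (_%:R); rewrite -[RHS](card_topk lam kd) -sum1_card.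
    by rewrite [RHS]big_mkcond.
  rewrite subrr subr0; congr (_ - _); rewrite big_mkcond; apply: eq_bigr => c _.
  by case: (S c); rewrite ?mulr1 ?mulr0.
apply: sumr_ge0 => c _; have /andP[q0 q1] := q01 c.
have [Sc|Sc] := boolP (S c).
  by rewrite mulr_ge0// subr_ge0//; exact: tS.
by rewrite mulr_le0// ?sub0r ?oppr_le0// subr_le0; exact: tN.
Qed.
End topk.

(** * Projections spanned by columns of a unitary matrix *)

Section uproj.
Variables (R : realType) (d : nat).
Local Notation C := R[i].
Local Open Scope sesquilinear_scope.
Implicit Types (U : 'M[C]_d) (S : pred 'I_d).

Lemma adjE m n (M : 'M[C]_(m, n)) i j : M^t* i j = conjc (M j i).
Proof. by rewrite !mxE. Qed.

Lemma adjM m n p (M : 'M[C]_(m, n)) (N : 'M[C]_(n, p)) : (M *m N)^t* = N^t* *m M^t*.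
Proof. by rewrite trmx_mul map_mxM. Qed.

Lemma adjK m n (M : 'M[C]_(m, n)) : M^t*^t* = M.
Proof. by apply/matrixP => i j; rewrite !adjE conjcK. Qed.

Lemma hermsymmxP (H : 'M[C]_d) : reflect (H^t* = H) (H \is hermsymmx).
Proof.
apply: (iffP (is_hermitianmxP _ _ _)) => /=; rewrite expr0 scale1r => h.
  by rewrite -{}h.
by rewrite -[LHS]h.
Qed.

Lemma unitary_adjU U : U \is unitarymx -> U^t* \is unitarymx.
Proof. by move=> h; rewrite trmxC_unitary; exact: h. Qed.

Definition diagS S : 'M[C]_d := diag_mx (\row_c (S c)%:R).

Lemma uprojE U S : uproj U S = U *m diagS S *m U^t*.
Proof.
apply/matrixP => i j; rewrite !mxE; apply: eq_bigr => c _.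
rewrite mul_mx_diag !mxE mulrA; congr (_ * _); exact: mulrC.
Qed.

Lemma diagS_adj S : (diagS S)^t* = diagS S.
Proof.
rewrite tr_diag_mx map_diag_mx; congr diag_mx; apply/rowP => c; rewrite !mxE.
exact: rmorph_nat.
Qed.

Lemma diagS_idem S : diagS S *m diagS S = diagS S.
Proof.
rewrite mulmx_diag; congr diag_mx; apply/rowP => c; rewrite !mxE.
by case: (S c); rewrite ?mulr1 ?mulr0.
Qed.

(** The matrix factors as E^T E through the coordinates in S, and E E^T = 1. *)
Lemma rank_diagS S : \rank (diagS S) = #|S|.
Proof.
pose f (i : 'I_#|S|) : 'I_d := enum_val i.
pose E : 'M[C]_(#|S|, d) := \matrix_(i, j) (f i == j)%:R.
have EE : E *m E^T = 1%:M.
  apply/matrixP => i j; rewrite !mxE (bigD1 (f i))//= big1 => [|c]; last first.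
    by rewrite eq_sym !mxE => /negbTE ->; rewrite mul0r.
  by rewrite !mxE eqxx mul1r addr0 (inj_eq enum_val_inj) eq_sym.
have DE : E^T *m E = diagS S.
  apply/matrixP => i j; rewrite !mxE.
  have [Si|Si] := boolP (i \in S).
    rewrite (bigD1 (enum_rank_in Si i))//= big1 => [|c]; last first.
      rewrite !mxE => ci; case: eqP => [e|]; last by rewrite mul0r.
      by case/eqP: ci; apply: enum_val_inj; rewrite enum_rankK_in.
    by rewrite !mxE /f enum_rankK_in// eqxx mul1r addr0; move: Si; rewrite unfold_in => ->.
  rewrite big1 => [|c _]; last first.
    rewrite !mxE; case: eqP => [e|]; last by rewrite mul0r.
    by case/negP: Si; rewrite -e enum_valP.
  by move: Si; rewrite unfold_in => /negbTE ->; rewrite mul0rn.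
apply/eqP; rewrite eqn_leq; apply/andP; split.
  by rewrite -DE (leq_trans (mxrankM_maxr _ _))// rank_leq_row.
have: (\rank (E *m diagS S *m E^T) <= \rank (diagS S))%N.
  by rewrite (leq_trans (mxrankM_maxl _ _))// mxrankM_maxr.
by rewrite -DE !mulmxA EE mul1mx EE mxrank1.
Qed.

Lemma rank_proj_uproj U S : U \is unitarymx -> rank_proj #|S| (uproj U S).
Proof.
move=> Uu; have UU : U^t* *m U = 1%:M.
  by rewrite -invmx_unitary// mulVmx// unitarymx_unit.
split.
- by apply/hermsymmxP; rewrite uprojE !adjM diagS_adj adjK mulmxA.
- by rewrite uprojE !mulmxA -(mulmxA (U *m _)) UU mulmx1 -(mulmxA U) diagS_idem.
- have Ut : U^t* \is unitarymx := unitary_adjU Uu.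
  rewrite uprojE mxrankMfree ?row_free_unit; last exact: unitarymx_unit.
  rewrite eqmxMfull ?rank_diagS//.
  rewrite row_full_unit; exact: unitarymx_unit Uu.
Qed.

(** The quadratic form of [X] at column [c] of [U]. *)
Definition qf (X : 'M[C]_d) (U : 'M[C]_d) (c : 'I_d) : R := complex.Re ((U^t* *m X *m U) c c).

Lemma mxinner_uproj (X : 'M[C]_d) U S : X^t* = X ->
  mxinner X (uproj U S) = \sum_(c | S c) qf X U c.
Proof.
move=> hX; rewrite /mxinner hX uprojE mulmxA mxtrace_mulC !mulmxA -(mulmxA _ X).
rewrite mulmxA /mxtrace raddf_sum/= [RHS]big_mkcond; apply: eq_bigr => c _.
rewrite mul_mx_diag !mxE /qf; case: (S c); first by rewrite mulr1 mxE.
by rewrite mulr0.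
Qed.

Lemma qfD X Y U c : qf (X + Y) U c = qf X U c + qf Y U c.
Proof. by rewrite /qf mulmxDr mulmxDl mxE raddfD. Qed.

Lemma qfN X U c : qf (- X) U c = - qf X U c.
Proof. by rewrite /qf mulmxN mulNmx mxE raddfN. Qed.

Lemma qfE X U c : (U^t* *m X *m U) c c = (row c (U^t*) *m X *m (row c (U^t*))^t*) 0 0.
Proof.
rewrite -row_mul !mxE; apply: eq_bigr => j _; rewrite [row _ _ _ _]mxE.
by congr (_ * _); rewrite !mxE conjCK.
Qed.

Lemma qf_psd A U c : psdmx A -> 0 <= qf A U c.
Proof.
by move=> [_ /(_ (row c (U^t*)))]; rewrite -qfE /qf; case: (X in 0 <= X) => a b; case/andP.
Qed.

Lemma unitary_adj U : U \is unitarymx -> U^t* *m U = 1%:M.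
Proof. by move=> Uu; rewrite -invmx_unitary// mulVmx// unitarymx_unit. Qed.

Definition sqabs (x : C) : R := complex.Re x ^+ 2 + complex.Im x ^+ 2.

Lemma sqabsE (x : C) : (sqabs x)%:C = x * conjc x.
Proof. by case: x => a b; rewrite /sqabs /=; simpc; congr (_ +i* _); ring. Qed.

Lemma unitary_sqabs U c : U \is unitarymx -> \sum_e sqabs (U c e) = 1.
Proof.
move=> /unitarymxP/matrixP/(_ c c); rewrite !mxE eqxx mulr1n => e1.
apply: (@complexI R); rewrite rmorph1 -e1 rmorph_sum; apply: eq_bigr => e _.
by rewrite adjE -sqabsE.
Qed.

(* In the eigenbasis V of H the weights of the eigenvalues in <H, Q> are the sums of the
   squared moduli of the entries of the unitary matrix V^* U over the columns in S. *)
Lemma mxinner_eig_le (H V U : 'M[C]_d) (l : 'rV[C]_d) (S : pred 'I_d) k :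
  (k <= d)%N -> H^t* = H -> V \is unitarymx -> H = V *m diag_mx l *m V^t* ->
  U \is unitarymx -> #|S| = k ->
  mxinner H (uproj U S) <= mxinner H (uproj V (topk (fun c => complex.Re (l 0 c)) k)).
Proof.
move=> kd hH Vu HE Uu Sk; rewrite !mxinner_uproj//.
pose lam c := complex.Re (l 0 c); pose W := V^t* *m U.
have VV := unitary_adj Vu.
have Wu : W \is unitarymx by apply: mul_unitarymx Uu; exact: unitary_adjU Vu.
have Wu' : W^t* \is unitarymx := unitary_adjU Wu.
have qV c : qf H V c = lam c.
  rewrite /qf HE !mulmxA VV mul1mx -mulmxA VV mulmx1 /lam mxE eqxx mulr1n //.
have lr c : l 0 c = (lam c)%:C.
  have : diag_mx l = V^t* *m H *m V.
    by rewrite HE !mulmxA VV mul1mx -mulmxA VV mulmx1.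
  move=> dl; have : (diag_mx l)^t* = diag_mx l.
    by rewrite dl !adjM adjK hH mulmxA.
  move=> /matrixP/(_ c c); rewrite adjE mxE eqxx mulr1n /lam.
  by case: (l 0 c) => a b [] /eqP; rewrite eq_sym -addr_eq0 -mulr2n mulrn_eq0/= => /eqP ->.
have qU e : qf H U e = \sum_c lam c * sqabs (W c e).
  rewrite /qf HE.
  have -> : U^t* *m (V *m diag_mx l *m V^t*) *m U = W^t* *m diag_mx l *m W.
    by rewrite /W adjM adjK !mulmxA.
  rewrite mxE -[RHS]/(complex.Re (\sum_c lam c * sqabs (W c e))%:C); congr complex.Re.
  rewrite rmorph_sum; apply: eq_bigr => j _.
  transitivity ((lam j)%:C * (sqabs (W j e))%:C); last by rewrite -rmorphM.
  by rewrite sqabsE mul_mx_diag mxE adjE lr; ring.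
under eq_bigr do rewrite qU.
under [leRHS]eq_bigr do rewrite qV.
rewrite exchange_big/=; under eq_bigr do rewrite -mulr_sumr.
have sq0 x : 0 <= sqabs x by rewrite addr_ge0 ?sqr_ge0.
apply: topk_max => // [c|].
  rewrite sumr_ge0//= -(unitary_sqabs c Wu) [leRHS](bigID S)/= lerDl.
  exact: sumr_ge0.
rewrite exchange_big/= -Sk -sum1_card natr_sum; apply: eq_bigr => e _.
rewrite -(unitary_sqabs e Wu'); apply: eq_bigr => c _.
by rewrite adjE /sqabs; case: (W c e) => a b /=; rewrite sqrrN.
Qed.
End uproj.

(** * Quadratic forms of Gram matrices and sums of top eigenvalues *)

Section spectral.
Variables (R : realType) (d : nat).
Local Notation C := R[i].
Local Open Scope sesquilinear_scope.

(** Since G is real, the complex form splits into those of the real and imaginary parts of the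
    vector, to which the real bound [opboundP] applies. *)
Lemma qf_gram (G : 'M[R]_(d, d + d)) (s : R) (U : 'M[C]_d) c :
  qf (map_mx (real_complex R) (s *: (G *m G^T))) U c =
  s * \sum_a ((\sum_i complex.Re (U i c) * G i a) ^+ 2 + (\sum_i complex.Im (U i c) * G i a) ^+ 2).
Proof.
pose z a : C := \sum_i conjc (U i c) * (G i a)%:C.
have zE a : sqabs (z a) =
    (\sum_i complex.Re (U i c) * G i a) ^+ 2 + (\sum_i complex.Im (U i c) * G i a) ^+ 2.
  rewrite /sqabs /z !raddf_sum/= -[in RHS](sqrrN (\sum_i complex.Im _ * _)) -sumrN.
  congr (_ ^+ 2 + _ ^+ 2); apply: eq_bigr => i _; case: (U i c) => x y /=; ring.
under eq_bigr do rewrite -zE.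
rewrite /qf -[RHS]/(complex.Re (s * \sum_a sqabs (z a))%:C); congr complex.Re.
rewrite rmorphM rmorph_sum mulr_sumr /= mxE.
have E1 e : (U^t* *m map_mx (real_complex R) (s *: (G *m G^T))) c e =
    \sum_a s%:C * z a * (G e a)%:C.
  rewrite mxE; under eq_bigr => i _.
    rewrite !mxE rmorphM rmorph_sum mulrCA mulr_sumr /=.
    under eq_bigr do rewrite !mxE rmorphM/= mulrA.
    over.
  rewrite -mulr_sumr exchange_big/= mulr_sumr; apply: eq_bigr => a _.
  by rewrite -mulr_suml mulrA.
transitivity (\sum_e (\sum_a s%:C * z a * (G e a)%:C) * U e c).
  by apply: eq_bigr => e _; rewrite E1.
under [LHS]eq_bigr do rewrite mulr_suml.
rewrite exchange_big/=; apply: eq_bigr => a _.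
have -> : (sqabs (z a))%:C = z a * \sum_e (G e a)%:C * U e c.
  rewrite sqabsE; congr (_ * _); rewrite /z rmorph_sum; apply: eq_bigr => e _.
  case: (U e c) => x y; apply/eqP; rewrite eq_complex /=.
  by apply/andP; split; apply/eqP; ring.
by rewrite mulrA [RHS]mulr_sumr; apply: eq_bigr => e _; rewrite !mulrA.
Qed.

Lemma qf_gram_ge0 (G : 'M[R]_(d, d + d)) (s : R) (U : 'M[C]_d) c : 0 <= s ->
  0 <= qf (map_mx (real_complex R) (s *: (G *m G^T))) U c.
Proof.
by move=> s0; rewrite qf_gram mulr_ge0// sumr_ge0// => a _; rewrite addr_ge0 ?sqr_ge0.
Qed.

Lemma qf_gram_le (G : 'M[R]_(d, d + d)) (s : R) (U : 'M[C]_d) c : (0 < d)%N -> 0 <= s ->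
  U \is unitarymx ->
  qf (map_mx (real_complex R) (s *: (G *m G^T))) U c <= s * opbound G.
Proof.
move=> d0 s0 Uu; rewrite qf_gram ler_wpM2l// big_split/=.
have -> : opbound G = opbound G * \sum_i complex.Re (U i c) ^+ 2 +
    opbound G * \sum_i complex.Im (U i c) ^+ 2.
  rewrite -mulrDr -big_split/= -[LHS]mulr1; congr (_ * _).
  rewrite -(unitary_sqabs c (unitary_adjU Uu)); apply: eq_bigr => i _.
  by rewrite adjE /sqabs; case: (U i c) => x y /=; rewrite sqrrN.
by apply: lerD; exact: opboundP.
Qed.

(** Comparing characteristic polynomials shows that [gamma] is a permutation of the eigenvalues
    returned by the routine; its first k entries are one admissible 0-1 weight in [topk_max]. *)
Lemma eig_sum_le (dg : diag_routine R) k (A : 'M[C]_d) (gamma : d.-tuple R) : (k <= d)%N ->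
  exact_diag dg -> A \is hermsymmx -> eigenvalues_of A gamma ->
  \sum_(i < k) gamma`_i <= mxinner A (topproj dg k A).
Proof.
move=> kd [hdg _ _] hA [hchar _]; have [Vu AE] := hdg _ _ hA.
have /hermsymmxP hA' := hA; rewrite /topproj mxinner_uproj//.
set V := (dg d A).1 in Vu AE *; set l := (dg d A).2 in AE *.
pose lam c := complex.Re (l 0 c).
have VV := unitary_adj Vu.
have qV c : qf A V c = lam c.
  by rewrite /qf AE !mulmxA VV mul1mx -mulmxA VV mulmx1 /lam mxE eqxx mulr1n.
under [leRHS]eq_bigr do rewrite qV.
have chl : char_poly A = \prod_(c < d) ('X - (l 0 c)%:P).
  transitivity (char_poly (diag_mx l)); last first.
    rewrite char_poly_trig; last exact/diag_mx_is_trig.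
    by apply: eq_bigr => c _; rewrite mxE eqxx.
  have -> : diag_mx l = V^t* *m A *m V by rewrite AE !mulmxA VV mul1mx -mulmxA VV mulmx1.
  pose Vt : 'M[C]_d := V^t*.
  rewrite -[V^t*]/Vt /char_poly /char_poly_mx !map_mxM.
  have VP : map_mx polyC Vt *m map_mx polyC V = 1%:M by rewrite -map_mxM VV map_mx1.
  have -> : 'X%:M - map_mx polyC Vt *m map_mx polyC A *m map_mx polyC V =
     map_mx polyC Vt *m ('X%:M - map_mx polyC A) *m map_mx polyC V.
    rewrite mulmxBr mulmxBl; congr (_ - _).
    by rewrite mul_mx_scalar -scalemxAl VP scalemx1.
  by rewrite !det_mulmx mulrAC -det_mulmx VP det1 mul1r.
have pe : perm_eq [seq complex.Re x | x <- [seq l 0 c | c <- enum 'I_d]] gamma.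
  have -> : val gamma = [seq complex.Re x | x <- [seq x%:C | x <- gamma]].
    by rewrite -map_comp map_id.
  apply/perm_map/prod_XsubC_eq.
  by rewrite [LHS]big_map [LHS]big_enum/= -chl hchar [RHS]big_map.
rewrite perm_sym -map_comp in pe.
have [p pE] : exists p : {perm 'I_d}, forall i : 'I_d, gamma`_i = lam (p i).
  have /tuple_permP[p pE] : perm_eq gamma [tuple lam i | i < d].
    by rewrite (perm_trans pe)// /= map_comp.
  exists p => i; rewrite pE.
  rewrite (nth_map i); last by rewrite size_enum_ord.
  by rewrite nth_ord_enum tnth_mktuple.
pose q c : R := ((p^-1)%g c < k)%N%:R.
have <- : \sum_c lam c * q c = \sum_(i < k) gamma`_i.
  rewrite (reindex_inj (@perm_inj _ p))/= (big_ord_widen d (fun i => gamma`_i) kd).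
  rewrite [RHS]big_mkcond; apply: eq_bigr => i _; rewrite /q permK pE.
  by case: ifP; rewrite ?mulr1 ?mulr0.
apply: topk_max => // [c|]; first by rewrite /q; case: (_ < _)%N; rewrite ?lexx ?ler01.
rewrite (reindex_inj (@perm_inj _ p))/= -natr_sum; congr (_%:R).
transitivity (\sum_(i < k) 1)%N; last by rewrite sum_nat_const card_ord muln1.
rewrite (big_ord_widen d (fun=> 1%N) kd) [RHS]big_mkcond; apply: eq_bigr => i _.
by rewrite permK; case: ltnP.
Qed.
End spectral.

(** * Measurability of the mechanism *)

Section meas.
Variable R : realType.

Definition cmx_meas dT (T : measurableType dT) m n (F : T -> 'M[R[i]]_(m, n)) : Prop :=
  forall S, mx_measurable S -> measurable (F @^-1` S).

Section one.
Variables (dT : measure_display) (T : measurableType dT).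

Lemma cmx_measI m n (F : T -> 'M[R[i]]_(m, n)) :
  (forall i j, measurable_fun setT (fun t => complex.Re (F t i j))) ->
  (forall i j, measurable_fun setT (fun t => complex.Im (F t i j))) -> cmx_meas F.
Proof.
move=> hr hi S; apply: (@smallest_sub _ _ _ [set S | measurable (F @^-1` S)]).
  split=> /=; first by rewrite preimage_set0.
  - by move=> A mA; rewrite setTD preimage_setC; exact: measurableC.
  - by move=> A mA; rewrite preimage_bigcup; exact: bigcupT_measurable.
move=> _ [i [j [B [mB [->|->]]]]] /=; rewrite -[X in measurable X]setTI.
- exact: hr.
- exact: hi.
Qed.

Lemma cmx_meas_Re m n (F : T -> 'M[R[i]]_(m, n)) i j :
  cmx_meas F -> measurable_fun setT (fun t => complex.Re (F t i j)).
Proof.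
move=> mF _ B mB; rewrite setTI.
apply: (mF [set M : 'M[R[i]]_(m, n) | B (complex.Re (M i j))]).
by apply: sub_sigma_algebra; exists i, j, B; split=> //; left.
Qed.

Lemma cmx_meas_Im m n (F : T -> 'M[R[i]]_(m, n)) i j :
  cmx_meas F -> measurable_fun setT (fun t => complex.Im (F t i j)).
Proof.
move=> mF _ B mB; rewrite setTI.
apply: (mF [set M : 'M[R[i]]_(m, n) | B (complex.Im (M i j))]).
by apply: sub_sigma_algebra; exists i, j, B; split=> //; right.
Qed.

Lemma measurable_topk d k (lam : T -> 'I_d -> R) c :
  (forall c, measurable_fun setT (fun t => lam t c)) ->
  measurable_fun setT (fun t => (topk (lam t) k c)%:R : R).
Proof.
move=> ml.
have mnat (b : T -> bool) : measurable_fun setT b -> measurable_fun setT (fun t => (b t)%:R : R).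
  move=> mb; have -> : (fun t => (b t)%:R : R) = (fun t => if b t then 1 else 0).
    by apply/funext => t; case: (b t).
  by apply: measurable_fun_ifT.
apply: (mnat _); have -> : (fun t => topk (lam t) k c) =
    (fun t => \sum_(j < d) ((lam t c <= lam t j) && ((lam t j <= lam t c) ==> (j <= c)%N))%:R
       <= k%:R :> R).
  by apply/funext => t; rewrite /topk -natr_sum ler_nat.
apply: measurable_fun_ler; last exact: measurable_cst.
apply: measurable_sum => j; apply: (mnat _); apply: measurable_and.
  exact: measurable_fun_ler.
case: (leqP j c) => jc.
  have -> : (fun x => (lam x j <= lam x c) ==> true) = (fun=> true) by apply/funext => x; rewrite implybT.
  exact: measurable_cst.
have -> : (fun x => (lam x j <= lam x c) ==> false) = (fun x => ~~ (lam x j <= lam x c)).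
  by apply/funext => x; rewrite implybF.
by apply: measurable_neg; exact: measurable_fun_ler.
Qed.

(** The entries are polynomials in the selection flags and in the real and imaginary parts of the
    eigenvectors, all of which depend measurably on the matrix. *)
Lemma cmx_meas_topproj (dg : diag_routine R) d k (H : T -> 'M[R[i]]_d) :
  exact_diag dg -> cmx_meas H -> cmx_meas (fun t => topproj dg k (H t)).
Proof.
move=> [_ mU ml] mH.
have mU' : cmx_meas (fun t => (dg d (H t)).1) by move=> S mS; exact: (mH _ (mU _ _ mS)).
have ml' : cmx_meas (fun t => (dg d (H t)).2) by move=> S mS; exact: (mH _ (ml _ _ mS)).
pose s t c : R := (topk (fun c => complex.Re ((dg d (H t)).2 0 c)) k c)%:R.
have ms c : measurable_fun setT (fun t => s t c).
  by apply: measurable_topk => e; exact: cmx_meas_Re.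
pose u t i c : R := complex.Re ((dg d (H t)).1 i c).
pose v t i c : R := complex.Im ((dg d (H t)).1 i c).
have mu i c : measurable_fun setT (fun t => u t i c) by exact: cmx_meas_Re.
have mv i c : measurable_fun setT (fun t => v t i c) by exact: cmx_meas_Im.
have PE t i j : topproj dg k (H t) i j =
    (\sum_c s t c * (u t i c * u t j c + v t i c * v t j c)) +i*
    (\sum_c s t c * (v t i c * u t j c - u t i c * v t j c)).
  rewrite mxE; apply/eqP; rewrite eq_complex !raddf_sum/=; apply/andP; split; apply/eqP;
    apply: eq_bigr => c _; rewrite /s /u /v; set b := topk _ _ _.
    have -> : b%:R = (b%:R : R)%:C by rewrite rmorph_nat.
    by case: ((dg d (H t)).1 i c) => x y; case: ((dg d (H t)).1 j c) => x' y' /=; ring.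
  have -> : b%:R = (b%:R : R)%:C by rewrite rmorph_nat.
  by case: ((dg d (H t)).1 i c) => x y; case: ((dg d (H t)).1 j c) => x' y' /=; ring.
apply: cmx_measI => i j.
  under eq_fun do rewrite PE /=.
  apply: measurable_sum => c; apply: measurable_funM => //.
  by apply: measurable_funD; exact: measurable_funM.
under eq_fun do rewrite PE /=.
apply: measurable_sum => c; apply: measurable_funM => //.
by apply: measurable_funB; exact: measurable_funM.
Qed.

Lemma measurable_mxinner d (A : 'M[R[i]]_d) (P : T -> 'M[R[i]]_d) :
  cmx_meas P -> measurable_fun setT (fun t => mxinner A (P t)).
Proof.
move=> mP; have -> : (fun t => mxinner A (P t)) = (fun t => \sum_i \sum_j
   (complex.Re (A j i) * complex.Re (P t j i) + complex.Im (A j i) * complex.Im (P t j i))).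
  apply/funext => t; rewrite /mxinner /mxtrace raddf_sum; apply: eq_bigr => i _ /=.
  rewrite mxE raddf_sum; apply: eq_bigr => j _ /=; rewrite adjE.
  by case: (A j i) => x y; case: (P t j i) => x' y' /=; ring.
apply: measurable_sum => i; apply: measurable_sum => j.
by apply: measurable_funD; apply: measurable_funM => //;
  [exact: cmx_meas_Re|exact: cmx_meas_Im].
Qed.
End one.
End meas.

(** * Privacy *)

Section index.
Variable d : nat.
Let dd := (d * d)%N.
Let m := (dd + dd + (dd + dd))%N.
Let M := (m + (dd + dd))%N.

(** The doubling is there because the real part of coordinate j of the sphere vector comes from the
    tape entry 2 j. *)
Definition gidx (b : bool) (i : 'I_d) (a : 'I_(d + d)) : nat :=
  (b * M + i * (d + d) + a).*2.

Definition sidx (b : bool) (j : 'I_m) : nat := (b * M + (dd + dd) + j).*2.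

Lemma gidx_lt (i : 'I_d) (a : 'I_(d + d)) : (i * (d + d) + a < dd + dd)%N.
Proof.
have -> : (dd + dd = d * (d + d))%N by rewrite mulnDr.
have : (i.+1 * (d + d) <= d * (d + d))%N by rewrite leq_mul2r ltn_ord orbT.
by rewrite mulSn; have := ltn_ord a; lia.
Qed.

Lemma gidx_inj b : (0 < d)%N -> forall i a i' a', gidx b i a = gidx b i' a' -> i = i' /\ a = a'.
Proof.
move=> d_gt0 i a i' a'; rewrite /gidx => /double_inj; rewrite -!addnA => /addnI e.
have q : (i : nat) = i'.
  have := congr1 (divn^~ (d + d)%N) e.
  by rewrite !divnMDl ?divn_small ?addn0// addn_gt0 d_gt0.
split; apply: ord_inj => //; move: e; rewrite q; exact: addnI.
Qed.

Lemma sidx_inj b : injective (sidx b).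
Proof. by move=> j j' /double_inj /addnI /ord_inj. Qed.

Lemma gidx_sidx b i a j : gidx b i a != sidx b j.
Proof. by apply/eqP => /double_inj; have := gidx_lt i a; lia. Qed.

Definition half_coords b : seq nat := scale_coords (sidx b) ++ gram_coords (gidx b).

Lemma half_coords_lt b j : (j \in half_coords b) -> (b * M <= j./2 < b * M + M)%N.
Proof.
rewrite mem_cat => /orP[/mapP[i _ ->]|/mapP[[i a] _ ->]]; rewrite /= doubleK /M.
  by have := ltn_ord i; lia.
by have := gidx_lt i a; rewrite /m; lia.
Qed.

Lemma half_coords_uniq b : (0 < d)%N -> uniq (half_coords b).
Proof.
move=> d_gt0; rewrite cat_uniq scale_coords_uniq; last exact: sidx_inj.
rewrite (gram_coords_uniq (@gidx_inj b d_gt0)) andbT /=; apply/hasPn => j jg.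
exact: (gram_notin_scale (@gidx_sidx b)) jg.
Qed.

Lemma half_coords_disj b b' j : b != b' -> j \in half_coords b -> j \notin half_coords b'.
Proof.
move=> bb jb; apply/negP => /half_coords_lt; have := half_coords_lt jb.
by case: b b' bb jb => [] [] //= _ _; rewrite ?mul1n ?mul0n; lia.
Qed.

End index.

(** * The mechanism as a function of the tape, and its privacy *)

Section mechanism.
Variables (R : realType) (d : nat) (eps : R).
Hypotheses (d_gt0 : (0 < d)%N) (eps_gt0 : 0 < eps).
Notation tape := (tape R).
Let dd := (d * d)%N.
Let m := (dd + dd + (dd + dd))%N.
Let M := (m + (dd + dd))%N.
Let L : R := scale d eps.
Notation gidx := (@gidx d).
Notation sidx := (@sidx d).
Notation half_coords := (@half_coords d).

Let m_gt0 : (0 < m)%N. Proof. by rewrite /m; have : (0 < dd)%N; [rewrite muln_gt0 d_gt0|lia]. Qed.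
Let L_gt0 : 0 < L.
Proof. by rewrite /L /scale divr_gt0// ltr0n -/dd; have := m_gt0; rewrite /m; lia. Qed.

Definition half_noise b := noise (gidx b) (sidx b) L.

Lemma half_noise_local b (z y : nat -> R) : {in half_coords b, z =1 y} -> half_noise b z = half_noise b y.
Proof.
move=> h; rewrite /half_noise /noise.
have -> : sqs (scale_coords (sidx b)) z = sqs (scale_coords (sidx b)) y.
  by apply: eq_big_seq => j jl; rewrite h// mem_cat jl.
have -> // : gram (gidx b) z = gram (gidx b) y.
apply/matrixP => i j; rewrite !gramE; apply: eq_bigr => a _.
by rewrite !h// mem_cat mem_gram_coords ?orbT.
Qed.

Definition mechmx (A : 'M[R[i]]_d) (z : nat -> R) : 'M[R[i]]_d :=
  A + map_mx (real_complex R) (half_noise false z) - map_mx (real_complex R) (half_noise true z).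

(* The normalization of the sphere vector cancels; this includes its junk value when all
   coordinates vanish. *)
Lemma noisyE A (z : nat -> R) : noisy z eps A = mechmx A z.
Proof.
rewrite /noisy /mechmx; suff h b : (scale d eps / sqnorm z d b) *: gramof z d b = half_noise b z.
  by rewrite !h.
set s := \sum_(i < (M + M).*2) z i ^+ 2.
pose t : R := 2 / Num.sqrt s.
have rE j : rnd z d j = t * z j.*2 by rewrite /rnd -/s mulrA mulrAC.
have gE : gramof z d b = t ^+ 2 *: gram (gidx b) z.
  apply/matrixP => i j; rewrite !mxE mulr_sumr; apply: eq_bigr => a _.
  by rewrite !rE !mxE /gidx -!/M; ring.
have sE : sqnorm z d b = t ^+ 2 * sqs (scale_coords (sidx b)) z.
  rewrite /sqnorm /sqs big_map big_enum mulr_sumr; apply: eq_bigr => j _.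
  by rewrite rE exprMn.
have [t0|tn] := eqVneq t 0; last first.
  rewrite gE sE scalerA /half_noise /noise; congr (_ *: _).
  have : t ^+ 2 != 0 by rewrite expf_neq0.
  move: (t ^+ 2) (sqs _ _) => T q T0.
  by rewrite -/L invfM (mulrC T^-1) mulrA mulfVK.
have s0 : s = 0.
  apply/eqP; move: t0; rewrite /t => /eqP; rewrite mulf_eq0 invr_eq0 sqrtr_eq0.
  rewrite pnatr_eq0/= => sle; rewrite eq_le sle/=.
  by apply: sumr_ge0 => *; exact: sqr_ge0.
have z0 j : (j < (M + M).*2)%N -> z j = 0.
  move=> jM; move: s0 => /psumr_eq0P h0.
  have /eqP := h0 (fun i _ => sqr_ge0 (z i)) (Ordinal jM) isT.
  by rewrite sqrf_eq0 => /eqP.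
rewrite gE t0 expr0n scale0r scaler0 /half_noise /noise.
have -> : gram (gidx b) z = 0.
  apply/matrixP => i j; rewrite gramE mxE big1// => a _.
  rewrite z0 ?mul0r// /gidx ltn_double; have := gidx_lt i a; rewrite /M /m.
  by case: (b); lia.
by rewrite scaler0.
Qed.

Lemma mx_meas_half_noise b : mx_meas (half_noise b).
Proof. exact: mx_meas_noise. Qed.

Variables (dg : diag_routine R) (k : nat).
Hypothesis hdg : exact_diag dg.

Lemma cmx_meas_map dT (T : measurableType dT) (A : 'M[R[i]]_d) (f : T -> 'M[R]_d) : mx_meas f ->
  cmx_meas (fun t => A + map_mx (real_complex R) (f t)).
Proof.
move=> mf; apply: cmx_measI => i j.
  have -> : (fun t => complex.Re ((A + map_mx (real_complex R) (f t)) i j)) =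
      (fun t => complex.Re (A i j) + f t i j).
    by apply/funext => t; rewrite !mxE; case: (A i j).
  by apply: measurable_funD => //; exact: mf.
have -> : (fun t => complex.Im ((A + map_mx (real_complex R) (f t)) i j)) =
    (fun=> complex.Im (A i j)).
  by apply/funext => t; rewrite !mxE; case: (A i j) => x y /=; rewrite addr0.
exact: measurable_cst.
Qed.

Lemma cmx_meas_mechmx A : cmx_meas (fun z : tape => mechmx A z).
Proof.
have -> : (fun z : tape => mechmx A z) =
    (fun z => A + map_mx (real_complex R) (half_noise false z + (-1) *: half_noise true z)).
  by apply/funext => z; rewrite /mechmx scaleN1r map_mxD map_mxN addrA.
apply: cmx_meas_map; apply: mx_meas_add; first exact: mx_meas_half_noise.
by apply: mx_meas_scale; [exact: measurable_cst|exact: mx_meas_half_noise].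
Qed.

Section privacy.
Local Open Scope ereal_scope.
Variable S : set 'M[R[i]]_d.
Hypothesis mS : mx_measurable S.

Definition event (B : 'M[R]_d) : \bar R :=
  (\1_S (topproj dg k (map_mx (real_complex R) B)) : R)%:E.

Lemma event_mnn : mx_mnn event.
Proof.
split=> [dT T f mf|B]; last by rewrite lee_fin.
have mt : cmx_meas (fun t => topproj dg k (0 + map_mx (real_complex R) (f t))).
  by apply: cmx_meas_topproj => //; exact: cmx_meas_map.
apply/measurable_EFinP.
have -> : (fun t => \1_S (topproj dg k (map_mx (real_complex R) (f t))) : R) =
    \1_((fun t => topproj dg k (0 + map_mx (real_complex R) (f t))) @^-1` S).
  apply/funext => t; rewrite !indicE; congr (nat_of_bool _)%:R.
  by apply/idP/idP; rewrite !inE /preimage /= add0r.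
apply: measurable_indic; exact: mt.
Qed.

(** The point [x] is only a base point: all coordinates that the event reads are integrated. *)
Definition prob (B : 'M[R]_d) (x : nat -> R) : \bar R :=
  gauss_int (half_coords false ++ half_coords true) (fun z : tape => event (B + half_noise false z - half_noise true z)%R) x.

Let half : R := (eps / 2)%R.

Lemma mx_mnn_comp (f : 'M[R]_d -> 'M[R]_d) (phi : 'M[R]_d -> \bar R) :
  (forall dT (T : measurableType dT) (g : T -> 'M[R]_d), mx_meas g -> mx_meas (f \o g)) ->
  mx_mnn phi -> mx_mnn (phi \o f).
Proof. by move=> hf [mp p0]; split=> [dT T g mg|N]; [exact: (mp _ _ _ (hf _ _ _ mg))|exact: p0]. Qed.

Let mnn_event (B : 'M[R]_d) : mnn (fun z : tape => event (B + half_noise false z - half_noise true z)%R).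
Proof.
split=> [|z]; last exact: event_mnn.2.
apply: (event_mnn.1 _ tape (fun z => B + half_noise false z - half_noise true z)%R).
have -> : (fun z : tape => B + half_noise false z - half_noise true z)%R =
    (fun z => B + (half_noise false z + (-1) *: half_noise true z))%R.
  by apply/funext => z; rewrite scaleN1r addrA.
apply: mx_meas_add; first exact: mx_meas_cst.
apply: mx_meas_add; first exact: mx_meas_half_noise.
by apply: mx_meas_scale; [exact: measurable_cst|exact: mx_meas_half_noise].
Qed.

Lemma half_noise_rank1_shift b (v : 'cV[R]_d) phi (x : tape) : mx_mnn phi ->
  (\sum_(i < d) v i 0 ^+ 2 <= 1)%R ->
  gauss_int (half_coords b) (fun z => phi (half_noise b z + v *m v^T)%R) x <=
  (expR half)%:E * gauss_int (half_coords b) (fun z => phi (half_noise b z)) x.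
Proof.
move=> mphi v1.
have mk : mx_mnn (fun X => phi X) by [].
apply: le_trans (@noise_rank1_shift R d m (gidx b) (sidx b) (@gidx_inj d b d_gt0) (@sidx_inj d b)
  (@gidx_sidx d b) m_gt0 L L_gt0 phi v x mphi) _.
apply: lee_wpmul2r; last first.
  rewrite lee_fin ler_expR /half /L /scale -/dd -/m -/M.
  have M0 : (0 < M%:R :> R)%R by rewrite ltr0n /M; lia.
  have -> : ((m + d * (d + d))%:R = M%:R :> R)%R by rewrite mulnDr.
  (* The choice L = M / eps is made for this cancellation. *)
  have -> : ((\sum_i v i 0 ^+ 2) * M%:R / (2 * (M%:R / eps)) = (\sum_i v i 0 ^+ 2) * (eps / 2))%R.
    by field; rewrite !gt_eqF.
  by rewrite -[leRHS]mul1r ler_wpM2r// divr_ge0// ltW.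
have : mnn (phi \o noise (gidx b) (sidx b) L).
  by split=> [|z]; [exact: (mphi.1 _ _ _ (@mx_meas_half_noise b))|exact: mphi.2].
by move=> /(mnn_gauss_int (half_coords b)) [_]; apply.
Qed.

Let agree_half_noise b b' (y z : nat -> R) : b != b' -> agree_off (half_coords b) y z -> half_noise b' z = half_noise b' y.
Proof.
by move=> bb h; apply: half_noise_local => j jb; rewrite h//; apply: half_coords_disj jb; rewrite eq_sym.
Qed.

Let disj b b' : b != b' -> {in half_coords b, forall j, j \notin half_coords b'}.
Proof. by move=> bb j jb; exact: half_coords_disj jb. Qed.

Let prob_perm B x : prob B x =
  gauss_int (half_coords true ++ half_coords false) (fun z : tape => event (B + half_noise false z - half_noise true z)%R) x.
Proof. by rewrite /prob (@gauss_int_perm _ _ (half_coords true ++ half_coords false))// perm_catC. Qed.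

(** Given X_2, the rank-one term is absorbed by X_1. *)
Lemma prob_add B (v : 'cV[R]_d) x : (\sum_(i < d) v i 0 ^+ 2 <= 1)%R ->
  prob (B + v *m v^T)%R x <= (expR half)%:E * prob B x.
Proof.
move=> v1; rewrite !prob_perm !(gauss_int_cat (disj (isT : true != false)))//.
have mg C : mnn (gauss_int (half_coords false) (fun z : tape => event (C + half_noise false z - half_noise true z)%R)).
  exact: mnn_gauss_int.
rewrite -gauss_intZl_cst ?expR_ge0//.
apply: gauss_int_le => //.
  split=> [|z]; last by rewrite mule_ge0 ?lee_fin ?expR_ge0//; case: (mg B).
  by apply: emeasurable_funM; [exact: measurable_cst|case: (mg B)].
move=> y _; pose phi X := event (B + X - half_noise true y)%R.
have mphi : mx_mnn phi.
  apply: (@mx_mnn_comp (fun X => B + X - half_noise true y)%R event) event_mnn => dT T g mg'.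
  by apply: mx_meas_add; [apply: mx_meas_add => //|]; exact: mx_meas_cst.
have := @half_noise_rank1_shift false v phi y mphi v1.
rewrite (gauss_int_eq (G := fun z => event (B + v *m v^T + half_noise false z - half_noise true z)%R)); last first.
  by move=> z /(agree_half_noise (isT : false != true)) e; rewrite /phi e [(half_noise false z + _)%R]addrC addrA.
by rewrite (gauss_int_eq (F := fun z => phi (half_noise false z)) (G := fun z => event (B + half_noise false z - half_noise true z)%R))// => z
  /(agree_half_noise (isT : false != true)) e; rewrite /phi e.
Qed.

(** Given X_1, the matrix B + X_1 - X_2 is (B + v v^T) + X_1 - (X_2 + v v^T), so the missing term is
    absorbed by X_2. *)
Lemma prob_sub B (v : 'cV[R]_d) x : (\sum_(i < d) v i 0 ^+ 2 <= 1)%R ->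
  prob B x <= (expR half)%:E * prob (B + v *m v^T)%R x.
Proof.
move=> v1; rewrite /prob !(gauss_int_cat (disj (isT : false != true)))//.
have mg C : mnn (gauss_int (half_coords true) (fun z : tape => event (C + half_noise false z - half_noise true z)%R)).
  exact: mnn_gauss_int.
rewrite -gauss_intZl_cst ?expR_ge0//.
apply: gauss_int_le => //.
  split=> [|z]; last by rewrite mule_ge0 ?lee_fin ?expR_ge0//; case: (mg (B + v *m v^T)%R).
  by apply: emeasurable_funM; [exact: measurable_cst|case: (mg (B + v *m v^T)%R)].
move=> y _; pose phi X := event (B + v *m v^T + half_noise false y - X)%R.
have mphi : mx_mnn phi.
  apply: (@mx_mnn_comp (fun X => B + v *m v^T + half_noise false y - X)%R event) event_mnn => dT T g mg'.
  have -> : ((fun X => B + v *m v^T + half_noise false y - X) \o g =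
     fun t => B + v *m v^T + half_noise false y + (-1) *: g t)%R.
    by apply/funext => t; rewrite /= scaleN1r.
  by apply: mx_meas_add; [exact: mx_meas_cst|apply: mx_meas_scale => //; exact: measurable_cst].
have := @half_noise_rank1_shift true v phi y mphi v1.
rewrite (gauss_int_eq (G := fun z => event (B + half_noise false z - half_noise true z)%R)); last first.
  move=> z /(agree_half_noise (isT : true != false)) e; rewrite /phi e; congr event.
  by rewrite opprD addrA addrAC [(B + v *m v^T + _)%R]addrAC addrK.
by rewrite (gauss_int_eq (F := fun z => phi (half_noise true z)) (G := fun z => event (B + v *m v^T + half_noise false z - half_noise true z)%R))// => z
  /(agree_half_noise (isT : true != false)) e; rewrite /phi e.
Qed.

Lemma prob_sum (I : Type) (s : seq I) (v : I -> 'cV[R]_d) B x :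
  (forall u, (\sum_(i < d) v u i 0 ^+ 2 <= 1)%R) ->
  prob (B + \sum_(u <- s) v u *m (v u)^T)%R x <= (expR (half * (size s)%:R))%:E * prob B x /\
  prob B x <= (expR (half * (size s)%:R))%:E * prob (B + \sum_(u <- s) v u *m (v u)^T)%R x.
Proof.
move=> v1; elim: s => [|u s [IH1 IH2]].
  by rewrite big_nil addr0 mulr0 expR0 mul1e.
rewrite big_cons [(v u *m _ + _)%R]addrC addrA.
have -> : expR (half * (size (u :: s))%:R) = (expR half * expR (half * (size s)%:R))%R.
  by rewrite -expRD; congr expR; rewrite /= -natr1; ring.
split.
  apply: le_trans (prob_add _ _ (v1 u)) _; rewrite EFinM -muleA.
  by apply: lee_wpmul2l => //; rewrite lee_fin expR_ge0.
apply: le_trans IH2 _; rewrite [(expR half * _)%R]mulrC EFinM -muleA.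
by apply: lee_wpmul2l; [rewrite lee_fin expR_ge0|exact: prob_sub].
Qed.

Section law.
Variables (disp : measure_display) (W : measurableType disp)
  (Pr : probability W R) (xi : nat -> {RV Pr >-> R}).
Hypothesis hxi : iid_normal xi.

Lemma prob_law B x : Pr ((fun w => topproj dg k
    (mechmx (map_mx (real_complex R) B) (fun j => xi j w))) @^-1` S) = prob B x.
Proof.
have mo : cmx_meas (fun w => topproj dg k (mechmx (map_mx (real_complex R) B) (fun j => xi j w))).
  apply: cmx_meas_topproj => // S' mS'.
  have mT : measurable_fun setT (fun w => (fun j => xi j w) : tape).
    by apply: measurable_tape => j; exact: measurable_funP.
  rewrite -[X in measurable X]setTI; apply: (mT measurableT _ (cmx_meas_mechmx _ mS')).
set A := _ @^-1` _; rewrite -(setIT A) -integral_indic//; last exact: mo.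
rewrite /prob -(integral_iid hxi (l := half_coords false ++ half_coords true)).
- apply: eq_integral => w _; rewrite /event !indicE; congr ((nat_of_bool _)%:R%:E).
  by apply/idP/idP; rewrite !inE /A /preimage /= /mechmx map_mxB map_mxD.
- rewrite cat_uniq !half_coords_uniq// andbT; apply/hasPn => j j1.
  exact: half_coords_disj (isT : true != false) j1.
- exact: mnn_event.
- move=> y y' yy.
  have e0 : {in half_coords false, y =1 y'} by move=> j jl; apply: yy; rewrite mem_cat jl.
  have e1 : {in half_coords true, y =1 y'} by move=> j jl; apply: yy; rewrite mem_cat jl orbT.
  by rewrite (half_noise_local e0) (half_noise_local e1).
Qed.

(** Both datasets are compared with their intersection. Each user of the symmetric difference costs
    a factor exp (eps / 2), however the two users are distributed over the two sides. *)
Lemma prob_neighbours_le (U : finType) (v : U -> 'cV[R]_d) (D D' : {set U}) :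
  unit_bounded v -> neighbours D D' ->
  Pr ((fun w => topproj dg k (mechmx (dataset_mx v D) (fun j => xi j w))) @^-1` S) <=
  (expR eps)%:E *
  Pr ((fun w => topproj dg k (mechmx (dataset_mx v D') (fun j => xi j w))) @^-1` S).
Proof.
move=> vb nb; pose x : tape := fun=> 0%R; rewrite !(prob_law _ x).
have v1 u : (\sum_(i < d) v u i 0 ^+ 2 <= 1)%R.
  have := vb u; set s := (\sum_(i < d) _)%R => h.
  have s0 : (0 <= s)%R by apply: sumr_ge0 => i _; exact: sqr_ge0.
  by rewrite -(sqr_sqrtr s0) exprn_ile1// sqrtr_ge0.
pose B := (\sum_(u in D :&: D') v u *m (v u)^T)%R.
have DE (E E' : {set U}) : (\sum_(u in E) v u *m (v u)^T = \sum_(u in E :&: E') v u *m (v u)^T +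
    \sum_(u <- enum (E :\: E')) v u *m (v u)^T)%R.
  rewrite (big_setID E')/=; congr (_ + _)%R.
  by rewrite [RHS]big_enum.
rewrite (DE D D') (DE D' D) finset.setIC.
set C := (\sum_(u in _) _)%R.
apply: le_trans (prob_sum _ _ _ v1).1 _.
have -> : expR eps = (expR (half * (size (enum (D :\: D')))%:R) *
    expR (half * (size (enum (D' :\: D)))%:R))%R.
  rewrite -expRD -mulrDr -natrD -!cardE.
  have <- : (#|(D :\: D') :|: (D' :\: D)| = #|D :\: D'| + #|D' :\: D|)%N.
    rewrite cardsU (_ : _ :&: _ = finset.set0) ?cards0 ?subn0//.
    by apply/setP => u; rewrite !inE; case: (u \in D); case: (u \in D').
  by rewrite nb /half; congr expR; lra.
rewrite EFinM -muleA; apply: lee_wpmul2l; first by rewrite lee_fin expR_ge0.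
exact: (prob_sum _ _ _ v1).2.
Qed.
End law.
End privacy.
End mechanism.

(** The terms [x0'] and [x1] have the favourable sign and are dropped; what remains is X_1 on the
    output and X_2 on the optimum. *)
Lemma le_of_noisy (R : realFieldType) (a0 a x0' x1' x0 x1 l0 l1 : R) :
  a0 + x0' - x1' <= a + x0 - x1 ->
  0 <= x0' -> 0 <= x1 -> x0 <= l0 -> x1' <= l1 -> a0 <= a + (l0 + l1).
Proof. lra. Qed.

(** * Utility *)

Section utility.
Variables (R : realType) (d : nat) (eps : R).
Hypotheses (d_gt0 : (0 < d)%N) (eps_gt0 : 0 < eps).
Notation tape := (tape R).
Local Open Scope sesquilinear_scope.
Variables (dg : diag_routine R) (k : nat).
Hypotheses (hdg : exact_diag dg) (kd : (k <= d)%N).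
Implicit Type A : 'M[R[i]]_d.

Let scale_ge0 : 0 <= scale d eps.
Proof. by rewrite /scale divr_ge0// ltW. Qed.

Definition loss (b : bool) (z : nat -> R) : R :=
  k%:R * (scale d eps / sqs (scale_coords (@sidx d b)) z * opbound (gmx (@gidx d b) z)).

Let sg_ge0 b z : 0 <= scale d eps / sqs (scale_coords (@sidx d b)) z.
Proof. by rewrite divr_ge0// sqs_ge0. Qed.

Lemma loss_ge0 b z : 0 <= loss b z.
Proof.
by apply: mulr_ge0; [exact: ler0n|apply: mulr_ge0; [exact: sg_ge0|exact: opbound_ge0]].
Qed.

Let X b z : 'M[R[i]]_d := map_mx (real_complex R) (@half_noise R d eps b z).

Let XE b z : X b z = map_mx (real_complex R) (scale d eps / sqs (scale_coords (@sidx d b)) z *: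
  (gmx (@gidx d b) z *m (gmx (@gidx d b) z)^T)).
Proof. by []. Qed.

Lemma X_adj b z : (X b z)^t* = X b z.
Proof.
apply/matrixP => i j; rewrite adjE XE ![map_mx _ _ _ _]mxE conjc_real; congr (_%:C).
rewrite [LHS]mxE [RHS]mxE; congr (_ * _); rewrite !mxE; apply: eq_bigr => a _.
by rewrite !mxE mulrC.
Qed.

Lemma mechmx_herm A z : A \is hermsymmx -> mechmx eps A z \is hermsymmx.
Proof.
move=> /hermsymmxP hA; apply/hermsymmxP; rewrite /mechmx -!/(X _ _).
move: (X_adj false z) (X_adj true z); move: (X false z) (X true z) => Y Z hY hZ.
have h (N : 'M[R[i]]_d) i j : N^t* = N -> conjc (N j i) = N i j by rewrite -adjE => ->.
by apply/matrixP => i j; rewrite adjE !mxE rmorphB rmorphD /= !h.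
Qed.

Lemma sum_qf_ge0 b z U (S : pred 'I_d) : 0 <= \sum_(c | S c) qf (X b z) U c.
Proof. by apply: sumr_ge0 => c _; rewrite XE; exact: qf_gram_ge0. Qed.

Lemma sum_qf_le b z U (S : pred 'I_d) : U \is unitarymx -> #|S| = k ->
  \sum_(c | S c) qf (X b z) U c <= loss b z.
Proof.
move=> Uu Sk; rewrite /loss -Sk mulr_natl -sumr_const; apply: ler_sum => c _.
by rewrite XE; exact: qf_gram_le.
Qed.

Lemma utility_le A gamma z : psdmx A -> eigenvalues_of A gamma ->
  \sum_(i < k) gamma`_i <=
  mxinner A (topproj dg k (mechmx eps A z)) + (loss false z + loss true z).
Proof.
move=> pA eA; have hA := pA.1; have /hermsymmxP hA' := hA.
apply: le_trans (eig_sum_le kd hdg hA eA) _.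
set H := mechmx eps A z; have hH : H \is hermsymmx by exact: mechmx_herm.
have /hermsymmxP hH' := hH.
have [hd _ _] := hdg; have [Vu AE] := hd _ _ hA; have [Uu HE] := hd _ _ hH.
rewrite /topproj; set V := (@dg d A).1 in Vu AE *; set U := (@dg d H).1 in Uu HE *.
set S' := topk (fun c => complex.Re ((@dg d A).2 0 c)) k.
set S := topk (fun c => complex.Re ((@dg d H).2 0 c)) k.
have Sk : #|S| = k by exact: card_topk.
have S'k : #|S'| = k by exact: card_topk.
have opt := mxinner_eig_le kd hH' Uu HE Vu S'k; rewrite -/S in opt.
rewrite !mxinner_uproj// in opt *.
have qH W (P : pred 'I_d) : \sum_(c | P c) qf H W c =
    \sum_(c | P c) qf A W c + \sum_(c | P c) qf (X false z) W c - \sum_(c | P c) qf (X true z) W c.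
  by rewrite -big_split -sumrB; apply: eq_bigr => c _; rewrite /H /mechmx !qfD qfN.
rewrite !qH in opt.
apply: le_of_noisy opt _ _ _ _.
- exact: sum_qf_ge0.
- exact: sum_qf_ge0.
- exact: (sum_qf_le false z Uu Sk).
- exact: (sum_qf_le true z Vu S'k).
Qed.

Lemma mxinner_ge0 A z : psdmx A -> 0 <= mxinner A (topproj dg k (mechmx eps A z)).
Proof.
move=> pA; have /hermsymmxP hA' := pA.1; rewrite mxinner_uproj//.
by apply: sumr_ge0 => c _; exact: qf_psd.
Qed.

Section law.
Local Open Scope ereal_scope.
Variables (disp : measure_display) (W : measurableType disp)
  (Pr : probability W R) (xi : nat -> {RV Pr >-> R}).
Hypothesis hxi : iid_normal xi.

Lemma mnn_loss b : mnn (fun z : tape => (loss b z)%:E).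
Proof.
apply: mnn_EFin => [|z]; last exact: loss_ge0.
apply: measurable_funM; first exact: measurable_cst.
apply: measurable_funM; last by apply: measurable_opbound.
apply: measurable_funM; first exact: measurable_cst.
by apply: measurable_funV_ge0 => [|x]; [exact: measurable_sqs|exact: sqs_ge0].
Qed.

(** G is integrated first with g frozen, so that the moments of |G|_op^2 and of 1 / |g|^2
    multiply. *)
Lemma gauss_int_loss b x : gauss_int (half_coords d b) (fun z : tape => (loss b z)%:E) x <=
  (4080 * ((d * k)%:R / eps))%:E.
Proof.
have gi : {in scale_coords (@sidx d b), forall j, j \notin gram_coords (@gidx d b)}.
  by apply: scale_notin_gram => i a j; exact: gidx_sidx.
rewrite /half_coords gauss_int_cat//; last exact: mnn_loss.
pose c : R := (k%:R * scale d eps * (1360 * d%:R))%R.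
have c0 : (0 <= c)%R by apply: mulr_ge0; [exact: mulr_ge0|rewrite -natrM ler0n].
have mi : mnn (fun z : tape => ((sqs (scale_coords (@sidx d b)) z)^-1)%:E).
  apply: mnn_EFin => [|z]; last by rewrite invr_ge0 sqs_ge0.
  by apply: measurable_funV_ge0 => [|y]; [exact: measurable_sqs|exact: sqs_ge0].
have mo : mnn (fun z : tape => (opbound (gmx (@gidx d b) z))%:E).
  by apply: mnn_EFin => [|z]; [exact: measurable_opbound|exact: opbound_ge0].
apply: (@le_trans _ _ (gauss_int (scale_coords (@sidx d b))
    (fun z : tape => c%:E * ((sqs (scale_coords (@sidx d b)) z)^-1)%:E) x)).
  apply: gauss_int_le.
  - exact/mnn_gauss_int/mnn_loss.
  - split=> [|z]; last by apply: mule_ge0; [rewrite lee_fin|case: mi].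
    by apply: emeasurable_funM; [exact: measurable_cst|case: mi].
  move=> y _; pose s : R := (k%:R * (scale d eps / sqs (scale_coords (@sidx d b)) y))%R.
  have s0 : (0 <= s)%R by rewrite mulr_ge0.
  rewrite (gauss_int_eq (G := fun z => s%:E * (opbound (gmx (@gidx d b) z))%:E)); last first.
    move=> z yz; rewrite -EFinM /loss /s mulrA.
    have -> // : sqs (scale_coords (@sidx d b)) z = sqs (scale_coords (@sidx d b)) y.
    by apply: eq_big_seq => j jl; rewrite yz//; exact: gi.
  rewrite gauss_intZl_cst//.
  apply: (@le_trans _ _ (s%:E * (1360 * d%:R)%:E)).
    apply: lee_wpmul2l; first by rewrite lee_fin.
    exact: (gauss_int_opbound d_gt0 (@gidx_inj d b d_gt0)).
  by rewrite -!EFinM lee_fin /c /s le_eqVlt; apply/orP; left; apply/eqP; ring.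
rewrite gauss_intZl_cst//.
have dd0 : (0 < d * d)%N by rewrite muln_gt0 d_gt0.
have [r rE] : exists r, (d * d + d * d = r.+2)%N.
  by exists (d * d + d * d - 2)%N; clear - dd0; lia.
apply: (@le_trans _ _ (c%:E * ((2 * r.+1%:R)^-1)%:E)).
  apply: lee_wpmul2l; first by rewrite lee_fin.
  apply: gauss_int_inv_sqs; first by apply: scale_coords_uniq; exact: sidx_inj.
  by rewrite size_scale_coords rE; lia.
rewrite -EFinM lee_fin /c /scale.
(* Since m = 4 d^2 = 2 (r + 2), the inverse moment is at most 1 / (2 (r + 1)), and r + 1 = 2 d^2 - 1
   >= d^2. *)
have r1 : (d%:R * d%:R <= r.+1%:R :> R)%R by rewrite -natrM ler_nat; clear - dd0 rE; lia.
have d0 : (0 < d%:R :> R)%R by rewrite ltr0n.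
have r0 : (0 < r.+1%:R :> R)%R by rewrite ltr0n.
rewrite !natrD !natrM ler_pdivrMr; last by rewrite mulr_gt0.
set D : R := d%:R in r1 d0 *.
(* L = 6 d^2 / eps and 6 * 1360 = 8160, which the 2 in the inverse moment halves. *)
have -> : (k%:R * ((D * D + D * D + (D * D + D * D) + (D * D + D * D)) / eps) * (1360 * D) =
   8160 * (D * k%:R / eps) * (D * D))%R by field; rewrite gt_eqF.
have h0 : (0 <= D * k%:R / eps)%R by rewrite divr_ge0 ?mulr_ge0 ?ler0n// ltW.
have := ler_wpM2l h0 r1.
lra.
Qed.

Lemma loss_law b : \int[Pr]_w (loss b (fun j => xi j w))%:E <= (4080 * ((d * k)%:R / eps))%:E.
Proof.
pose x : tape := fun=> 0%R.
rewrite (@integral_iid R _ _ _ _ hxi (half_coords d b) (fun z => (loss b z)%:E) x).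
- exact: gauss_int_loss.
- exact: half_coords_uniq d_gt0.
- exact: mnn_loss.
move=> y y' yy; rewrite /loss.
have -> : sqs (scale_coords (@sidx d b)) y = sqs (scale_coords (@sidx d b)) y'.
  by apply: eq_big_seq => j jl; rewrite yy// mem_cat jl.
have -> // : gmx (@gidx d b) y = gmx (@gidx d b) y'.
by apply/matrixP => i a; rewrite !mxE yy// mem_cat mem_gram_coords orbT.
Qed.

Lemma cmx_meas_out A : cmx_meas (fun w => topproj dg k (mechmx eps A (fun j => xi j w))).
Proof.
apply: cmx_meas_topproj => // S mS.
have mT : measurable_fun setT (fun w => (fun j => xi j w) : tape).
  by apply: measurable_tape => j; exact: measurable_funP.
by rewrite -[X in measurable X]setTI; apply: (mT measurableT _ (cmx_meas_mechmx eps A mS)).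
Qed.

Lemma utility A gamma delta : psdmx A -> eigenvalues_of A gamma -> (0 < delta)%R ->
  (8160 * ((d * k)%:R / eps) <= delta * \sum_(i < k) gamma`_i)%R ->
  ((1 - delta) * \sum_(i < k) gamma`_i)%:E <=
  \int[Pr]_w (mxinner A (topproj dg k (mechmx eps A (fun j => xi j w))))%:E.
Proof.
move=> pA eA dl0 hs; set s := (\sum_(i < k) _)%R in hs *.
pose f w := mxinner A (topproj dg k (mechmx eps A (fun j => xi j w))).
pose g b w := loss b (fun j => xi j w).
have mf : measurable_fun setT (fun w => (f w)%:E).
  by apply/measurable_EFinP; apply: measurable_mxinner; exact: cmx_meas_out.
have mT : measurable_fun setT (fun w => (fun j => xi j w) : tape).
  by apply: measurable_tape => j; exact: measurable_funP.
have mg b : measurable_fun setT (fun w => (g b w)%:E).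
  exact: (measurableT_comp (mnn_loss b).1 mT).
have f0 w : (0 <= (f w)%:E) by rewrite lee_fin mxinner_ge0.
have g0 b w : (0 <= (g b w)%:E) by rewrite lee_fin loss_ge0.
have h8 : (0 <= 8160 * ((d * k)%:R / eps))%R.
  apply: mulr_ge0; first exact: ler0n.
  by apply: divr_ge0; [exact: ler0n|exact: ltW].
have s0 : (0 <= s)%R by rewrite -(pmulr_rge0 _ dl0); exact: le_trans hs.
have : s%:E <= \int[Pr]_w (f w)%:E + (\int[Pr]_w (g false w)%:E + \int[Pr]_w (g true w)%:E).
  rewrite -ge0_integralD//.
  rewrite -ge0_integralD//; last 2 first.
  - by move=> w _; exact: adde_ge0.
  - by apply: emeasurable_funD; exact: mg.
  have -> : s%:E = \int[Pr]_w (s%:E).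
    rewrite integral_cst// -[LHS]mule1; congr (_ * _).
    by symmetry; exact: (probability_setT Pr).
  apply: ge0_le_integral => //.
  - by apply: emeasurable_funD => //; exact: emeasurable_funD.
  by move=> w _; rewrite -!EFinD lee_fin; exact: utility_le.
have h0 := loss_law false; have h1 := loss_law true.
move=> h; have {}h : s%:E <= \int[Pr]_w (f w)%:E + (8160 * ((d * k)%:R / eps))%:E.
  apply: (le_trans h); apply: leeD; first exact: lexx.
  apply: (le_trans (leeD h0 h1)).
  by rewrite -EFinD lee_fin -mulrDl; apply: ler_wpM2r; [rewrite divr_ge0// ltW|lra].
have {}h : s%:E <= \int[Pr]_w (f w)%:E + (delta * s)%:E.
  by apply: (le_trans h); apply: leeD; [exact: lexx|rewrite lee_fin].
by rewrite mulrBl mul1r EFinB leeBlDr.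
Qed.
End law.
End utility.

Theorem theorem1p5 (R : realType) :
  exists (C delta0 : R) (p : prog) (K e : nat),
  0 < C /\ 0 < delta0 /\
  forall (dg : diag_routine R), exact_diag dg ->
  forall (disp : measure_display) (W : measurableType disp)
    (Pr : probability W R) (xi : nat -> {RV Pr >-> R}), iid_normal xi ->
  let out (d k : nat) (A : 'M[R[i]]_d) (gamma : d.-tuple R)
      (eps delta : R) (w : W) : 'M[R[i]]_d :=
    output dg p k A gamma eps delta (fun j => xi j w) in
  forall (d k : nat) (eps delta : R),
  (1 <= k <= d)%N -> 0 < eps -> 0 < delta < delta0 ->
  [/\
    forall (A : 'M[R[i]]_d) (gamma : d.-tuple R),
      psdmx A -> eigenvalues_of A gamma ->
      (forall S, mx_measurable S ->
         measurable (out d k A gamma eps delta @^-1` S)) /\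
      {ae Pr, forall w, rank_proj k (out d k A gamma eps delta w)},
    forall (A : 'M[R[i]]_d) (gamma : d.-tuple R),
      psdmx A -> eigenvalues_of A gamma -> 0 < gamma`_d.-1 ->
      C * ((d * k)%:R / (eps * delta)) * ln (1 / delta)
        <= \sum_(i < k) gamma`_i ->
      (((1 - delta) * \sum_(i < k) gamma`_i)%:E
        <= 'E_Pr[fun w => mxinner A (out d k A gamma eps delta w)])%E,
    forall (U : finType) (v : U -> 'cV[R]_d) (D D' : {set U})
      (gamma gamma' : d.-tuple R),
      unit_bounded v -> neighbours D D' ->
      eigenvalues_of (dataset_mx v D) gamma ->
      eigenvalues_of (dataset_mx v D') gamma' ->
      forall S : set 'M[R[i]]_d, mx_measurable S ->
      (Pr (out d k (dataset_mx v D) gamma eps delta @^-1` S)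
        <= (expR eps)%:E *
           Pr (out d k (dataset_mx v D') gamma' eps delta @^-1` S))%E
    & forall (A : 'M[R[i]]_d) (gamma : d.-tuple R) (q : d.-tuple rat),
      psdmx A -> eigenvalues_of A gamma -> 0 < gamma`_d.-1 ->
      gamma = map_tuple ratr q ->
      {ae Pr, forall w,
        halts_within dg p k A gamma eps delta (fun j => xi j w)
          (K%:R * (1 + (gamma`_0 - gamma`_d.-1) + 1 / eps + (bits q)%:R)
                ^+ e)} ].
Proof.
(* 8160 = 2 * 4080 bounds the two expected losses together. For delta < exp (-1) the factor ln (1 /
   delta) is at least 1, so the assumed lower bound on the eigenvalue sum implies the one required
   by [utility]. The cost of a run is at most 1000 d^3. *)
exists 8160, (expR (-1)), mech_prog, 1000%N, 3%N.
split; first exact: ltr0n.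
split; first exact: expR_gt0.
move=> dg hdg disp W Pr xi hxi out d k eps delta /andP[k1 kd] eps0 /andP[dl0 dl1].
have d0 : (0 < d)%N by exact: leq_trans kd.
have outE A gamma w : out d k A gamma eps delta w =
    topproj dg k (mechmx eps A (fun j => xi j w)).
  have [s [sE oE]] := output_runs (@runs_mech R dg (fun j => xi j w) d k eps d0 A gamma delta).
  by rewrite -(noisyE d0 eps0) -sE -oE.
have outE' A gamma : out d k A gamma eps delta =
    (fun w => topproj dg k (mechmx eps A (fun j => xi j w))).
  by apply/funext => w; exact: outE.
split.
- move=> A gamma pA eA; split=> [S mS|].
    by rewrite outE'; exact: cmx_meas_out.
  apply: aeW => w; rewrite outE.
  have [hd _ _] := hdg.
  have [Uu _] := hd _ _ (mechmx_herm eps (fun j => xi j w) pA.1).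
  rewrite /topproj -[X in rank_proj X _](card_topk (fun c => complex.Re ((dg d (mechmx eps A (fun j => xi j w))).2 0 c)) kd).
  exact: rank_proj_uproj.
- move=> A gamma pA eA g0 hs; rewrite outE'; set g := (1 - delta) * _; rewrite unlock {}/g.
  apply: (utility d0 eps0 hdg kd hxi pA eA dl0).
  have ln1 : 1 <= ln (1 / delta).
    rewrite -[leLHS]expRK ler_ln ?posrE ?expR_gt0 ?divr_gt0//.
    rewrite ler_pdivlMr// -[leRHS](_ : expR 1 * expR (-1) = 1).
      by rewrite ler_pM2l ?expR_gt0// ltW.
    by rewrite -expRD subrr expR0.
  rewrite -ler_pdivrMl//; apply: (le_trans _ hs).
  set c : R := 8160; have c0 : 0 <= c by exact: ler0n.
  clearbody c; set q : R := (d * k)%:R; have q0 : 0 <= q by exact: ler0n.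
  have -> : delta^-1 * (c * (q / eps)) = c * (q / (eps * delta)) by field; rewrite !gt_eqF.
  by rewrite ler_peMr// mulr_ge0// divr_ge0// mulr_ge0// ltW.
- move=> U v D D' gamma gamma' vb nb eA eA' S mS; rewrite !outE'.
  exact: prob_neighbours_le.
- move=> A gamma q pA eA g0 gq; apply: aeW => w.
  have [s [t [E le _]]] := @runs_mech R dg (fun j => xi j w) d k eps d0 A gamma delta.
  exists s, t; split; first exact: E.
  (* Every eigenvalue takes at least one bit, so a cost bound in terms of d suffices. *)
  have db : (d <= bits q)%N.
    rewrite /bits -[leqLHS](size_tuple q) -sum1_size; apply: leq_sum => x _.
    by rewrite /rat_bits addn1.
  have gg : 0 <= gamma`_0 - gamma`_d.-1.
    rewrite subr_ge0; have [_ srt] := eA.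
    have tr : transitive (fun x y : R => y <= x) by move=> x y z xy yz; exact: le_trans yz xy.
    have rf : reflexive (fun x y : R => y <= x) by move=> x; exact: lexx.
    by apply: (sorted_leq_nth tr rf 0 srt) => //; rewrite inE size_tuple// ltn_predL.
  have b0 : 0 <= 1 + (gamma`_0 - gamma`_d.-1) + 1 / eps.
    by apply: addr_ge0; [apply: addr_ge0|apply/ltW/divr_gt0].
  apply: (@le_trans _ _ (1000%:R * (d%:R ^+ 3))).
    by rewrite -natrX -natrM ler_nat.
  apply: ler_wpM2l; first exact: ler0n.
  apply: lerXn2r; rewrite ?nnegrE ?ler0n//; first exact: addr_ge0.
  apply: (@le_trans _ _ (bits q)%:R); first by rewrite ler_nat.
  by rewrite lerDr.
Qed.
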